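(* Let $r\ge 1$ be a fixed integer. For every $n=1,2,\ldots$ let $(X_{n,t})_{t=1}^{\infty}$ be a strictly stationary sequence of real random variables satisfying the absolute regularity condition with coefficients $\beta_n(t)$, i.e. $\beta_n(t)\downarrow 0$ as $t\to\infty$ for each $n$. For every $n$ let $\{f_{n;j_1,\ldots,j_r}: 1\le j_1,\ldots,j_r\le n\}$ be a family of measurable functions $\mathbb{R}^r\to\mathbb{R}$ with $|f_{n;j_1,\ldots,j_r}|\le F_n<\infty$, and put $$V_n=\sum_{j_1,\ldots,j_r=1}^{n} f_{n;j_1,\ldots,j_r}(X_{n,j_1},\ldots,X_{n,j_r}),\qquad V_n^*=\frac{V_n-\mathbf{E}V_n}{\sqrt{\mathbf{D}V_n}},$$ where $\mathbf{D}V_n>0$. Suppose there are a sequence of positive integers $(m_n)$ and a number $b_0\in(0,2/3]$ such that for all $b\in(0,b_0]$ $$\frac{F_n^2\, m_n^{2-b}\, n^{2(r-1)+b}\, r^{4-2b}}{\mathbf{D}V_n}+\bigl(\beta_n(m_n)\bigr)^{b}\,\frac{F_n^{2}\, n^{2r}}{\mathbf{D}V_n}\longrightarrow 0\qquad (n\to\infty).$$ Then, as $n\to\infty$, the moments and the distribution function of $V_n^*$ converge to the moments and the distribution function of the standard normal law; that is, for every integer $k\ge 1$, $\mathbf{E}(V_n^* )^k\to\mathbf{E}N^k$ with $N\sim\mathcal N(0,1)$, and $\mathbf{P}(V_n^*\le x)\to\mathbf{P}(N\le x)$ for every $x\in\mathbb{R}$.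
   Context: $\mathbf{E}$ and $\mathbf{D}$ denote expectation and variance. The distribution of the sequence $(X_{n,t})_{t\ge1}$, the functions $f_{n;j_1,\ldots,j_r}$, and the numbers $F_n$, $m_n$ may all depend on $n$ (triangular array scheme). Strict stationarity: for all $k\ge1$ and $t_1,\ldots,t_k,\tau\ge 1$, the vectors $(X_{n,t_1+\tau},\ldots,X_{n,t_k+\tau})$ and $(X_{n,t_1},\ldots,X_{n,t_k})$ have the same distribution. Absolute regularity: the stationary sequence $(X_{n,t})_{t\ge 1}$ is extended (in law) to a two-sided stationary sequence indexed by $t\in\mathbb{Z}$, $\mathcal F_a^b$ denotes the $\sigma$-algebra generated by $X_{n,t}$, $a\le t\le b$, and $$\beta_n(t)=\mathbf{E}\Bigl\{\sup_{A\in\mathcal F_t^{\infty}}\bigl|\mathbf{P}\{A\mid\mathcal F_{-\infty}^{0}\}-\mathbf{P}\{A\}\bigr|\Bigr\},\qquad t=1,2,\ldots,$$ the supremum being understood as an essential supremum. The sequence satisfies the absolute regularity condition if $\beta_n(t)\downarrow0$ as $t\to\infty$. *)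

(* Defs.v *)
From HB Require Import structures.
From mathcomp Require Import all_boot all_order all_algebra.
From mathcomp Require Import all_classical all_reals all_analysis measurable_realfun.

Set Implicit Arguments.
Unset Strict Implicit.
Unset Printing Implicit Defensive.

Import Order.TTheory GRing.Theory Num.Theory.
Import numFieldNormedType.Exports.

Local Open Scope classical_set_scope.
Local Open Scope ring_scope.

Definition at_times {I T E : Type} (X : I -> T -> E) (k : nat)
    (t : k.-tuple I) : T -> k.-tuple E :=
  fun w => map_tuple (fun s => X s w) t.

(* [k.-tuple R] carries the product sigma-algebra, i.e. the Borel sets of R^k;
   the two vectors may live on different probability spaces. *)
Definition same_law {d d' d0} {T : measurableType d} {T' : measurableType d'}
    {S : measurableType d0} {R : realType} (P : probability T R)
    (Q : probability T' R) (U : T -> S) (W : T' -> S) : Prop :=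
  forall B : set S, measurable B -> P (U @^-1` B) = Q (W @^-1` B).

(* A one-sided sequence (X_t)_{t >= 1} is a [nat]-indexed one whose term of
   index 0 is never used. *)
Definition strictly_stationary {d} {T : measurableType d} {R : realType}
    (P : probability T R) (X : nat -> {RV P >-> R}) : Prop :=
  forall (k : nat) (t : k.-tuple nat) (tau : nat),
    (1 <= k)%N -> (forall i, (1 <= tnth t i)%N) -> (1 <= tau)%N ->
    same_law P P (at_times X (map_tuple (fun s => (s + tau)%N) t))
                 (at_times X t).

Definition strictly_stationary_two_sided {d} {T : measurableType d}
    {R : realType} (P : probability T R) (Y : int -> {RV P >-> R}) : Prop :=
  forall (k : nat) (t : k.-tuple int) (tau : int), (1 <= k)%N ->
    same_law P P (at_times Y (map_tuple (fun s => s + tau) t)) (at_times Y t).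

(* Y, possibly on another probability space, is a two-sided stationary
   sequence whose restriction to t >= 1 has the same law as (X_t)_{t >= 1}. *)
Definition two_sided_extension {d d'} {T : measurableType d}
    {T' : measurableType d'} {R : realType} (P : probability T R)
    (X : nat -> {RV P >-> R}) (Q : probability T' R)
    (Y : int -> {RV Q >-> R}) : Prop :=
  strictly_stationary_two_sided Y /\
  forall (k : nat) (t : k.-tuple nat),
    (1 <= k)%N -> (forall i, (1 <= tnth t i)%N) ->
    same_law Q P (at_times Y (map_tuple Posz t)) (at_times X t).

Definition sigma_generated {d} {T : measurableType d} {R : realType}
    (P : probability T R) (Y : int -> {RV P >-> R}) (D : set int) :
    set (set T) :=
  <<s \bigcup_(s in D) preimage_set_system setT (Y s) measurable >>.

(* c is a version of the conditional probability P(A | G), where G is a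
   sub-sigma-algebra of the measurable sets of T. *)
Definition is_cond_prob {d} {T : measurableType d} {R : realType}
    (P : probability T R) (G : set (set T)) (A : set T) (c : T -> R) : Prop :=
  [/\ (forall B : set R, measurable B -> G (c @^-1` B)),
      P.-integrable setT (EFin \o c) &
      forall B, G B -> (\int[P]_(w in B) (c w)%:E = P (A `&` B))%E].

(* h is the essential supremum of the (possibly uncountable) family S of
   functions: the almost surely smallest measurable function dominating almost
   surely each member of S. It is unique up to almost sure equality. *)
Definition is_ess_sup_family {d} {T : measurableType d} {R : realType}
    (P : probability T R) (S : set (T -> \bar R)) (h : T -> \bar R) : Prop :=
  [/\ measurable_fun setT h,
      (forall g, S g -> {ae P, forall w, (g w <= h w)%E}) &
      forall h' : T -> \bar R, measurable_fun setT h' ->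
        (forall g, S g -> {ae P, forall w, (g w <= h' w)%E}) ->
        {ae P, forall w, (h w <= h' w)%E}].

Definition cond_prob_deviations {d} {T : measurableType d} {R : realType}
    (P : probability T R) (G H : set (set T)) : set (T -> \bar R) :=
  [set g | exists A c, [/\ H A, is_cond_prob P G A c &
             g = fun w => (`|c w - fine (P A)|)%:E]].

(* b = E{ esssup_{A in F_t^oo} |P(A | F_{-oo}^0) - P(A)| } *)
Definition is_beta_coef {d} {T : measurableType d} {R : realType}
    (P : probability T R) (Y : int -> {RV P >-> R}) (t : nat) (b : R) : Prop :=
  exists h : T -> \bar R,
    is_ess_sup_family P
      (cond_prob_deviations P (sigma_generated Y [set s : int | s <= 0])
                              (sigma_generated Y [set s : int | t%:Z <= s]))
      h /\
    b%:E = (\int[P]_w h w)%E.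

(* beta 1, beta 2, ... are the absolute regularity coefficients of the
   stationary sequence (X_t)_{t >= 1}; they are determined by the law of X, so
   any two-sided extension gives the same numbers. beta 0 is unconstrained. *)
Definition abs_regularity_coefs {d} {T : measurableType d} {R : realType}
    (P : probability T R) (X : nat -> {RV P >-> R}) (beta : nat -> R) : Prop :=
  exists (d' : measure_display) (T' : measurableType d')
         (Q : probability T' R) (Y : int -> {RV Q >-> R}),
    two_sided_extension X Y /\
    forall t : nat, (1 <= t)%N -> is_beta_coef Y t (beta t).

Definition decreases_to_0 {R : realType} (beta : nat -> R) : Prop :=
  (forall s t : nat, (1 <= s <= t)%N -> beta t <= beta s) /\
  beta t @[t --> \oo] --> (0 : R).

(* The multi-index (j_1, ..., j_r), 1 <= j_i <= n, is an r-tuple over 'I_n;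
   the ordinal i < n stands for the time i + 1. *)
Definition multi_sum {T : Type} {R : realType} {r n : nat} (X : nat -> T -> R)
    (f : r.-tuple 'I_n -> r.-tuple R -> R) : T -> R :=
  fun w => \sum_(j : r.-tuple 'I_n)
             f j (at_times X (map_tuple (fun i : 'I_n => i.+1) j) w).

Definition standardized {d} {T : measurableType d} {R : realType}
    (P : probability T R) (V : T -> R) : T -> R :=
  fun w => (V w - fine ('E_P[V])%E) / Num.sqrt (fine ('V_P[V])%E).

(* Main.v *)
(* With sigma^2 = D V, the variable V^* is a sum of n^r centred terms y_j, bounded
   by 2 F / sigma. Absolute regularity bounds by O(beta(m)) the error made by
   factoring the expectation of a product over two sets of times at distance at
   least m, even interlaced ones: the runs of times are replaced one by one by
   independent copies. Call two multi-indices adjacent if they contain times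
   closer than m. A joint cumulant of k terms is then O(beta(m)) unless the terms
   are connected, and there are O((m n^(r-1))^(k-1) n^r) connected k-families.
   The resulting bound on the k-th cumulant of V^* is controlled by the power k / 2
   of the quantity assumed to tend to 0 with b = 2 / k, so all cumulants of order
   at least 2 / b0 vanish in the limit.

   Those of order between 3 and 2 / b0 vanish as well (Janson): otherwise, after
   rescaling and extraction of a limit, there would be a positive moment sequence
   whose cumulant generating function is a polynomial of degree at least 3, which
   is impossible (Marcinkiewicz). So the moments converge to those of the normal
   law. As |y|^k / k! bounds the Taylor remainders of cosines, expectations of
   trigonometric polynomials converge, and indicators of half-lines are
   sandwiched between trigonometric polynomials up to a small multiple of
   1 + (x - c)^2. *)

Require Import Defs.
From HB Require Import structures.
From mathcomp Require Import all_boot all_order all_algebra.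
From mathcomp Require Import ring lra zify.

Set Implicit Arguments.
Unset Strict Implicit.
Unset Printing Implicit Defensive.

Import Order.TTheory GRing.Theory Num.Theory.

Local Open Scope ring_scope.

(** * Joint cumulants *)

(** Cumulants of small order escape the direct bound because the assumption provides exponents up to
    [b0] only, while order k calls for b = 2 / k; this forces the detour through Marcinkiewicz's
    theorem. That theorem is applied to a limit of moment sequences, of which only positivity on
    squares of polynomials is known; no representing measure is constructed. With M the moment
    series and p the cumulant polynomial, |M(z)| <= M(Re z) comes from testing positivity on
    truncations of Re (exp (i phi) exp (z x / 2)), whose square has a closed form. Complex values
    are carried by pairs of real power series along a ray. Limits are taken along an ultrafilter,
    since infinitely many sequences must converge at once. On the probabilistic side multi-indices
    interlace, so mixing is needed for arbitrary bounded functions of past and future, not only for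
    products. It is drawn from the essential supremum through finite partitions of the past with one
    future event per cell; sets with finitely many sections have exactly this shape, and they
    approximate all measurable sets of the product. *)

Section JointCumulants.
Context {R : realFieldType} {k : nat}.
Implicit Types (e : {set 'I_k} -> R) (S C A : {set 'I_k}).

(** Quantifying over the least elements of [S], instead of choosing one, keeps the condition
    meaningful for the empty set, where it is vacuous. *)
Definition contains_min S C : bool :=
  [forall a in S, [forall b in S, (a <= b)%N] ==> (a \in C)].

Definition cumulant_blocks S C : bool := (C \subset S) && contains_min S C.

(** This is the moment-cumulant formula grouped by the block [C] that holds the least element of
    [S]: summing over the partitions of the rest gives back the moment [e (S :\: C)], so partitions
    never appear. The argument [m] is fuel for a recursion on the cardinality. *)
Fixpoint joint_cumulant_rec (m : nat) e S : R :=
  if m is m'.+1 then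
    e S - \sum_(C | cumulant_blocks S C && (C != S))
            joint_cumulant_rec m' e C * e (S :\: C)
  else 0.

Definition joint_cumulant e S : R := joint_cumulant_rec #|S|.+1 e S.

Lemma contains_minE S C a : a \in S -> (forall b, b \in S -> a <= b)%N ->
  contains_min S C = (a \in C).
Proof.
move=> aS amin; apply/forall_inP/idP => [h|aC b bS].
  by apply: (implyP (h a aS)); apply/forall_inP => b bS; exact: amin.
apply/implyP => /forall_inP h; suff -> : b = a by [].
by apply/val_inj/eqP; rewrite eqn_leq h// amin.
Qed.

Lemma exists_min S : S != set0 ->
  exists2 a, a \in S & forall b, b \in S -> (a <= b)%N.
Proof.
move=> /set0Pn[a0 a0S].
by case: (arg_minnP (fun i : 'I_k => i : nat) a0S) => a aS amin; exists a.
Qed.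

Lemma joint_cumulant_recE (m m' : nat) e S : (#|S| < m)%N -> (#|S| < m')%N ->
  joint_cumulant_rec m e S = joint_cumulant_rec m' e S.
Proof.
elim: m m' S => // m IH [//|m'] S Sm Sm' /=; congr (_ - _).
apply: eq_bigr => C /andP[/andP[CS _] CnS]; congr (_ * _).
have CpS : (#|C| < #|S|)%N by apply: proper_card; rewrite properEneq CnS.
by apply: IH; apply: (leq_trans CpS); rewrite -ltnS.
Qed.

Lemma joint_cumulantE e S : joint_cumulant e S =
  e S - \sum_(C | cumulant_blocks S C && (C != S))
          joint_cumulant e C * e (S :\: C).
Proof.
rewrite {1}/joint_cumulant /=; congr (_ - _).
apply: eq_bigr => C /andP[/andP[CS _] CnS]; congr (_ * _).
have CpS : (#|C| < #|S|)%N by apply: proper_card; rewrite properEneq CnS.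
exact: joint_cumulant_recE.
Qed.

Lemma joint_cumulant_sum e S : e set0 = 1 -> S != set0 ->
  e S = \sum_(C | cumulant_blocks S C) joint_cumulant e C * e (S :\: C).
Proof.
move=> e0 S0; rewrite (bigD1 S)/=; last first.
  have [a aS amin] := exists_min S0.
  by rewrite /cumulant_blocks subxx (contains_minE _ aS amin) aS.
by rewrite setDv e0 mulr1 joint_cumulantE subrK.
Qed.

(** The recursion has at most [2 ^+ k] blocks, plus the leading moment; [B] is the price of one more
    element of [S]. *)
Let B : R := 1 + 2 ^+ k.

Let B1 : 1 <= B. Proof. by rewrite lerDl exprn_ge0. Qed.

Let sum_le (P : pred {set 'I_k}) (F : {set 'I_k} -> R) (M : R) : 0 <= M ->
  (forall C, P C -> F C <= M) -> \sum_(C | P C) F C <= 2 ^+ k * M.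
Proof.
move=> M0 FM; apply: (@le_trans _ _ (\sum_(C in powerset [set: 'I_k]) M)).
  rewrite big_mkcond [leRHS]big_mkcond; apply: ler_sum => C _.
  by rewrite powersetE subsetT; case: ifP => // /FM.
by rewrite sumr_const card_powerset cardsT card_ord -[in leLHS]mulr_natl natrX.
Qed.

Section bounds.
Variables (e : {set 'I_k} -> R) (K : R).
Hypothesis K0 : 0 <= K.
Hypothesis e1 : e set0 = 1.
Hypothesis eK : forall S, `|e S| <= K ^+ #|S|.

Lemma joint_cumulant_le S : S != set0 ->
  `|joint_cumulant e S| <= B ^+ #|S| * K ^+ #|S|.
Proof.
have [m] := ubnP #|S|; elim: m S => // m IH S Sm S0.
have [a aS amin] := exists_min S0.
have S1 : (0 < #|S|)%N by rewrite card_gt0.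
rewrite joint_cumulantE; apply: (le_trans (ler_normB _ _)).
apply: (@le_trans _ _ (K ^+ #|S| + 2 ^+ k * (B ^+ #|S|.-1 * K ^+ #|S|))).
  apply: lerD => //; apply: (le_trans (ler_norm_sum _ _ _)); apply: sum_le.
    by rewrite mulr_ge0// exprn_ge0// (le_trans ler01).
  move=> C /andP[/andP[CS]]; rewrite (contains_minE _ aS amin) => aC CnS.
  have CpS : (#|C| < #|S|)%N by apply: proper_card; rewrite properEneq CnS.
  rewrite normrM -(cardsID C S) (setIidPr CS) [in leRHS]exprD mulrA.
  apply: ler_pM => //; apply: (le_trans (IH C _ _)).
  - by apply: (leq_trans CpS).
  - by apply/set0Pn; exists a.
  - rewrite ler_wpM2r ?exprn_ge0// ler_weXn2l//.
    by move: CpS; rewrite -(cardsID C S) (setIidPr CS); lia.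
rewrite mulrA -[X in X + _]mul1r -mulrDl ler_wpM2r ?exprn_ge0//.
rewrite -[in leRHS](prednK S1) exprS /B mulrDl mul1r lerD2r.
by rewrite exprn_ege1.
Qed.

(** Were the factorization over [A] exact, the blocks inside [A] would rebuild
    [e (S :&: A) * e (S :\: A)] and cancel [e S]. The other blocks meet both sides, and induction
    applies to them. An approximate factorization adds an error of order [delta] to each term. *)
Lemma joint_cumulant_split_le (A : {set 'I_k}) (delta : R) : 0 <= delta ->
  (forall S, `|e S - e (S :&: A) * e (S :\: A)| <= delta * K ^+ #|S|) ->
  forall S, S :&: A != set0 -> S :\: A != set0 ->
  `|joint_cumulant e S| <= delta * ((2 * B) ^+ #|S| * K ^+ #|S|).
Proof.
move=> delta0 eA S.
have [m] := ubnP #|S|; elim: m S => // m IH S Sm SA SD.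
(* Exchanging [A] with its complement puts the least element of [S] in [A]; then every block meets
   [A]. *)
wlog : A eA IH SA SD / exists2 a, a \in S :&: A & forall b, b \in S -> (a <= b)%N.
  move=> hw; have [|a aS amin] := @exists_min S.
    by apply: contraNneq SA => ->; rewrite set0I.
  have [aA|aA] := boolP (a \in A).
    by apply: (hw A) => //; exists a => //; rewrite inE aS.
  have SIC (T : {set 'I_k}) : T :\: ~: A = T :&: A by rewrite setDE setCK.
  apply: (hw (~: A)).
  - by move=> T; rewrite SIC -setDE mulrC; exact: eA.
  - by move=> T Tm; rewrite SIC -setDE => T1 T2; exact: IH.
  - by rewrite -setDE.
  - by rewrite SIC.
  - by exists a => //; rewrite !inE aS.
move=> [a]; rewrite inE => /andP[aS aA] amin.
have S1 : (0 < #|S|)%N by rewrite card_gt0; apply/set0Pn; exists a.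
have B0 : 0 <= B := le_trans ler01 B1.
have B2 : 1 <= 2 * B by apply: (le_trans B1); rewrite ler_peMl// ler1n.
have aSA : a \in S :&: A by rewrite inE aS.
have aminA b : b \in S :&: A -> (a <= b)%N by rewrite inE => /andP[/amin].
(* As [S :\: A] is not empty, no block inside [A] equals [S]; these blocks are exactly those of
   [S :&: A]. *)
have main : \sum_(C | cumulant_blocks S C && (C != S) && (C \subset A))
    joint_cumulant e C * e (S :&: A :\: C) = e (S :&: A).
  rewrite [RHS]joint_cumulant_sum//; apply: eq_bigl => C.
  rewrite /cumulant_blocks subsetI !(contains_minE _ aSA aminA).
  rewrite (contains_minE _ aS amin).
  have [CA|] := boolP (C \subset A); last by rewrite !andbF.
  rewrite !andbT; case: eqP => [CS|_]; last by rewrite andbT.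
  by move: SD; rewrite -CS setD_eq0 CA.
have split C : C \subset A ->
    (S :\: C) :&: A = S :&: A :\: C /\ (S :\: C) :\: A = S :\: A.
  move=> CA; split; first by rewrite setIDAC.
  by rewrite setDDl (setUidPr CA).
pose M := delta * ((2 * B) ^+ #|S|.-1 * K ^+ #|S|).
have M0 : 0 <= M by rewrite mulr_ge0// mulr_ge0// exprn_ge0// mulr_ge0.
have BB j : B ^+ j <= (2 * B) ^+ j by rewrite lerXn2r ?nnegrE ?mulr_ge0// ler_peMl// ler1n.
have cSle C : C \subset S -> C != S -> (#|C| <= #|S|.-1)%N.
  move=> CS CnS; have : (#|C| < #|S|)%N by apply: proper_card; rewrite properEneq CnS.
  by move=> h; rewrite -ltnS (prednK S1).
have KS C : C \subset S -> K ^+ #|S| = K ^+ #|C| * K ^+ #|S :\: C|.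
  by move=> CS; rewrite -exprD -(cardsID C S) (setIidPr CS).
have -> : joint_cumulant e S = (e S - e (S :&: A) * e (S :\: A))
   - \sum_(C | cumulant_blocks S C && (C != S) && (C \subset A)) joint_cumulant e C *
       (e (S :\: C) - e ((S :\: C) :&: A) * e ((S :\: C) :\: A))
   - \sum_(C | cumulant_blocks S C && (C != S) && ~~ (C \subset A))
       joint_cumulant e C * e (S :\: C).
  rewrite joint_cumulantE (bigID (fun C => C \subset A))/= -{1}main mulr_suml.
  rewrite opprD addrA; congr (_ - _); rewrite -!addrA; congr (_ + _).
  rewrite -opprD; congr (- _); rewrite -big_split/=; apply: eq_bigr => C /andP[_ CA].
  by have [-> ->] := split C CA; ring.
(* There are two sums over blocks here instead of one, whence [2 * B] in place of [B]. *)
apply: (@le_trans _ _ (delta * K ^+ #|S| + 2 ^+ k * M + 2 ^+ k * M)).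
  apply: (le_trans (ler_normB _ _)); apply: lerD.
    apply: (le_trans (ler_normB _ _)); apply: lerD => //.
    apply: (le_trans (ler_norm_sum _ _ _)); apply: sum_le => // C.
    move=> /andP[/andP[/andP[CS]]]; rewrite (contains_minE _ aS amin) => aC CnS CA.
    have [_ dE] := split C CA; have := eA (S :\: C); rewrite dE => eAC.
    have C0 : C != set0 by apply/set0Pn; exists a.
    rewrite normrM.
    apply: (@le_trans _ _ ((B ^+ #|C| * K ^+ #|C|) * (delta * K ^+ #|S :\: C|))).
      by apply: ler_pM => //; exact: joint_cumulant_le.
    rewrite -mulrA [K ^+ _ * _]mulrCA -KS// mulrCA ler_wpM2l//.
    rewrite ler_wpM2r ?exprn_ge0//; apply: le_trans (BB _).
    by rewrite ler_weXn2l// cSle.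
  apply: (le_trans (ler_norm_sum _ _ _)); apply: sum_le => // C.
  move=> /andP[/andP[/andP[CS]]]; rewrite (contains_minE _ aS amin) => aC CnS CA.
  have CA1 : C :&: A != set0 by apply/set0Pn; exists a; rewrite inE aC.
  rewrite normrM.
  apply: (@le_trans _ _ (delta * ((2 * B) ^+ #|C| * K ^+ #|C|) * K ^+ #|S :\: C|)).
    apply: ler_pM => //; apply: IH => //; last by rewrite setD_eq0.
    by apply: (leq_ltn_trans (cSle C CS CnS)); rewrite (prednK S1) -ltnS.
  rewrite -!mulrA -KS// ler_wpM2l// ler_wpM2r ?exprn_ge0// ler_weXn2l ?cSle//.
have -> : delta * K ^+ #|S| + 2 ^+ k * M + 2 ^+ k * M =
  (delta * K ^+ #|S|) * (1 + 2 * 2 ^+ k * (2 * B) ^+ #|S|.-1) by rewrite /M; ring.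
rewrite [_ ^+ #|S| * K ^+ #|S|]mulrC mulrA ler_wpM2l ?mulr_ge0 ?exprn_ge0//.
rewrite -[in leRHS](prednK S1) exprS.
have -> : 2 * B = 2 + 2 * 2 ^+ k by rewrite /B mulrDr mulr1.
have h1 : 1 <= (2 + 2 * 2 ^+ k) ^+ #|S|.-1 :> R.
  apply: exprn_ege1; apply: (@le_trans _ _ 2); first by rewrite ler1n.
  by rewrite lerDl mulr_ge0// exprn_ge0.
rewrite [leRHS]mulrDl lerD2r; apply: (le_trans h1).
by rewrite ler_peMl ?ler1n// (le_trans ler01 h1).
Qed.
End bounds.
End JointCumulants.

(** * Averages over independent uniform indices *)

Section RandomIndices.
Context {R : realFieldType} {k : nat} {J : finType}.
Implicit Types (S C A : {set 'I_k}) (j : {ffun 'I_k -> J}).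

Definition depends_on {W : Type} S (f : {ffun 'I_k -> J} -> W) : Prop :=
  forall j j', {in S, j =1 j'} -> f j = f j'.

Lemma sum_indep S (f g : {ffun 'I_k -> J} -> R) :
  depends_on S f -> depends_on (~: S) g ->
  (\sum_j f j) * (\sum_j g j) = (#|J| ^ k)%:R * \sum_j f j * g j.
Proof.
move=> fS gS.
pose mix (p : {ffun 'I_k -> J} * {ffun 'I_k -> J}) :=
  ([ffun i => if i \in S then p.1 i else p.2 i],
   [ffun i => if i \in S then p.2 i else p.1 i]).
have mixK : involutive mix.
  case=> j j'; congr (_, _); apply/ffunP => i; rewrite !ffunE; case: ifP => iS;
  by rewrite ?ffunE ?iS.
rewrite big_distrlr/= pair_bigA/= (reindex_inj (inv_inj mixK))/=.
under eq_bigr => p _.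
  rewrite (fS _ p.1) => [|i iS]; last by rewrite ffunE iS.
  rewrite (gS _ p.1) => [|i iS]; last by rewrite ffunE; move: iS; rewrite inE => /negPf ->.
  over.
rewrite -(pair_bigA _ (fun x y => f x * g x))/= mulr_sumr; apply: eq_bigr => j _.
by rewrite sumr_const card_ffun card_ord mulr_natl.
Qed.

Section family.
Variables (e : {ffun 'I_k -> J} -> {set 'I_k} -> R).
Hypothesis eS : forall S, depends_on S (e^~ S).

Lemma joint_cumulant_depends S : depends_on S (fun j => joint_cumulant (e j) S).
Proof.
have [m] := ubnP #|S|; elim: m S => // m IH S Sm j j' jj'.
rewrite !joint_cumulantE (eS jj'); congr (_ - _).
apply: eq_bigr => C /andP[/andP[CS _] CnS].
have CpS : (#|C| < #|S|)%N by apply: proper_card; rewrite properEneq CnS.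
congr (_ * _).
  apply: IH; first exact: (leq_trans CpS).
  by move=> i iC; apply: jj'; exact: (subsetP CS).
by apply: eS => i; rewrite inE => /andP[_ iS]; exact: jj'.
Qed.

Variable ebar : {set 'I_k} -> R.
Hypothesis sum_e : forall S, \sum_j e j S = (#|J| ^ k)%:R * ebar S.
Hypothesis J0 : (0 < #|J|)%N.

(** Multilinearity of cumulants in averaged form: [C] and [S :\: C] use disjoint coordinates, so
    their averages multiply and averaging commutes with the recursion. *)
Lemma sum_joint_cumulant S :
  \sum_j joint_cumulant (e j) S = (#|J| ^ k)%:R * joint_cumulant ebar S.
Proof.
have [m] := ubnP #|S|; elim: m S => // m IH S Sm.
rewrite (eq_bigr _ (fun j _ => joint_cumulantE (e j) S)) joint_cumulantE.
rewrite sumrB sum_e mulrBr; congr (_ - _).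
rewrite exchange_big/= mulr_sumr; apply: eq_bigr => C /andP[/andP[CS _] CnS].
have CpS : (#|C| < #|S|)%N by apply: proper_card; rewrite properEneq CnS.
have N0 : (#|J| ^ k)%:R != 0 :> R by rewrite pnatr_eq0 -lt0n expn_gt0 J0.
apply: (mulfI N0); rewrite -(@sum_indep C).
- by rewrite IH ?sum_e ?(leq_trans CpS)//; ring.
- exact: joint_cumulant_depends.
- move=> j j' jj'; apply: eS => i; rewrite inE => /andP[iC _].
  by apply: jj'; rewrite inE.
Qed.

End family.
End RandomIndices.

(** * Cumulants of a single variable *)

Section Exchangeable.
Context {R : realFieldType}.

(* [kap 0] is unconstrained. *)
Definition cumulants_of (mu kap : nat -> R) : Prop :=
  forall k, mu k.+1 =
    \sum_(j < k.+1) 'C(k, j)%:R * kap j.+1 * mu (k - j)%N.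

(** Since [mu 0 = 1], the term [j = k] of the recursion isolates the new cumulant. The list [ks n]
    holds the cumulants of orders 1 to [n], and [next] computes the following one. *)
Lemma cumulants_of_exists (mu : nat -> R) : mu 0%N = 1 ->
  exists kap, cumulants_of mu kap.
Proof.
move=> mu0.
pose next (s : seq R) (n : nat) :=
  mu n.+1 - \sum_(j < n) 'C(n, j)%:R * s`_j * mu (n - j)%N.
pose ks := fix ks n := if n is n'.+1 then rcons (ks n') (next (ks n') n') else [::].
have sz n : size (ks n) = n by elim: n => //= n IH; rewrite size_rcons IH.
have nthks n j : (j < n)%N -> (ks n)`_j = next (ks j) j.
  elim: n => // n IH; rewrite ltnS leq_eqVlt /= nth_rcons sz => /orP[/eqP->|jn].
    by rewrite ltnn eqxx.
  by rewrite jn IH.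
exists (fun k => next (ks k.-1) k.-1) => k.
rewrite big_ord_recr/= subnn mu0 binn mulr1 mul1r /next addrCA.
rewrite -[LHS]addr0; congr (_ + _); apply/esym/eqP; rewrite subr_eq0; apply/eqP.
by apply: eq_bigr => j _; rewrite nthks.
Qed.

Lemma sum_subset_card (T : finType) (A : {set T}) (F : nat -> R) :
  \sum_(C : {set T} | C \subset A) F #|C| =
  \sum_(j < #|A|.+1) 'C(#|A|, j)%:R * F j.
Proof.
have h (C : {set T}) : C \subset A -> (#|C| < #|A|.+1)%N by move=> CA; rewrite ltnS subset_leq_card.
rewrite (partition_big (fun C : {set T} => inord #|C| : 'I_#|A|.+1) xpredT)//=.
apply: eq_bigr => j _; rewrite -cards_draws mulr_natl -sumr_const.
rewrite [RHS](eq_bigl (fun C : {set T} => (C \subset A) && (inord #|C| == j))).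
  apply: eq_bigr => C /andP[CA /eqP <-]; by rewrite inordK// h.
move=> C; rewrite inE; have [CA|//] := boolP (C \subset A).
by rewrite -val_eqE /= inordK// h.
Qed.

(** A block is the least element [a] together with an arbitrary subset of [S :\ a]; counting these
    subsets by size turns the recursion over sets into the binomial one. *)
Lemma joint_cumulant_card (k : nat) (mu kap : nat -> R) : mu 0%N = 1 ->
  cumulants_of mu kap -> forall S : {set 'I_k}, S != set0 ->
  joint_cumulant (fun S : {set 'I_k} => mu #|S|) S = kap #|S|.
Proof.
move=> mu0 hk S; have [m] := ubnP #|S|; elim: m S => // m IH S Sm S0.
have [a aS amin] := exists_min S0.
pose N := #|S :\ a|.
have SN : #|S| = N.+1 by rewrite (cardsD1 a S) aS.
have e0 : (fun S : {set 'I_k} => mu #|S|) set0 = 1 by rewrite /= cards0.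
have := @joint_cumulant_sum _ _ (fun S : {set 'I_k} => mu #|S|) S e0 S0.
rewrite (bigD1 S)/=; last first.
  by rewrite /cumulant_blocks subxx (contains_minE _ aS amin).
rewrite setDv cards0 mu0 mulr1.
under eq_bigr => C /andP[/andP[CS]].
  rewrite (contains_minE _ aS amin) => aC CnS.
  have CpS : (#|C| < #|S|)%N by apply: proper_card; rewrite properEneq CnS.
  rewrite IH; [|exact: (leq_trans CpS)|by apply/set0Pn; exists a].
  rewrite cardsD (setIidPr CS); over.
move=> /= /eqP; rewrite -subr_eq => /eqP <-.
have : mu #|S| = \sum_(C | cumulant_blocks S C) kap #|C| * mu (#|S| - #|C|)%N.
  rewrite [in LHS]SN hk; under eq_bigr do rewrite -mulrA.
  rewrite -(sum_subset_card (S :\ a) (fun j => kap j.+1 * mu (N - j)%N)).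
  rewrite (reindex_onto (fun C => C :\ a) (fun C => a |: C))/=; last first.
    by move=> C CS; rewrite setU1K//; apply: contraTN CS => aC; apply/subsetPn; exists a; rewrite // !inE eqxx.
  apply: eq_big => C.
    rewrite /cumulant_blocks (contains_minE _ aS amin) subsetD1 !inE eqxx andbT.
    apply/andP/andP => [[CS /eqP aC]|[CS aC]].
      have aC' : a \in C by rewrite -aC !inE eqxx.
      by split => //; rewrite -(setD1K aC') subUset sub1set aS.
    by split; [exact: subset_trans (subD1set _ _) CS|rewrite setD1K].
  move=> /andP[_ /eqP aC].
  have aC' : a \in C by rewrite -aC !inE eqxx.
  by rewrite (cardsD1 a C) aC' SN add1n subSS.
rewrite (bigD1 S)/=; last first.
  by rewrite /cumulant_blocks subxx (contains_minE _ aS amin).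
by rewrite subnn mu0 mulr1 => ->; rewrite addrK.
Qed.

End Exchangeable.

(** * Connected families of indices *)

Section CountingConnected.
Context {k' : nat} {J : finType}.
Local Notation k := k'.+1.
Variables (adj : rel J) (D : nat).
Hypothesis adjD : forall x, (#|[pred y | adj x y]| <= D)%N.
Implicit Types (A : {set 'I_k}) (j : {ffun 'I_k -> J}).

(** Stated by a cut rather than by paths: the cut is what the factorization estimate consumes, and
    its absence is what lets a set of indices grow. *)
Definition disconnected j : bool :=
  [exists A : {set 'I_k}, [&& A != set0, A != setT &
    [forall p in A, forall q in ~: A, ~~ adj (j p) (j q)]]].

(* [grown m j A]: starting from one index, A is reached by adding m indices, each
   adjacent to one that is already there. *)
Fixpoint grown (m : nat) j A : bool :=
  if m is m'.+1 then
    [exists p, exists q, [&& p \in A, q \in A :\ p, adj (j q) (j p)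
                           & grown m' j (A :\ p)]]
  else #|A| == 1%N.

Lemma grown_depends m A : depends_on A (grown m ^~ A).
Proof.
elim: m A => //= m IH A j j' jj'.
apply: eq_existsb => p; apply: eq_existsb => q.
have [pA|] := boolP (p \in A); last by [].
have [qA|] := boolP (q \in A :\ p); last by [].
rewrite !jj'//; last by move: qA; rewrite inE => /andP[].
rewrite (IH (A :\ p) j j')// => i; rewrite inE => /andP[_ iA]; exact: jj'.
Qed.

(** With the other indices fixed, at most [D] of the [#|J|] values at [p] are adjacent to [j q]. The
    involution [h] redraws the index at [p] by exchanging it with an auxiliary value. *)
Lemma card_adj_coord (p q : 'I_k) (phi : pred {ffun 'I_k -> J}) : q != p ->
  depends_on (~: [set p]) phi ->
  (#|[set j | phi j && adj (j q) (j p)]| * #|J| <= D * #|[set j | phi j]|)%N.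
Proof.
move=> qp phip.
pose h (u : {ffun 'I_k -> J} * J) :=
  ([ffun i => if i == p then u.2 else u.1 i], u.1 p).
have hK : involutive h.
  case=> j y; congr (_, _); last by rewrite /= ffunE eqxx.
  by apply/ffunP => i; rewrite !ffunE; case: eqP => // ->.
pose F (u : {ffun 'I_k -> J} * J) : nat := phi u.1 && adj (u.1 q) u.2.
have -> : (#|[set j | phi j && adj (j q) (j p)]| * #|J| = \sum_u F (h u))%N.
  rewrite -sum1dep_card big_distrl/= big_mkcond/=.
  rewrite -(pair_bigA _ (fun j y => F (h (j, y))))/=; apply: eq_bigr => j _.
  rewrite (eq_bigr (fun=> (phi j && adj (j q) (j p) : nat))) => [|y _].
    by rewrite sum_nat_const mul1n; case: ifP => _; rewrite ?muln1 ?muln0.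
  rewrite /F /= ffunE (negPf qp) (phip _ j)// => i; rewrite !inE => ip.
  by rewrite ffunE (negPf ip).
have -> : (\sum_u F (h u) = \sum_u F u)%N.
  by rewrite [RHS](reindex_inj (inv_inj hK)).
rewrite -(pair_bigA _ (fun j y => F (j, y)))/=.
rewrite -sum1dep_card big_distrr/= [leqRHS]big_mkcond/=; apply: leq_sum => j _.
rewrite /F /=; case: (phi j) => /=; last by rewrite big1.
rewrite muln1; apply: leq_trans (adjD (j q)); rewrite -sum1_card [leqRHS]big_mkcond/=.
by apply: leq_sum => y _; rewrite inE; case: (adj _ _).
Qed.

(** The added index and its neighbour are chosen in at most [k ^ 2] ways, and each adjacency retains
    at most the proportion [D] over [#|J|] of all families. *)
Lemma card_grown m A :
  (#|[set j | grown m j A]| * #|J| ^ m <= (k ^ 2 * D) ^ m * #|J| ^ k)%N.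
Proof.
elim: m A => [|m IH] A.
  rewrite !expn0 muln1 mul1n -[X in (_ <= _ ^ X)%N]card_ord -card_ffun.
  exact: max_card.
have le1 : (#|[set j | grown m.+1 j A]| <= \sum_p \sum_(q | q != p)
    #|[set j | grown m j (A :\ p) && adj (j q) (j p)]|)%N.
  rewrite -sum1dep_card big_mkcond/=.
  under [leqRHS]eq_bigr => p _ do under eq_bigr => q _ do rewrite -sum1dep_card big_mkcond/=.
  under [leqRHS]eq_bigr do rewrite exchange_big/=.
  rewrite exchange_big/=; apply: leq_sum => j _.
  case: ifP => // /existsP[p /existsP[q /and4P[pA]]].
  rewrite inE in_set1 => /andP[qp qA] a g.
  by rewrite (bigD1 p)//= (bigD1 q)//= g a.
have le2 p q : q != p ->
    (#|[set j | grown m j (A :\ p) && adj (j q) (j p)]| * #|J| ^ m.+1 <=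
    D * ((k ^ 2 * D) ^ m * #|J| ^ k))%N.
  move=> qp; rewrite expnS mulnA.
  have h := @card_adj_coord p q (grown m ^~ (A :\ p)) qp.
  apply: (@leq_trans (D * #|[set j | grown m j (A :\ p)]| * #|J| ^ m)).
    rewrite leq_mul2r h ?orbT// => j j' jj'; apply: grown_depends => i.
    by rewrite !inE => /andP[ip _]; apply: jj'; rewrite !inE.
  by rewrite -mulnA leq_mul2l IH orbT.
apply: (leq_trans (leq_mul le1 (leqnn _))); rewrite big_distrl/=.
apply: (@leq_trans (\sum_(p : 'I_k) \sum_(q : 'I_k) D * ((k ^ 2 * D) ^ m * #|J| ^ k))%N).
  apply: leq_sum => p _; rewrite big_distrl/= big_mkcond/=; apply: leq_sum => q _.
  by case: ifP => // /le2.
rewrite !sum_nat_const !card_ord (expnS _ m); apply: eq_leq; move: (_ ^ m)%N (_ ^ k)%N => X Y; ring.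
Qed.

(** As long as the set reached is not everything, it is not a cut, so some adjacency leaves it; [k']
    additions exhaust the indices. *)
Lemma connected_grown j : ~~ disconnected j -> grown k' j setT.
Proof.
move=> /existsPn conn.
have h m : (m < k)%N -> exists2 A : {set 'I_k}, #|A| = m.+1 & grown m j A.
  elim: m => [|m IH] mk.
    by exists [set ord0]; rewrite /= ?cards1.
  have [A Am gA] := IH (ltnW mk).
  have A0 : A != set0 by rewrite -card_gt0 Am.
  have AT : A != setT.
    by apply: contraTneq mk => AT; rewrite -Am AT cardsT card_ord ltnn.
  have := conn A; rewrite A0 AT/= => /forallPn[q]; rewrite negb_imply => /andP[qA].
  move=> /forallPn[p]; rewrite negb_imply negbK inE => /andP[pA a].
  exists (p |: A); first by rewrite cardsU1 pA Am.
  apply/existsP; exists p; apply/existsP; exists q.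
  have qp : q != p by apply: contraNneq pA => <-.
  by apply/and4P; split => //; rewrite ?setU1K// !inE ?eqxx ?qp.
have [A Ak] := h k' (ltnSn _).
suff -> : A = setT by [].
by apply/eqP; rewrite eqEcard subsetT cardsT card_ord Ak leqnn.
Qed.

Lemma card_connected :
  (#|[set j | ~~ disconnected j]| <= (k ^ 2 * D) ^ k' * #|J|)%N.
Proof.
have [J0|J0] := posnP #|J|.
  rewrite J0 muln0 leqn0 -leqn0 (leq_trans (max_card _))//.
  by rewrite card_ffun card_ord J0 exp0n.
rewrite -(@leq_pmul2r (#|J| ^ k')) ?expn_gt0 ?J0// -mulnA -expnS.
apply: leq_trans (card_grown k' setT); rewrite leq_mul2r; apply/orP; right.
by apply/subset_leq_card/subsetP => j; rewrite !inE; exact: connected_grown.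
Qed.

End CountingConnected.

(** * Cumulants of a sum of weakly dependent terms *)

Section CumulantBound.
Context {R : realFieldType} {k' : nat} {J : finType}.
Local Notation k := k'.+1.
Implicit Types (S A : {set 'I_k}) (j : {ffun 'I_k -> J}).
Variables (adj : rel J) (D : nat).
Hypothesis adjD : forall x, (#|[pred y | adj x y]| <= D)%N.
Variables (e : {ffun 'I_k -> J} -> {set 'I_k} -> R) (K delta : R).
Hypothesis K0 : 0 <= K.
Hypothesis delta0 : 0 <= delta.
Hypothesis eS : forall S, depends_on S (e^~ S).
Hypothesis e1 : forall j, e j set0 = 1.
Hypothesis eK : forall j S, `|e j S| <= K ^+ #|S|.
Hypothesis eA : forall j (A : {set 'I_k}),
  (forall p q, p \in A -> q \notin A -> ~~ adj (j p) (j q)) ->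
  forall S, `|e j S - e j (S :&: A) * e j (S :\: A)| <= delta * K ^+ #|S|.
Variables (mu kap : nat -> R).
Hypothesis mu0 : mu 0%N = 1.
Hypothesis mukap : cumulants_of mu kap.
Hypothesis J0 : (0 < #|J|)%N.
Hypothesis sum_e : forall S,
  #|J|%:R ^+ #|S| * \sum_(j : {ffun 'I_k -> J}) e j S = #|J|%:R ^+ k * mu #|S|.

Lemma cumulant_sum_le : `|kap k| <= (2 * (1 + 2 ^+ k)) ^+ k * K ^+ k *
  ((k ^ 2 * D)%:R ^+ k' * #|J|%:R + delta * #|J|%:R ^+ k).
Proof.
set N : R := #|J|%:R; have N0 : N != 0 by rewrite pnatr_eq0 -lt0n.
have N0' : 0 <= N by [].
have ST : [set: 'I_k] != set0 by apply/set0Pn; exists ord0.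
have cT : #|[set: 'I_k]| = k by rewrite cardsT card_ord.
(* By [sum_e], the average of [e j S] over [j] is the moment of order [#|S|] of the sum divided by
   [#|J|]. Hence the powers of [N^-1], which the factor [#|J| ^ k] compensates at order k. *)
have kapE : kap k = \sum_j joint_cumulant (e j) setT.
  rewrite (@sum_joint_cumulant _ _ _ e eS (fun S => N^-1 ^+ #|S| * mu #|S|))//; last first.
    move=> S; rewrite natrX -/N mulrCA -sum_e mulrA -exprMn mulVf// expr1n mul1r//.
  rewrite (@joint_cumulant_card _ _ (fun i => N^-1 ^+ i * mu i) (fun i => N^-1 ^+ i * kap i))//.
  - by rewrite cT natrX mulrA -exprMn divff// expr1n mul1r.
  - by rewrite expr0 mul1r.
  - move=> n; rewrite mukap mulr_sumr; apply: eq_bigr => i _.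
    have -> : N^-1 ^+ n.+1 = N^-1 ^+ i.+1 * N^-1 ^+ (n - i).
      by rewrite -exprD addSn subnKC// -ltnS.
    by ring.
set B : R := (2 * (1 + 2 ^+ k)) ^+ k.
have B0 : 0 <= B by rewrite exprn_ge0// mulr_ge0// addr_ge0// exprn_ge0.
have hB : (1 + 2 ^+ k) ^+ k <= B.
  rewrite lerXn2r ?nnegrE ?mulr_ge0 ?addr_ge0 ?exprn_ge0//.
  by rewrite ler_peMl ?ler1n// addr_ge0// exprn_ge0.
rewrite kapE (bigID (@disconnected k' J adj))/= addrC mulrDr.
apply: (le_trans (ler_normD _ _)); apply: lerD.
  apply: (@le_trans _ _ (\sum_(j | ~~ disconnected adj j) B * K ^+ k)).
    apply: (le_trans (ler_norm_sum _ _ _)); apply: ler_sum => j _.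
    have := joint_cumulant_le K0 (eK j) ST; rewrite cT => /le_trans; apply.
    by rewrite ler_wpM2r// exprn_ge0.
  rewrite sumr_const -[leLHS]mulr_natr ler_wpM2l ?(mulr_ge0 B0) ?exprn_ge0//.
  rewrite /N -natrX -natrM ler_nat -cardsE; exact: card_connected.
apply: (@le_trans _ _ (\sum_(j | disconnected adj j) B * K ^+ k * delta)).
  apply: (le_trans (ler_norm_sum _ _ _)); apply: ler_sum => j.
  move=> /existsP[A /and3P[A0 AT /forall_inP hA]].
  have hA' p q : p \in A -> q \notin A -> ~~ adj (j p) (j q).
    by move=> pA qA; apply: (forall_inP (hA p pA)); rewrite inE.
  have := @joint_cumulant_split_le _ _ _ _ K0 (e1 j) (eK j) A delta delta0 (eA hA') setT.
  have AC : ~: A != set0 by apply: contraNneq AT => h; rewrite -(setCK A) h setC0.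
  rewrite setTI setTD cT => /(_ A0 AC) /le_trans; apply.
  by rewrite mulrC.
rewrite sumr_const -[leLHS]mulr_natr -mulrA ler_wpM2l ?(mulr_ge0 B0) ?exprn_ge0//.
rewrite ler_wpM2l// /N -natrX ler_nat -[X in (_ <= _ ^ X)%N]card_ord -card_ffun.
exact: max_card.
Qed.

End CumulantBound.

(** * Multi-indices with close times *)

Section CloseTuples.
Variables (r n m : nat).

(** Distance less than [m], written with two additions to avoid truncated subtraction. *)
Definition close_tuples : rel (r.-tuple 'I_n) := fun j j' =>
  [exists p : 'I_r, exists q : 'I_r,
     (tnth j p < tnth j' q + m)%N && (tnth j' q < tnth j p + m)%N].

Lemma card_close_ord (x : nat) : (#|[pred i : 'I_n | (x < i + m)%N && (i < x + m)%N]| <= m.*2)%N.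
Proof.
rewrite cardE -(size_map val) -(size_iota (x - m) m.*2).
apply: uniq_leq_size; first by rewrite map_inj_uniq ?enum_uniq//; exact: val_inj.
move=> y /mapP[i]; rewrite mem_enum inE => /andP[h1 h2] ->; rewrite mem_iota -addnn /=; clear -h1 h2; lia.
Qed.

Lemma card_tuple_coord (C : pred 'I_n) (q : 'I_r) :
  #|[pred j : r.-tuple 'I_n | C (tnth j q)]| = (#|C| * n ^ r.-1)%N.
Proof.
pose G (i : 'I_r) (t : 'I_n) : nat := if i == q then C t : nat else 1%N.
have -> : #|[pred j : r.-tuple 'I_n | C (tnth j q)]| =
    #|[pred f : {ffun 'I_r -> 'I_n} | C (f q)]|.
  rewrite -(card_image (f := fun j : r.-tuple 'I_n => [ffun i => tnth j i])); last first.
    by move=> j j' /ffunP h; apply: eq_from_tnth => i; have := h i; rewrite !ffunE.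
  apply: eq_card => f; rewrite inE; apply/imageP/idP => [[j]|Cf].
    by rewrite inE => Cj ->; rewrite ffunE.
  exists [tuple f i | i < r]; first by rewrite inE tnth_mktuple.
  by apply/ffunP => i; rewrite ffunE tnth_mktuple.
have -> : #|[pred f : {ffun 'I_r -> 'I_n} | C (f q)]| =
    (\sum_(f : {ffun 'I_r -> 'I_n}) \prod_i G i (f i))%N.
  rewrite -sum1_card [RHS](bigID (fun f : {ffun 'I_r -> 'I_n} => C (f q)))/=.
  rewrite [X in _ = (_ + X)%N]big1 ?addn0 => [|f /negPf Cf]; last first.
    by rewrite (bigD1 q)//= /G eqxx Cf mul0n.
  apply: eq_bigr => f Cf; rewrite big1// => i _; rewrite /G; case: eqP => // ->.
  by move: Cf; rewrite inE => ->.
rewrite -(bigA_distr_bigA G) (bigD1 q)//=; congr (_ * _)%N.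
  rewrite /G eqxx -sum1_card [RHS]big_mkcond; apply: eq_bigr => t _.
  by rewrite unfold_in; case: (C t).
rewrite (eq_bigr (fun=> n)) => [|i /negPf iq]; last first.
  by rewrite /G iq sum1_card card_ord.
by rewrite prod_nat_const; congr (n ^ _)%N; rewrite cardC1 card_ord.
Qed.

(** The positions of the two close times are chosen in [r ^ 2] ways; then one coordinate of [j'] has
    at most [m.*2] values and the others are free. *)
Lemma card_close_tuples (j : r.-tuple 'I_n) :
  (#|[pred j' | close_tuples j j']| <= r ^ 2 * (m.*2 * n ^ r.-1))%N.
Proof.
pose E (p q : 'I_r) := [pred j' : r.-tuple 'I_n |
  (tnth j p < tnth j' q + m)%N && (tnth j' q < tnth j p + m)%N].
apply: (@leq_trans (\sum_(p : 'I_r) \sum_(q : 'I_r) #|E p q|)).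
  rewrite -sum1_card; apply: (@leq_trans (\sum_(j' : r.-tuple 'I_n) \sum_p \sum_q (E p q j' : nat))).
    rewrite [leqLHS]big_mkcond; apply: leq_sum => j' _; case: ifP => //.
    rewrite inE => /existsP[p /existsP[q pq]].
    by rewrite (bigD1 p)//= (bigD1 q)//= pq.
  rewrite exchange_big; apply: leq_sum => p _; rewrite exchange_big; apply: leq_sum => q _.
  rewrite -sum1_card [leqRHS]big_mkcond; apply: leq_sum => j' _.
  by have -> : (if j' \in E p q then 1 else 0)%N = (E p q j' : nat) by []; exact: leqnn.
apply: (@leq_trans (\sum_(p : 'I_r) \sum_(q : 'I_r) (m.*2 * n ^ r.-1))).
  apply: leq_sum => p _; apply: leq_sum => q _.
  rewrite (card_tuple_coord [pred i : 'I_n | (tnth j p < i + m)%N && (i < tnth j p + m)%N] q).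
  by rewrite leq_mul2r card_close_ord orbT.
by rewrite !sum_nat_const card_ord mulnA expnS expn1.
Qed.

End CloseTuples.

From mathcomp Require Import all_classical all_reals all_analysis measurable_realfun.

Import numFieldNormedType.Exports.

Local Open Scope classical_set_scope.
Local Open Scope ring_scope.

(** * Polynomial cumulant generating functions *)

Section EntireSeries.
Context {R : realType}.

(** Infinite radius of convergence, expressed by coefficient bounds that pass directly through
    recurrences, shifts and differentiation. *)
Definition entire_coefs (c : nat -> R) : Prop :=
  forall e : R, 0 < e -> exists C, forall k, `|c k| <= C * e ^+ k.

Lemma entire_coefsW (c : nat -> R) :
  (forall e : R, 0 < e <= 1 -> exists C, forall k, `|c k| <= C * e ^+ k) ->
  entire_coefs c.
Proof.
move=> hc e e0; have [e1|e1] := leP e 1; first by apply: hc; rewrite e0.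
have [|C hC] := hc 1; first by rewrite ltr01 lexx.
exists C => k; apply: (le_trans (hC k)); rewrite expr1n mulr1.
have C0 : 0 <= C by have := hC 0%N; rewrite expr1n mulr1; apply: le_trans.
by rewrite ler_peMr// exprn_ege1// ltW.
Qed.

Lemma entire_coefs_le (c c' : nat -> R) (D : R) :
  (forall k, `|c' k| <= D * `|c k|) -> 0 <= D ->
  entire_coefs c -> entire_coefs c'.
Proof.
move=> h D0 hc e e0; have [C hC] := hc e e0; exists (D * C) => k.
by apply: (le_trans (h k)); rewrite -mulrA ler_wpM2l.
Qed.

(** The bound at [e / 2] absorbs the factor [k.+1], which is at most [2 ^+ k.+1]. *)
Lemma entire_coefs_diffs (c : nat -> R) :
  entire_coefs c -> entire_coefs (pseries_diffs c).
Proof.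
move=> hc e e0; have [|C hC] := hc (e / 2); first by rewrite divr_gt0.
have C0 : 0 <= C by have := hC 0%N; rewrite expr0 mulr1; apply: le_trans.
exists (C * e) => k; rewrite /pseries_diffs normrM normr_nat.
apply: (@le_trans _ _ (k.+1%:R * (C * (e / 2) ^+ k.+1))).
  by rewrite ler_wpM2l.
rewrite exprMn exprVn exprS.
have -> : k.+1%:R * (C * (e * e ^+ k * (2 ^+ k.+1)^-1)) =
  C * e * e ^+ k * (k.+1%:R / 2 ^+ k.+1) by ring.
rewrite ler_piMr//; first by rewrite !mulr_ge0// ?exprn_ge0// ltW.
by rewrite ler_pdivrMr ?exprn_gt0// mul1r -natrX ler_nat ltnW// ltn_expl.
Qed.

Lemma entire_coefs_normed (c : nat -> R) (t : R) :
  entire_coefs c -> cvgn [normed pseries c t].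
Proof.
move=> hc; set e := (2 * (`|t| + 1))^-1.
have e0 : 0 < e by rewrite invr_gt0 mulr_gt0// ltr_wpDl.
have [C hC] := hc e e0.
have C0 : 0 <= C by have := hC 0%N; rewrite expr0 mulr1; apply: le_trans.
apply: (@series_le_cvg _ _ (geometric C 2^-1)).
- by move=> n /=; exact: normr_ge0.
- by move=> n; rewrite /geometric /= mulr_ge0// exprn_ge0// invr_ge0.
- move=> k /=; rewrite normrM normrX.
  apply: (@le_trans _ _ (C * e ^+ k * `|t| ^+ k)).
    by rewrite ler_wpM2r// exprn_ge0.
  rewrite -mulrA -exprMn ler_wpM2l// lerXn2r// ?nnegrE ?mulr_ge0 ?(ltW e0) ?invr_ge0//.
  rewrite /e invfM -mulrA ler_piMr ?invr_ge0// mulrC ler_pdivrMr ?mul1r ?lerDl//.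
- by apply: is_cvg_geometric_series; rewrite ger0_norm ?invr_ge0// invf_lt1 ?ltr1n.
Qed.

Lemma entire_coefs_cvg (c : nat -> R) (t : R) :
  entire_coefs c -> cvgn (pseries c t).
Proof. by move=> hc; apply: normed_cvg; exact: entire_coefs_normed. Qed.

Lemma is_derive_entire (c : nat -> R) (t : R) : entire_coefs c ->
  is_derive t (1 : R) (fun x => limn (pseries c x))
    (limn (pseries (pseries_diffs c) t)).
Proof.
move=> hc; apply: (@pseries_snd_diffs _ _ (`|t| + 1)).
- exact: entire_coefs_cvg.
- exact/entire_coefs_cvg/entire_coefs_diffs.
- exact/entire_coefs_cvg/entire_coefs_diffs/entire_coefs_diffs.
- by rewrite [ltRHS]ger0_norm ?addr_ge0// ltrDl.
Qed.

Lemma limn_pseries0 (c : nat -> R) : limn (pseries c 0) = c 0.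
Proof.
apply: cvg_lim => //; apply/cvgrPdist_le => e e0; near=> n.
rewrite /pseries /series /= big_ltn; last by near: n; exact: nbhs_infty_gt.
rewrite expr0 mulr1 big_nat big1 ?addr0 ?subrr ?normr0 ?ltW// => i.
by case: i => // i _; rewrite expr0n mulr0.
Unshelve. all: end_near. Qed.

Lemma limn_pseriesD (c c' : nat -> R) (t : R) : entire_coefs c ->
  entire_coefs c' -> limn (pseries (fun k => c k + c' k) t) =
  limn (pseries c t) + limn (pseries c' t).
Proof.
move=> hc hc'; rewrite -limD; [|exact: entire_coefs_cvg..].
congr (limn _); apply/funext => n; rewrite /pseries /series /= ?fctE -big_split/=.
by apply: eq_bigr => i _; rewrite mulrDl.
Qed.

Lemma limn_pseriesZ (c : nat -> R) (x t : R) : entire_coefs c ->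
  limn (pseries (fun k => x * c k) t) = x * limn (pseries c t).
Proof.
move=> hc; apply: cvg_lim => //.
rewrite (_ : pseries _ t = (fun n => x * pseries c t n)).
  by apply: cvgMl_tmp; exact: entire_coefs_cvg.
apply/funext => n; rewrite /pseries /series /= mulr_sumr.
by apply: eq_bigr => i _; rewrite -mulrA.
Qed.

Lemma limn_pseries_shift (c : nat -> R) (t : R) (j : nat) : entire_coefs c ->
  limn (pseries (fun k => if (j <= k)%N then c (k - j)%N else 0) t) =
  t ^+ j * limn (pseries c t).
Proof.
move=> hc; apply: cvg_lim => //; rewrite -(cvg_shiftn j).
rewrite (_ : (fun _ => _) = (fun n => t ^+ j * pseries c t n)).
  by apply: cvgMl_tmp; exact: entire_coefs_cvg.
apply/funext => n; rewrite /pseries /series /=.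
rewrite addnC (@big_cat_nat _ _ _ j)//= ?leq_addr// big_nat big1 ?add0r.
  rewrite addnC -{1}[j]add0n big_addn addnK mulr_sumr; apply: eq_bigr => i _.
  by rewrite leq_addl addnK exprD; ring.
by move=> i /andP[_ ij]; rewrite leqNgt ij mul0r.
Qed.

Lemma entire_coefsD (c c' : nat -> R) : entire_coefs c -> entire_coefs c' ->
  entire_coefs (fun k => c k + c' k).
Proof.
move=> hc hc' e e0; have [C hC] := hc e e0; have [C' hC'] := hc' e e0.
exists (C + C') => k; apply: (le_trans (ler_normD _ _)).
by rewrite mulrDl lerD.
Qed.

Lemma entire_coefsZ (c : nat -> R) (x : R) : entire_coefs c ->
  entire_coefs (fun k => x * c k).
Proof. by apply: (@entire_coefs_le _ _ `|x|) => // k; rewrite normrM. Qed.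

Lemma entire_coefs_shift (c : nat -> R) (j : nat) : entire_coefs c ->
  entire_coefs (fun k => if (j <= k)%N then c (k - j)%N else 0).
Proof.
move=> hc e e0; have [C hC] := hc e e0.
have C0 : 0 <= C by have := hC 0%N; rewrite expr0 mulr1; apply: le_trans.
exists (C / e ^+ j) => k; case: ifP => [jk|_].
  suff -> : C / e ^+ j * e ^+ k = C * e ^+ (k - j) by exact: hC.
  by rewrite -{1}(subnK jk) exprD; field; rewrite gt_eqF// exprn_gt0.
by rewrite normr0 mulr_ge0// ?divr_ge0// exprn_ge0// ltW.
Qed.

Lemma limn_pseries_sum (I : Type) (s : seq I) (c : I -> nat -> R) (t : R) :
  (forall i, entire_coefs (c i)) ->
  entire_coefs (fun k => \sum_(i <- s) c i k) /\
  limn (pseries (fun k => \sum_(i <- s) c i k) t) =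
  \sum_(i <- s) limn (pseries (c i) t).
Proof.
move=> hc; elim: s => [|i s [IH1 IH2]].
  split.
    by move=> e e0; exists 0 => k; rewrite big_nil normr0 mul0r.
  rewrite big_nil; apply: cvg_lim => //.
  rewrite (_ : pseries _ t = fun=> 0); first exact: cvg_cst.
  apply/funext => n; rewrite /pseries /series /= big1// => k _.
  by rewrite big_nil mul0r.
rewrite big_cons -IH2 -limn_pseriesD//.
have -> : (fun k => \sum_(j <- i :: s) c j k) =
  (fun k => c i k + \sum_(j <- s) c j k).
  by apply/funext => k; rewrite big_cons.
by split => //; exact: entire_coefsD.
Qed.

End EntireSeries.

(** * Modulus of the moment generating function on a ray *)

Section Marcinkiewicz.
Context {R : realType}.

Lemma natr_fact_neq0 k : k`!%:R != 0 :> R.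
Proof. by rewrite pnatr_eq0 -lt0n fact_gt0. Qed.

(** Coefficients of M' = p' M, where M is the moment generating function, with coefficients [a], and
    p the cumulant generating function, so that p' has coefficients [b]. *)
Lemma cumulants_of_fact (mu kap : nat -> R) (a := fun k => mu k / k`!%:R)
  (b := fun j => kap j.+1 / j`!%:R) : cumulants_of mu kap ->
  forall k, k.+1%:R * a k.+1 = \sum_(j < k.+1) b j * a (k - j)%N.
Proof.
move=> h k; have -> : k.+1%:R * a k.+1 = mu k.+1 / k`!%:R.
  rewrite /a factS natrM; field.
  by rewrite natr_fact_neq0 nat1r pnatr_eq0.
rewrite h mulr_suml; apply: eq_bigr => j _.
have jk : (j <= k)%N by rewrite -ltnS.
rewrite /a /b -(bin_fact jk) !natrM; field.
by rewrite !natr_fact_neq0 /= pnatr_eq0 -lt0n bin_gt0.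
Qed.

Lemma is_derive_monomial (c x : R) (n : nat) :
  is_derive x (1 : R) (fun x => c * x ^+ n.+1 / n.+1%:R) (c * x ^+ n).
Proof.
rewrite (_ : (fun _ => _) = (c / n.+1%:R) \*: ((@idfun R) ^+ n.+1)); last first.
  by apply/funext => y /=; rewrite fctE /= /GRing.scale/=; ring.
apply: is_derive_eq; rewrite /GRing.scale/=.
by field; rewrite nat1r pnatr_eq0.
Qed.

Lemma is_derive_sumsq_expR (A B Q : R -> R) (a b p x : R) :
  is_derive x (1 : R) A a -> is_derive x (1 : R) B b -> is_derive x (1 : R) Q p ->
  is_derive x (1 : R) (fun x => (A x ^+ 2 + B x ^+ 2) * expR (- (2 * Q x)))
    (2 * (A x * a + B x * b - (A x ^+ 2 + B x ^+ 2) * p) * expR (- (2 * Q x))).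
Proof.
move=> hA hB hQ.
rewrite (_ : (fun _ => _) = (A ^+ 2 + B ^+ 2) * (expR \o (cst (-2) * Q))); last first.
  by apply/funext => y /=; rewrite !fctE mulNr.
apply: is_derive_eq.
rewrite /GRing.scale/=.
rewrite !fctE.
rewrite mulNr.
by ring.
Qed.

Section growth.
Variables (d : nat) (a b : nat -> R).
Hypothesis b0 : forall j, (d <= j)%N -> b j = 0.
Hypothesis ab : forall k, k.+1%:R * a k.+1 = \sum_(j < k.+1) b j * a (k - j)%N.

(** Only [d] of the [b j] can be nonzero, so the recurrence loses at most the factor S / e^d while
    dividing by [k.+1]. Beyond [K] the division wins and the bound [C * e ^+ k] reproduces itself;
    the constant [C] takes care of the terms before [K]. *)
Lemma entire_coefs_cumulants : entire_coefs a.
Proof.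
apply: entire_coefsW => e /andP[e0 e1].
set S := \sum_(j < d) `|b j|.
have S0 : 0 <= S by apply: sumr_ge0.
set K := (Num.truncn (S / e ^+ d)).+1.
have hK : S / e ^+ d <= K%:R by apply: ltW; exact: truncnS_gt.
pose C := \sum_(i < K) `|a i| / e ^+ i.
have C0 : 0 <= C by apply: sumr_ge0 => i _; rewrite divr_ge0// exprn_ge0// ltW.
exists C; elim/ltn_ind => k IH; have [kK|] := ltnP k K.
  rewrite -ler_pdivrMr ?exprn_gt0// /C (bigD1 (Ordinal kK))//= lerDl.
  by apply: sumr_ge0 => i _; rewrite divr_ge0// exprn_ge0// ltW.
case: k IH => // k IH Kk.
have k0 : 0 < k.+1%:R :> R by rewrite ltr0n.
rewrite -(ler_pM2l k0) -[X in X * `|_|]normr_nat -normrM ab.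
apply: (le_trans (ler_norm_sum _ _ _)).
apply: (@le_trans _ _ (\sum_(j < k.+1) `|b j| * (C * e ^+ k.+1 / e ^+ d))).
  apply: ler_sum => j _; rewrite normrM.
  have [jd|jd] := leqP d j; first by rewrite b0// normr0 !mul0r.
  rewrite ler_wpM2l//; apply: (le_trans (IH _ _)).
    by rewrite ltnS leq_subr.
  rewrite -mulrA ler_wpM2l// ler_pdivlMr ?exprn_gt0// -exprD.
  by apply: ler_wiXn2l; rewrite ?(ltW e0)//; have := ltn_ord j; lia.
rewrite -mulr_suml.
have hS : \sum_(j < k.+1) `|b j| <= S.
  rewrite /S -!(big_mkord xpredT (fun j => `|b j|)).
  apply: (@le_trans _ _ (\sum_(0 <= j < d + k.+1) `|b j|)).
    rewrite [leRHS](@big_cat_nat _ _ _ k.+1)//= ?leq_addl// lerDl.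
    by apply: sumr_ge0.
  rewrite (@big_cat_nat _ _ _ d)//= ?leq_addr// [X in _ + X]big_nat.
  by rewrite [X in _ + X]big1 ?addr0// => i /andP[di _]; rewrite b0 ?normr0.
apply: (le_trans (ler_wpM2r _ hS)).
  by rewrite !mulr_ge0// ?invr_ge0 ?exprn_ge0// ltW.
have -> : S * (C * e ^+ k.+1 / e ^+ d) = S / e ^+ d * (C * e ^+ k.+1) by ring.
rewrite ler_wpM2r ?mulr_ge0 ?exprn_ge0 ?(ltW e0)//.
by rewrite (le_trans hK)// ler_nat.
Qed.

(* [phase theta psi t] is the real part of [expR (i psi)] times the value at
   [t expR (i theta)] of the power series with coefficients [a]. *)
Definition phase (theta psi t : R) : R :=
  limn (pseries (fun k => a k * cos (k%:R * theta + psi)) t).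

Lemma entire_coefs_phase (theta psi : R) :
  entire_coefs (fun k => a k * cos (k%:R * theta + psi)).
Proof.
apply: (@entire_coefs_le _ a _ 1) => // [k|]; last exact: entire_coefs_cumulants.
by rewrite normrM mul1r ler_piMr// ler_norml cos_geN1 cos_le1.
Qed.

(** A quarter turn of [psi] yields minus the imaginary part, so the values of [phase] at [psi] and
    at [psi + pi / 2] together carry the complex number. *)
Lemma phaseD (theta alpha psi t : R) : phase theta (alpha + psi) t =
  cos alpha * phase theta psi t + sin alpha * phase theta (psi + pi / 2) t.
Proof.
have hc := entire_coefs_phase theta.
rewrite /phase -!limn_pseriesZ// -limn_pseriesD; [|exact: entire_coefsZ..].
congr (limn (pseries _ t)); apply/funext => k.
by rewrite addrCA cosD (addrA _ psi) cosDpihalf; ring.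
Qed.

Lemma is_derive_phase (theta psi t : R) :
  is_derive t (1 : R) (phase theta psi)
    (\sum_(j < d) b j * t ^+ j * phase theta (j.+1%:R * theta + psi) t).
Proof.
have hc := entire_coefs_phase theta; rewrite /phase.
have := is_derive_entire t (hc psi); set l := limn _; set l' := \sum_(j < d) _.
suff -> : l = l' by [].
rewrite /l /l'.
pose g (j k : nat) := b j * (if (j <= k)%N then
  a (k - j)%N * cos ((k - j)%:R * theta + (j.+1%:R * theta + psi)) else 0).
have hg j : entire_coefs (g j).
  apply: entire_coefsZ.
  exact: (@entire_coefs_shift _ (fun k => a k * cos (k%:R * theta + (j.+1%:R * theta + psi)))).
have -> : pseries_diffs (fun k => a k * cos (k%:R * theta + psi)) =
  (fun k => \sum_(j <- index_iota 0 d) g j k).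
  apply/funext => k; rewrite /pseries_diffs mulrA ab mulr_suml.
  rewrite -(big_mkord xpredT (fun j => b j * a (k - j)%N * cos (k.+1%:R * theta + psi))).
  rewrite [LHS](_ : _ = \sum_(0 <= j < k.+1) g j k); last first.
    apply: eq_big_nat => j /andP[_ jk]; rewrite /g -ltnS jk -mulrA.
    suff -> : k.+1%:R * theta + psi =
        (k - j)%:R * theta + (j.+1%:R * theta + psi) by [].
    by rewrite addrA -mulrDl -natrD addnS subnK.
  have [dk|dk] := leqP d k.+1.
    rewrite (@big_cat_nat _ _ _ d)//= [X in _ + X]big_nat [X in _ + X]big1 ?addr0//.
    by move=> j /andP[dj _]; rewrite /g b0 ?mul0r.
  rewrite [RHS](@big_cat_nat _ _ _ k.+1) ?(ltnW dk)//=.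
  rewrite [X in _ + X]big_nat [X in _ + X]big1 ?addr0//.
  by move=> j /andP[kj _]; rewrite /g leqNgt kj mulr0.
have [_ ->] := limn_pseries_sum (index_iota 0 d) t hg.
rewrite big_mkord; apply: eq_bigr => j _.
rewrite limn_pseriesZ; last exact: (@entire_coefs_shift _ (fun k => a k * cos (k%:R * theta + (j.+1%:R * theta + psi)))).
by rewrite (@limn_pseries_shift _ (fun k => a k * cos (k%:R * theta + (j.+1%:R * theta + psi))))// mulrA.
Qed.

(** On the ray z = t exp (i theta) the two sides are |M(z)|^2 and exp (2 Re p(z)); their quotient
    has derivative 0 and equals 1 at the origin. *)
Lemma phase_sumsq (theta t : R) : a 0%N = 1 ->
  phase theta 0 t ^+ 2 + phase theta (pi / 2) t ^+ 2 =
  expR (2 * \sum_(j < d) b j * cos (j.+1%:R * theta) * t ^+ j.+1 / j.+1%:R).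
Proof.
move=> a01.
pose Q (x : R) := \sum_(j < d) b j * cos (j.+1%:R * theta) * x ^+ j.+1 / j.+1%:R.
pose P (x : R) := \sum_(j < d) b j * cos (j.+1%:R * theta) * x ^+ j.
have dQ (x : R) : is_derive x (1 : R) Q (P x).
  rewrite (_ : Q = \sum_(j < d) (fun x => b j * cos (j.+1%:R * theta) * x ^+ j.+1 / j.+1%:R)); last first.
    by apply/funext => y; rewrite fct_sumE.
  by apply: is_derive_sum => j; exact: is_derive_monomial.
have cvtE (y : R) : phase theta (pi / 2 + pi / 2) y = - phase theta 0 y.
  rewrite -splitr /phase -mulN1r -limn_pseriesZ; last exact: entire_coefs_phase.
  by congr (limn (pseries _ y)); apply/funext => k; rewrite addrC cosD addr0 cospi sinpi; ring.
set A := phase theta 0; set B := phase theta (pi / 2).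
have dA (x : R) : is_derive x (1 : R) A
    (\sum_(j < d) b j * x ^+ j * (cos (j.+1%:R * theta) * A x +
       sin (j.+1%:R * theta) * B x)).
  have := is_derive_phase theta 0 x; rewrite -/A.
  by under eq_bigr do rewrite phaseD add0r.
have dB (x : R) : is_derive x (1 : R) B
    (\sum_(j < d) b j * x ^+ j * (cos (j.+1%:R * theta) * B x -
       sin (j.+1%:R * theta) * A x)).
  have := is_derive_phase theta (pi / 2) x; rewrite -/B.
  by under eq_bigr do rewrite phaseD cvtE mulrN.
have dG (x : R) := is_derive_sumsq_expR (dA x) (dB x) (dQ x).
have {}dG (x : R) : is_derive x (1 : R)
    (fun x => (A x ^+ 2 + B x ^+ 2) * expR (- (2 * Q x))) 0.
  suff <- : 2 * (A x * (\sum_(j < d) b j * x ^+ j * (cos (j.+1%:R * theta) * A x +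
       sin (j.+1%:R * theta) * B x)) + B x * (\sum_(j < d) b j * x ^+ j *
       (cos (j.+1%:R * theta) * B x - sin (j.+1%:R * theta) * A x)) -
       (A x ^+ 2 + B x ^+ 2) * P x) * expR (- (2 * Q x)) = 0 by exact: dG.
  rewrite /P !mulr_sumr -big_split/= -sumrB big1 ?mulr0 ?mul0r// => j _.
  ring.
have := is_derive_0_is_cst t 0 dG.
have -> : A 0 = 1 by rewrite /A /phase limn_pseries0 a01 mul0r add0r cos0 mulr1.
have -> : B 0 = 0.
  by rewrite /B /phase limn_pseries0 a01 mul0r add0r cos_pihalf mulr0.
have -> : Q 0 = 0.
  by rewrite /Q big1// => j _; rewrite expr0n/= mulr0 mul0r.
rewrite mulr0 oppr0 expR0 expr1n expr0n addr0 mulr1 expRN => h.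
exact: divr1_eq h.
Qed.
End growth.
End Marcinkiewicz.

(** * Binomial sums of cosines and double series *)

Section PositiveMoments.
Context {R : realType}.

Lemma sum_binS (f : nat -> R) (k : nat) :
  \sum_(i < k.+2) 'C(k.+1, i)%:R * f i =
  \sum_(i < k.+1) 'C(k, i)%:R * (f i + f i.+1).
Proof.
rewrite big_ord_recl bin0 mul1r.
under eq_bigr => i _ do rewrite lift0 binS natrD mulrDl.
under [RHS]eq_bigr do rewrite mulrDr.
rewrite !big_split/= addrA; congr (_ + _).
rewrite big_ord_recr/= bin_small// mul0r addr0 [RHS]big_ord_recl/= bin0 mul1r.
by congr (_ + _); apply: eq_bigr => i _; rewrite lift0.
Qed.

(** Real part of exp (i s) (exp (i theta) + exp (- i theta))^k. *)
Lemma sum_bin_cos (theta s : R) (k : nat) :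
  \sum_(i < k.+1) 'C(k, i)%:R * cos ((i%:R *+ 2 - k%:R) * theta + s) =
  (2 * cos theta) ^+ k * cos s.
Proof.
elim: k s => [|k IH] s.
  by rewrite big_ord1 bin0 mul0rn subrr mul0r add0r expr0.
rewrite (@sum_binS (fun i => cos ((i%:R *+ 2 - k.+1%:R) * theta + s))).
under eq_bigr => i _.
  have -> : (i%:R *+ 2 - k.+1%:R) * theta + s =
    (i%:R *+ 2 - k%:R) * theta + (s - theta) by rewrite -natr1; ring.
  have -> : (i.+1%:R *+ 2 - k.+1%:R) * theta + s =
    (i%:R *+ 2 - k%:R) * theta + (s + theta) by rewrite -!natr1; ring.
  rewrite mulrDr; over.
by rewrite big_split/= !IH cosB cosD exprSr; ring.
Qed.

(** The product of cosines splits into the cosine of the sum of the angles, which does not depend on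
    [i], and that of their difference, which [sum_bin_cos] adds up. These are the coefficients of
    the square of Re (exp (i phi) exp (x exp (i theta))). *)
Lemma sum_bin_cosM (theta phi : R) (k : nat) :
  \sum_(i < k.+1) 'C(k, i)%:R *
    (cos (i%:R * theta + phi) * cos ((k - i)%N%:R * theta + phi)) =
  2 ^+ k / 2 * (cos (k%:R * theta + phi *+ 2) + cos theta ^+ k).
Proof.
have := sum_bin_cos theta 0 k; rewrite cos0 mulr1 => h.
have h2 : \sum_(i < k.+1) 'C(k, i)%:R = 2 ^+ k :> R.
  have := exprDn (1 : R) 1 k; rewrite [1 + 1](_ : _ = 2)// => ->.
  by apply: eq_bigr => i _; rewrite !expr1n mulr1.
transitivity ((2 ^+ k * cos (k%:R * theta + phi *+ 2) + (2 * cos theta) ^+ k) / 2).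
  rewrite -h2 -h !mulr_suml -big_split/= mulr_suml; apply: eq_bigr => i _.
  have ik : (i <= k)%N by rewrite -ltnS.
  have -> : (i%:R *+ 2 - k%:R) * theta + 0 =
  (i%:R * theta + phi) - ((k - i)%N%:R * theta + phi).
    by rewrite natrB//; ring.
  have -> : k%:R * theta + phi *+ 2 =
  (i%:R * theta + phi) + ((k - i)%N%:R * theta + phi).
    by rewrite natrB//; ring.
  move: (i%:R * _ + _) ((k - i)%N%:R * _ + _) => u v.
  by rewrite cosB cosD; field.
by rewrite exprMn; move: (2 ^+ k) (cos theta ^+ k) => u v; field.
Qed.

Lemma sum_triangle (F : nat -> nat -> R) (N : nat) :
  \sum_(k < N) \sum_(i < k.+1) F i (k - i)%N =
  \sum_(i < N) \sum_(j < N | (i + j < N)%N) F i j.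
Proof.
under eq_bigr => k _.
  rewrite (big_ord_widen N (fun i => F i (k - i)%N)) ?ltn_ord//.
  under eq_bigl do rewrite ltnS.
  over.
rewrite (exchange_big_dep xpredT)//=; apply: eq_bigr => i _.
rewrite -(big_mkord (fun k => i <= k)%N (fun k => F i (k - i)%N)).
rewrite -(big_mkord (fun j => i + j < N)%N (fun j => F i j)).
rewrite -[LHS](big_nat_widenl i 0 N xpredT)//.
rewrite -{1}[i : nat]add0n big_addn; under eq_bigr do rewrite addnK.
rewrite (big_nat_widen _ _ N) ?leq_subr//; apply: eq_bigl => j.
by rewrite ltn_subRL addnC.
Qed.

Section double_sum.
Variables (mu g h : nat -> R) (rho : R).
Hypothesis rho0 : 0 <= rho.
Hypothesis hmu : entire_coefs (fun k => mu k / k`!%:R).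
Hypothesis hg : forall i, `|g i| <= rho ^+ i / i`!%:R.
Hypothesis hh : forall i, `|h i| <= rho ^+ i / i`!%:R.

(** Positivity of moments concerns square partial sums, whereas the value of the series comes from
    the Cauchy product, that is from triangles. The terms of the square outside the triangle satisfy
    i + j >= N and are geometrically small. *)
Lemma double_sum_cvg (l : R) :
  series (fun k => mu k * \sum_(i < k.+1) g i * h (k - i)%N) @ \oo --> l ->
  (fun N => \sum_(i < N) \sum_(j < N) g i * h j * mu (i + j)%N) @ \oo --> l.
Proof.
move=> hl.
have r1 : 0 < rho + 1 by rewrite ltr_wpDl.
(* With this [e] a term is at most C 8^-(i + j), the binomial coefficient costing 2^(i + j). Outside
   the triangle there are at most N^2 <= 4^N terms, which leaves C 2^-N. *)
set e := (16 * (rho + 1))^-1.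
have e0 : 0 < e by rewrite invr_gt0 mulr_gt0.
have [C hC] := hmu e0.
have C0 : 0 <= C by have := hC 0%N; rewrite expr0 mulr1; apply: le_trans.
pose F i j := g i * h j * mu (i + j)%N.
have hF i j : `|F i j| <= C * (8^-1) ^+ (i + j).
  rewrite /F !normrM.
  apply: (@le_trans _ _ ((rho ^+ i / i`!%:R) * (rho ^+ j / j`!%:R) *
     (C * e ^+ (i + j) * (i + j)`!%:R))).
    rewrite !ler_pM ?mulr_ge0// -ler_pdivrMr ?ltr0n ?fact_gt0//.
    by have := hC (i + j)%N; rewrite normrM [`|_^-1|]ger0_norm// invr_ge0.
  have -> : (rho ^+ i / i`!%:R) * (rho ^+ j / j`!%:R) *
     (C * e ^+ (i + j) * (i + j)`!%:R) =
     C * ((rho * e) ^+ (i + j) * 'C(i + j, i)%:R).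
    rewrite -(@bin_fact (i + j) i) ?leq_addr// addKn !natrM !exprMn !exprD.
    by field; rewrite !natr_fact_neq0.
  rewrite ler_wpM2l//.
  apply: (@le_trans _ _ ((rho * e) ^+ (i + j) * 2 ^+ (i + j))).
    rewrite ler_wpM2l ?exprn_ge0 ?mulr_ge0 ?(ltW e0)//.
    rewrite -natrX ler_nat -[X in (_ <= X ^ _)%N]/(1 + 1)%N expnDn.
    have iij : (i < (i + j).+1)%N by rewrite ltnS leq_addr.
    by rewrite (bigD1 (Ordinal iij))//= !exp1n !muln1 leq_addr.
  have re0 : 0 <= rho * e by rewrite mulr_ge0// ltW.
  rewrite -exprMn lerXn2r ?nnegrE ?invr_ge0 ?(mulr_ge0 re0)//.
  rewrite /e invfM; have -> : 8^-1 = 16^-1 * 2 :> R by field.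
  rewrite mulrCA -mulrA ler_wpM2l ?invr_ge0// ler_piMl//.
  by rewrite ler_pdivrMr// mul1r lerDl.
have hdiff N : `|\sum_(i < N) \sum_(j < N) F i j -
    series (fun k => mu k * \sum_(i < k.+1) g i * h (k - i)%N) N| <=
    C * (2^-1) ^+ N.
  rewrite /series/= big_mkord.
  rewrite [X in _ - X](_ : _ = \sum_(k < N) \sum_(i < k.+1) F i (k - i)%N); last first.
    apply: eq_bigr => k _; rewrite mulr_sumr; apply: eq_bigr => i _.
    have ik : (i <= k)%N by rewrite -ltnS.
    by rewrite /F subnKC// mulrC.
  rewrite sum_triangle -sumrB.
  under eq_bigr => i _.
    rewrite (bigID (fun j : 'I_N => i + j < N)%N)/= [X in X - _]addrC addrK; over.
  apply: (le_trans (ler_norm_sum _ _ _)).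
  apply: (@le_trans _ _ (\sum_(i < N) \sum_(j < N) C * (8^-1) ^+ N)).
    apply: ler_sum => i _; apply: (le_trans (ler_norm_sum _ _ _)).
    rewrite big_mkcond/=; apply: ler_sum => j _; case: ifPn; last first.
      by rewrite mulr_ge0// exprn_ge0// invr_ge0.
    rewrite -leqNgt => Nij; apply: (le_trans (hF _ _)); rewrite ler_wpM2l//.
    by apply: ler_wiXn2l => //; rewrite ?invr_ge0// invf_le1 ?ler1n.
  rewrite !sumr_const !card_ord -mulrnA -mulrnAr ler_wpM2l//.
  rewrite -mulr_natl; have -> : 8^-1 = (2 * 2)^-1 * 2^-1 :> R by field.
  rewrite exprMn mulrA ler_piMl ?exprn_ge0 ?invr_ge0//.
  rewrite exprVn ler_pdivrMr ?exprn_gt0 ?mulr_gt0// mul1r -natrM -natrX ler_nat.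
  by rewrite expnMn leq_mul// ltnW// ltn_expl.
rewrite (_ : (fun N => _) = (fun N => (\sum_(i < N) \sum_(j < N) F i j -
    series (fun k => mu k * \sum_(i < k.+1) g i * h (k - i)%N) N) +
    series (fun k => mu k * \sum_(i < k.+1) g i * h (k - i)%N) N)); last first.
  by apply/funext => N; rewrite subrK.
rewrite -[l]add0r; apply: cvgD => //.
apply/cvgr0Pnorm_le => eps eps0.
have : (fun N => C * (2^-1) ^+ N) @ \oo --> (0 : R).
  by apply: cvg_geometric; rewrite ger0_norm ?invr_ge0// invf_lt1 ?ltr1n.
move=> /cvgr0Pnorm_le /(_ _ eps0); apply: filterS => N.
by rewrite ger0_norm ?mulr_ge0 ?exprn_ge0 ?invr_ge0//; apply: le_trans.
Qed.

End double_sum.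
End PositiveMoments.

(** * Positivity against the leading cumulant *)

Section Marcinkiewicz.
Context {R : realType}.

Lemma ex_angle (u v : R) : u ^+ 2 + v ^+ 2 = 1 ->
  exists psi, cos psi = u /\ sin psi = v.
Proof.
move=> uv; have u1 : -1 <= u <= 1.
  by apply/andP; split; have := sqr_ge0 v; nra.
have us : Num.sqrt (1 - u ^+ 2) = `|v| by rewrite -uv addrC addKr sqrtr_sqr.
have [v0|v0] := leP 0 v.
  by exists (acos u); rewrite acosK ?in_itv//= sin_acos// us ger0_norm.
exists (- acos u); rewrite cosN sinN acosK ?in_itv//= sin_acos// us.
by rewrite ltr0_norm ?opprK.
Qed.

Lemma poly_ge0_lead (c : nat -> R) (d : nat) :
  (forall t, 1 <= t -> 0 <= \sum_(j < d.+1) c j * t ^+ j) -> 0 <= c d.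
Proof.
case: d => [|d] h.
  by have := h 1 (lexx _); rewrite big_ord1 expr0 mulr1.
rewrite leNgt; apply/negP => cd.
set S := \sum_(j < d.+1) `|c j|.
have S0 : 0 <= S by apply: sumr_ge0.
(* Then [c d.+1 * t] equals [c d.+1 - (S + 1)], so that the top term outweighs all the others. *)
pose t := 1 + (S + 1) / - c d.+1.
have cd' : 0 < - c d.+1 by rewrite oppr_gt0.
have t1 : 1 <= t by rewrite lerDl divr_ge0// ?addr_ge0// ltW.
have := h _ t1; rewrite big_ord_recr/= => {}h.
have : 0 <= S * t ^+ d + c d.+1 * t ^+ d.+1.
  apply: (le_trans h); rewrite lerD2r /S mulr_suml; apply: ler_sum => j _.
  apply: (@le_trans _ _ (`|c j| * t ^+ j)).
    by rewrite ler_wpM2r ?ler_norm// exprn_ge0// (le_trans ler01).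
  by rewrite ler_wpM2l// ler_weXn2l// -ltnS.
rewrite exprS mulrA -mulrDl pmulr_lge0; last first.
  by rewrite exprn_gt0// (lt_le_trans ltr01).
have -> : c d.+1 * t = c d.+1 - (S + 1).
  by rewrite /t; field; rewrite lt_eqF.
by move=> h'; move: h' cd'; lra.
Qed.

Variables (mu kap : nat -> R).
Hypothesis mukap : cumulants_of mu kap.
Hypothesis mu0 : mu 0%N = 1.
Hypothesis mu_ge0 : forall (N : nat) (g : nat -> R),
  0 <= \sum_(i < N) \sum_(j < N) g i * g j * mu (i + j)%N.

Let a k := mu k / k`!%:R.
Let b j := kap j.+1 / j`!%:R.

Variable d : nat.
Hypothesis kap0 : forall j, (d < j)%N -> kap j = 0.

Let b0 j : (d <= j)%N -> b j = 0.
Proof. by move=> dj; rewrite /b kap0 ?mul0r. Qed.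

Let ab := cumulants_of_fact mukap.

Let aE : entire_coefs a. Proof. exact: entire_coefs_cumulants b0 ab. Qed.

Let a01 : a 0%N = 1. Proof. by rewrite /a mu0 fact0 divr1. Qed.

(** Let G(x) = Re (exp (i phi) exp (t x exp (i theta) / 2)), with Taylor coefficients [g]. Then 2
    G(x)^2 = Re (exp (2 i phi) exp (t x exp (i theta))) + exp (t x cos theta), and the moment
    functional is nonnegative on the squares of the truncations of G. This replaces the inequality
    |E exp (z X)| <= E exp (X Re z). *)
Lemma phase_ge (theta phi t : R) :
  - phase a theta (phi *+ 2) t <= limn (pseries a (t * cos theta)).
Proof.
pose g i := (t / 2) ^+ i * cos (i%:R * theta + phi) / i`!%:R.
have hg i : `|g i| <= (`|t| / 2) ^+ i / i`!%:R.
  rewrite /g !normrM [`|_^-1|]ger0_norm ?invr_ge0// normrX normrM.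
  rewrite [`|2^-1|]ger0_norm ?invr_ge0// ler_wpM2r ?invr_ge0//.
  by rewrite ler_piMr ?exprn_ge0 ?divr_ge0// ler_norml cos_geN1 cos_le1.
have hE := entire_coefs_phase b0 ab theta (phi *+ 2).
have hl : series (fun k => mu k * \sum_(i < k.+1) g i * g (k - i)%N) @ \oo -->
    (phase a theta (phi *+ 2) t + limn (pseries a (t * cos theta))) / 2.
  rewrite (_ : series _ = (fun n => (pseries (fun k => a k * cos (k%:R * theta + phi *+ 2)) t n
     + pseries a (t * cos theta) n) / 2)).
    apply: cvgMr_tmp; apply: cvgD; first exact: entire_coefs_cvg.
    exact: entire_coefs_cvg.
  apply/funext => n; rewrite /pseries /series/= -big_split/= mulr_suml.
  apply: eq_bigr => k _.
  transitivity (a k * ((t / 2) ^+ k * \sum_(i < k.+1) 'C(k, i)%:R *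
    (cos (i%:R * theta + phi) * cos ((k - i)%N%:R * theta + phi)))).
    rewrite /a !mulr_sumr; apply: eq_bigr => i _.
    have ik : (i <= k)%N by rewrite -ltnS.
    have -> : (t / 2) ^+ k = (t / 2) ^+ i * (t / 2) ^+ (k - i).
      by rewrite -exprD subnKC.
    rewrite /g -(bin_fact ik) !natrM.
    by field; rewrite !natr_fact_neq0/= pnatr_eq0 -lt0n bin_gt0.
  rewrite sum_bin_cosM !exprMn exprVn; move: (cos theta ^+ k) (cos _) => x y.
  by field; rewrite expf_neq0.
have r0 : 0 <= `|t| / 2 by rewrite divr_ge0.
have := double_sum_cvg r0 aE hg hg hl => hc.
have : 0 <= (phase a theta (phi *+ 2) t + limn (pseries a (t * cos theta))) / 2.
  rewrite -(cvg_lim (@Rhausdorff R) hc); apply: limr_ge; first by apply/cvg_ex; eexists; exact: hc.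
  by apply: nearW => N; exact: mu_ge0.
by rewrite pmulr_lge0 ?invr_gt0// => h; rewrite -subr_ge0 opprK addrC.
Qed.

(** With [psi] opposite to the argument of M(z), [phase_ge] reads |M(z)| <= M(Re z), and logarithms
    give Re p(z) <= p(Re z). The exponential formula is available for squares only, which suffices
    because this inequality also shows M(Re z) >= 0. *)
Lemma cumulant_poly_ge0 (theta t : R) :
  0 <= \sum_(j < d) b j * (cos theta ^+ j.+1 - cos (j.+1%:R * theta)) / j.+1%:R
       * t ^+ j.+1.
Proof.
pose Q th x := \sum_(j < d) b j * cos (j.+1%:R * th) * x ^+ j.+1 / j.+1%:R.
have GE th x : phase a th 0 x ^+ 2 + phase a th (pi / 2) x ^+ 2 = expR (Q th x) ^+ 2.
  by rewrite (phase_sumsq b0 ab)// -expRM_natl.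
have M0 x : limn (pseries a x) ^+ 2 = expR (Q 0 x) ^+ 2.
  rewrite -GE; set M := limn _.
  have -> : phase a 0 0 x = M.
    rewrite /phase; congr (limn (pseries _ x)); apply/funext => k.
    by rewrite mulr0 add0r cos0 mulr1.
  suff -> : phase a 0 (pi / 2) x = 0 by rewrite expr0n addr0.
  rewrite /phase -[RHS](mul0r M) -limn_pseriesZ//.
  congr (limn (pseries _ x)); apply/funext => k.
  by rewrite mulr0 add0r cos_pihalf mulr0 mul0r.
have [psi [cpsi spsi]] : exists psi,
    cos psi = - phase a theta 0 t / expR (Q theta t) /\
    sin psi = - phase a theta (pi / 2) t / expR (Q theta t).
  apply: ex_angle; rewrite !expr_div_n -mulrDl !sqrrN GE divff//.
  by rewrite expf_neq0// gt_eqF ?expR_gt0.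
have := phase_ge theta (psi / 2) t.
rewrite -[_ *+ 2]mulr_natr divfK// -[psi]addr0 (phaseD b0 ab) add0r cpsi spsi.
have -> : - (- phase a theta 0 t / expR (Q theta t) * phase a theta 0 t +
    - phase a theta (pi / 2) t / expR (Q theta t) * phase a theta (pi / 2) t) =
    (phase a theta 0 t ^+ 2 + phase a theta (pi / 2) t ^+ 2) / expR (Q theta t).
  by field; rewrite gt_eqF ?expR_gt0.
rewrite GE expr2 mulfK ?gt_eqF ?expR_gt0// => hM.
have : expR (Q theta t) ^+ 2 <= expR (Q 0 (t * cos theta)) ^+ 2.
  by rewrite -M0 lerXn2r// ?nnegrE ?expR_ge0// (le_trans (expR_ge0 _) hM).
rewrite ler_pXn2r ?nnegrE ?expR_ge0// ler_expR -subr_ge0 /Q -sumrB.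
congr (0 <= _); apply: eq_bigr => j _; rewrite mulr0 cos0 exprMn.
by field; rewrite nat1r pnatr_eq0.
Qed.

(** The leading coefficient of p(Re z) - Re p(z) in t is a positive multiple of kap_d (cos^d theta -
    cos (d theta)). The angle is chosen so that cos (d theta) is the sign of kap_d, which makes this
    negative as soon as |cos theta| < 1. For a positive cumulant of order 2 the angle would be pi
    and the contradiction would disappear, as it must for the normal law. *)
Lemma top_cumulant0 : (3 <= d)%N -> kap d = 0.
Proof.
move=> d3; apply/eqP/negP => /negP kd.
have d0 : 0 < d%:R :> R by rewrite ltr0n; lia.
pose theta : R := if 0 < kap d then 2 * pi / d%:R else pi / d%:R.
have pi0 := pi_gt0 R.
have hth : 0 < theta < pi.
  rewrite /theta; case: ifP => _; rewrite ?divr_gt0 ?mulr_gt0//=.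
    rewrite ltr_pdivrMr// mulrC ltr_pM2l// ltr_nat; lia.
  rewrite ltr_pdivrMr// -[ltLHS]mulr1 ltr_pM2l// ltr1n; lia.
have c1 : `|cos theta| ^+ d < 1.
  rewrite exprn_ilt1//; first by apply/eqP; lia.
  rewrite -(@ltr_pXn2r _ 2)// ?nnegrE// expr1n real_normK ?num_real//.
  have := cos2Dsin2 theta; have : 0 < sin theta ^+ 2.
    by rewrite exprn_gt0// sin_gt0_pi.
  by lra.
have hd : d.-1.+1 = d by lia.
pose c j := if j is j'.+1 then
  b j' * (cos theta ^+ j'.+1 - cos (j'.+1%:R * theta)) / j'.+1%:R else 0.
have : 0 <= c d.
  apply: poly_ge0_lead => t _; rewrite big_ord_recl mul0r add0r.
  rewrite (eq_bigr (fun j : 'I_d => b j * (cos theta ^+ j.+1 - cos (j.+1%:R * theta))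
    / j.+1%:R * t ^+ j.+1)); first exact: cumulant_poly_ge0.
  by move=> j _; rewrite lift0.
rewrite /c -hd /b hd pmulr_lge0 ?invr_gt0// mulrAC pmulr_lge0; last first.
  by rewrite invr_gt0 ltr0n fact_gt0.
have n1 := ler_norm (cos theta ^+ d); have n2 := ler_norm (- cos theta ^+ d).
rewrite normrN in n2; rewrite normrX in n1 n2.
have [k0|k0] := boolP (0 < kap d).
  rewrite (_ : cos (d%:R * theta) = 1) ?pmulr_rge0//; first by move: n1 c1; lra.
  by rewrite /theta k0 mulrC divfK ?gt_eqF// mulr_natl cos2pi.
have {}k0 : kap d < 0 by rewrite lt_neqAle kd/= leNgt.
rewrite (_ : cos (d%:R * theta) = -1) ?nmulr_rge0//; first by move: n2 c1; lra.
by rewrite /theta ltNge (ltW k0)/= mulrC divfK ?gt_eqF// cospi.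
Qed.

End Marcinkiewicz.

(* If a positive moment sequence has a polynomial cumulant generating function
   [p], then [|exp (p z)| <= exp (p (Re z))] on every ray, which for large [|z|]
   contradicts a leading term of degree at least 3. *)
Theorem marcinkiewicz {R : realType} (mu kap : nat -> R) (d : nat) :
  cumulants_of mu kap -> mu 0%N = 1 ->
  (forall (N : nat) (g : nat -> R),
    0 <= \sum_(i < N) \sum_(j < N) g i * g j * mu (i + j)%N) ->
  (forall j, (d < j)%N -> kap j = 0) -> forall j, (3 <= j)%N -> kap j = 0.
Proof.
move=> mukap mu0 mu_ge0; elim: d => [|d IH] kap0 j j3.
  by apply: kap0; lia.
have [d3|d3] := leqP 3 d.+1; last by apply: kap0; lia.
apply: (IH _ j j3) => i di; have [->|ne] := eqVneq i d.+1.
  exact: (top_cumulant0 mukap).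
by apply: kap0; lia.
Qed.

(** * Limits along ultrafilters and vanishing of the intermediate cumulants *)

Lemma ultra_bounded_cvg {R : realType} {T : Type} (G : set_system T)
  (u : T -> R) (C : R) : UltraFilter G -> (forall n, `|u n| <= C) ->
  exists l : R, u x @[x --> G] --> l.
Proof.
move=> GU uC; have GF : ProperFilter G := ultra_proper.
have uG : ProperFilter (u @ G) by exact: fmap_proper_filter.
have := @segment_compact R (- C) C (u @ G) uG.
case=> [|p [_ hp]].
  by apply: nearW => n /=; rewrite in_itv/= -ler_norml.
exists p => A pA /=; have [//|GA] := in_ultra_setVsetC (u @^-1` A) GU.
have [x [uAx Ax]] := hp (~` A) A GA pA.
by case: uAx.
Qed.

(** The ultrafilter plays the role of a subsequence that stays away from 0; every bounded sequence
    converges along it, so no diagonal extraction is needed. *)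
Lemma not_cvgr0_ultra {R : realType} (u : nat -> R) :
  ~ (u n @[n --> \oo] --> (0 : R)) ->
  exists (G : set_system nat) (e : R),
    [/\ UltraFilter G, \oo `<=` G, 0 < e & G [set n | e < `|u n|]].
Proof.
move=> /cvgr0Pnorm_le /existsNP[e /not_implyP[e0 ne]].
pose D := [set n | e < `|u n|].
have FF : ProperFilter (within D \oo).
  split; last exact: within_filter.
  move=> hB; apply: ne; have {}hB : \forall n \near \oo, D n -> False by [].
  apply: filterS hB => n hn.
  by have [//|Dn] := leP `|u n| e; case: (hn Dn).
have [G [GU sFG]] := ultraFilterLemma FF.
exists G, e; split => //.
  by move=> A hA; apply: sFG; move: hA; apply: filterS => n An _.
by apply: sFG; apply: nearW => n.
Qed.

Lemma cvg_sumr {R : realType} {T I : Type} (G : set_system T) (s : seq I)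
  (Q : pred I) (u : I -> T -> R) (l : I -> R) : Filter G ->
  (forall i, Q i -> u i x @[x --> G] --> l i) ->
  \sum_(i <- s | Q i) u i x @[x --> G] --> \sum_(i <- s | Q i) l i.
Proof.
move=> GF h; elim: s => [|i s IH].
  by rewrite big_nil; under eq_fun do rewrite big_nil; exact: cvg_cst.
rewrite big_cons; under eq_fun do rewrite big_cons.
by case: ifP => // Qi; apply: cvgD => //; exact: h.
Qed.

Section Janson.
Context {R : realType}.

Lemma cumulants_of_scale (mu kap : nat -> R) (c : R) : cumulants_of mu kap ->
  cumulants_of (fun k => c ^+ k * mu k) (fun k => c ^+ k * kap k).
Proof.
move=> h k; rewrite h mulr_sumr; apply: eq_bigr => j _.
have -> : c ^+ k.+1 = c ^+ j.+1 * c ^+ (k - j).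
  by rewrite -exprD addSn subnKC// -ltnS.
by ring.
Qed.

Lemma expr_cvg0 {T : Type} (G : set_system T) (x : T -> R) (j : nat) :
  ProperFilter G -> (0 < j)%N -> (forall n, 0 <= x n) ->
  x n ^+ j @[n --> G] --> (0 : R) -> x n @[n --> G] --> (0 : R).
Proof.
move=> GF j0 x0 /cvgr0Pnorm_le h; apply/cvgr0Pnorm_le => e e0.
have := h (e ^+ j) (exprn_gt0 _ e0); apply: filterS => n.
by rewrite !ger0_norm// ?exprn_ge0// ler_pXn2r// nnegrE// ltW.
Qed.

Lemma janson (mu kap : nat -> nat -> R) (s : nat) :
  (forall n, cumulants_of (mu n) (kap n)) -> (forall n, mu n 0%N = 1) ->
  (forall n (N : nat) (g : nat -> R),
    0 <= \sum_(i < N) \sum_(j < N) g i * g j * mu n (i + j)%N) ->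
  (forall n, kap n 1 = 0) -> (forall n, kap n 2 = 1) ->
  (forall k, (s <= k)%N -> kap n k @[n --> \oo] --> (0 : R)) ->
  forall k, (3 <= k)%N -> kap n k @[n --> \oo] --> (0 : R).
Proof.
move=> mukap mu0 mu_ge0 kap1 kap2 kaps j0 j03.
apply: contrapT => /not_cvgr0_ultra[G [eps [GU sG eps0 Geps]]].
have GF : ProperFilter G := ultra_proper.
pose q n (j : nat) := if (3 <= j)%N then `|kap n j| `^ (j%:R^-1) else 0.
have q0 n j : 0 <= q n j by rewrite /q; case: ifP => // _; exact: powR_ge0.
have qX n j : (3 <= j)%N -> q n j ^+ j = `|kap n j|.
  move=> j3; rewrite /q j3 -powR_mulrn ?powR_ge0// -powRrM mulVf ?powRr1//.
  by rewrite pnatr_eq0; lia.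
(* The weights [q n j] scale linearly with the variable. After division by [lam n] the cumulants of
   orders 3 to [s - 1] are at most 1 in absolute value, whatever their growth, and the second one
   stays bounded because [lam n] is at least 1. *)
pose lam n := 1 + \sum_(j < s) q n j.
have lam1 n : 1 <= lam n by rewrite lerDl sumr_ge0.
have lam0 n : 0 < lam n by rewrite (lt_le_trans _ (lam1 n)).
have qlam n j : (j < s)%N -> q n j <= lam n.
  move=> js; rewrite /lam (bigD1 (Ordinal js))//= addrCA lerDl.
  by rewrite addr_ge0// sumr_ge0.
pose c n := (lam n)^-1.
have c0 n : 0 < c n by rewrite invr_gt0.
have c1 n : c n <= 1 by rewrite invf_le1.
pose kap' n j := c n ^+ j * kap n j.
pose mu' n k := c n ^+ k * mu n k.
have mukap' n : cumulants_of (mu' n) (kap' n) by exact: cumulants_of_scale.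
have kap'E n j : (3 <= j)%N -> `|kap' n j| = (c n * q n j) ^+ j.
  by move=> j3; rewrite /kap' normrM normrX (gtr0_norm (c0 n)) exprMn qX.
have hkapL j : exists l : R, (0 < j)%N ->
    kap' n j @[n --> G] --> l /\ ((s <= j)%N -> l = 0).
  have [sj|js] := leqP s j.
    exists 0 => _; split=> //; apply/cvgr0Pnorm_le => e e0.
    have /cvgr0Pnorm_le /(_ _ e0) := kaps j sj => /sG; apply: filterS => n.
    apply: le_trans; rewrite /kap' normrM normrX (gtr0_norm (c0 n)).
    by rewrite ler_piMl// exprn_ile1// ltW.
  have [->|jp] := posnP j; first by exists 0.
  have [l hl] : exists l : R, kap' n j @[n --> G] --> l.
  {   have [j3|] := leqP 3 j.
    apply: (@ultra_bounded_cvg _ _ _ _ 1) => n; rewrite kap'E// exprn_ile1//.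
      by rewrite mulr_ge0// ltW.
    by rewrite mulrC ler_pdivrMr// mul1r qlam.
  case: j js jp => [|[|[|//]]] js // _ _.
  - by exists 0; rewrite /kap'; under eq_fun do rewrite kap1 mulr0; exact: cvg_cst.
  - apply: (@ultra_bounded_cvg _ _ _ _ 1) => n; rewrite /kap' kap2 mulr1 normrX.
    by rewrite (gtr0_norm (c0 n)) exprn_ile1// ltW. }
  by exists l => _; split => //; rewrite leqNgt js.
have /choice[kapL hL] := hkapL.
have kapLs j : (s <= j)%N -> (0 < j)%N -> kapL j = 0.
  by move=> sj jp; have [_] := hL j jp; exact.
have cvgL j : (0 < j)%N -> kap' n j @[n --> G] --> kapL j.
  by move=> jp; have [] := hL j jp.
(* No separate bound on the rescaled moments is required: the recursion makes them polynomials in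
   the rescaled cumulants, so they converge with these. *)
have hmuL k : exists l : R, mu' n k @[n --> G] --> l.
  elim/ltn_ind: k => -[|k] IH.
    by exists 1; rewrite /mu'; under eq_fun do rewrite expr0 mu0 mulr1; exact: cvg_cst.
  have /choice[m hm] : forall j : nat, exists l : R, (j <= k)%N -> mu' n j @[n --> G] --> l.
    move=> j; have [jk|] := leqP j k; last by exists 0.
    by have [l hl] := IH j jk; exists l.
  exists (\sum_(j < k.+1) 'C(k, j)%:R * kapL j.+1 * m (k - j)%N).
  under eq_fun do rewrite mukap'.
  apply: cvg_sumr => j _; apply: cvgM; last by apply: hm; exact: leq_subr.
  by apply: cvgMl_tmp; exact: cvgL.
have {hmuL} /choice[muL hmuL] := hmuL.
have mukapL : cumulants_of muL kapL.
  move=> k; apply: (@cvg_unique _ (@Rhausdorff R) (mu' n k.+1 @[n --> G])).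
    exact: hmuL.
  rewrite /=; under eq_fun do rewrite mukap'.
  apply: cvg_sumr => j _; apply: cvgM => //.
  by apply: cvgMl_tmp; exact: cvgL.
have muL0 : muL 0%N = 1.
  apply: (@cvg_unique _ (@Rhausdorff R) (mu' n 0%N @[n --> G])).
    exact: hmuL.
  by rewrite /mu' /=; under eq_fun do rewrite expr0 mu0 mulr1; exact: cvg_cst.
have muL_ge0 (N : nat) (g : nat -> R) :
    0 <= \sum_(i < N) \sum_(j < N) g i * g j * muL (i + j)%N.
  have h : (\sum_(i < N) \sum_(j < N) g i * g j * mu' n (i + j)%N) @[n --> G] -->
      \sum_(i < N) \sum_(j < N) g i * g j * muL (i + j)%N.
    by apply: cvg_sumr => i _; apply: cvg_sumr => j _; exact: cvgMl_tmp.
  rewrite -(cvg_lim (@Rhausdorff R) h); apply: limr_ge; first by apply/cvg_ex; eexists; exact: h.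
  apply: nearW => n; have := mu_ge0 n N (fun i => c n ^+ i * g i).
  congr (0 <= _); apply: eq_bigr => i _; apply: eq_bigr => j _.
  by rewrite /mu' exprD; ring.
have kapL0 j : (3 <= j)%N -> kapL j = 0.
  apply: (@marcinkiewicz _ muL kapL s.+1) => // i si.
  by apply: kapLs; lia.
have qcvg j : (3 <= j)%N -> c n * q n j @[n --> G] --> (0 : R).
  move=> j3; apply: (@expr_cvg0 _ _ _ j) => //; first by lia.
    by move=> n; rewrite mulr_ge0// ltW.
  under eq_fun do rewrite -kap'E//.
  have h : kap' n j @[n --> G] --> (0 : R) by rewrite -(kapL0 j j3); apply: cvgL; lia.
  apply/cvgr0Pnorm_le => e e0; move/cvgr0Pnorm_le: h => /(_ _ e0).
  by apply: filterS => n; rewrite normr_id.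
(* By definition of [lam], the numbers [c n] and [c n * q n j] add up to 1. Since the latter vanish
   in the limit, the rescaling was asymptotically trivial and can be undone. *)
have ccvg : c n @[n --> G] --> (1 : R).
  have -> : c = (fun n => 1 - \sum_(j < s) c n * q n j).
    apply/funext => n; rewrite -mulr_sumr; apply: (mulfI (lt0r_neq0 (lam0 n))).
    have lc : lam n * c n = 1 by rewrite /c divff ?lt0r_neq0.
    by rewrite mulrBr mulrA lc mulr1 mul1r /lam addrK.
  have h : \sum_(j < s) c n * q n j @[n --> G] --> \sum_(j < s) (0 : R).
    apply: cvg_sumr => j _; have [j3|j3] := leqP 3 j; first exact: qcvg.
    by rewrite /q leqNgt j3/=; under eq_fun do rewrite mulr0; exact: cvg_cst.
  have := cvgB (cvg_cst (1 : R)) h; rewrite big1_eq subr0; exact.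
have : kap n j0 @[n --> G] --> (0 : R).
  have -> : kap ^~ j0 = (fun n => kap' n j0 * (c n ^+ j0)^-1).
    by apply/funext => n; rewrite /kap' mulrAC divff ?mul1r// expf_neq0// lt0r_neq0.
  rewrite -(mul0r (1 ^+ j0)^-1); apply: cvgM.
    by rewrite -(kapL0 j0 j03); apply: cvgL; lia.
  apply: cvgV; first by rewrite expr1n oner_neq0.
  exact: (cvg_comp _ _ ccvg (@exprn_continuous _ _ _)).
move=> /cvgr0Pnorm_le /(_ _ eps0) hG.
have : G set0 by apply: filterS (filterI Geps hG) => n /= [h1 h2]; move: h1; rewrite ltNge h2.
exact: filter_not_empty.
Qed.
End Janson.

(** * Absolute regularity *)

Section AlgebraApproximation.
Context {d : measure_display} {T : measurableType d} {R : realType}.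
Variables (mu : {measure set T -> \bar R}) (G : set (set T)).
Hypothesis mu_fin : (mu setT < +oo)%E.
Hypothesis G0 : G set0.
Hypothesis GC : forall A, G A -> G (~` A).
Hypothesis GU : forall A B, G A -> G B -> G (A `|` B).
Hypothesis Gm : G `<=` measurable.

Definition approximable (C : set T) : Prop := measurable C /\
  forall e : R, 0 < e -> exists2 E, G E & (mu (C `+` E) <= e%:E)%E.

Let setYm (A B : set T) : measurable A -> measurable B -> measurable (A `+` B).
Proof. by move=> mA mB; rewrite setY_def; apply: measurableU; exact: measurableD. Qed.

Let approximableC C : approximable C -> approximable (~` C).
Proof.
move=> [mC hC]; split; first exact: measurableC.
move=> e e0; have [E GE hE] := hC e e0; exists (~` E); first exact: GC.
suff -> : ~` C `+` ~` E = C `+` E by [].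
by rewrite !setY_def !setDE !setCK setUC [C `&` _]setIC [E `&` _]setIC.
Qed.

Let approximableU C C' : approximable C -> approximable C' ->
  approximable (C `|` C').
Proof.
move=> [mC hC] [mC' hC']; split; first exact: measurableU.
move=> e e0; have e2 : 0 < e / 2 by rewrite divr_gt0.
have [E GE hE] := hC _ e2; have [E' GE' hE'] := hC' _ e2.
exists (E `|` E'); first exact: GU.
have mE := Gm GE; have mE' := Gm GE'.
apply: (@le_trans _ _ (mu ((C `+` E) `|` (C' `+` E')))).
  rewrite le_measure ?inE//.
  - by apply: setYm; exact: measurableU.
  - by apply: measurableU; exact: setYm.
  - move=> x; rewrite !setY_def /=; tauto.
apply: (le_trans (measureU2 _ _ _)); try exact: setYm.
by rewrite (splitr e) EFinD leeD.
Qed.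

(** The approximable sets form a sigma-algebra containing [G]: a countable union is first cut down
    to a finite one, at the cost of [e / 2], by continuity from above of a finite measure. *)
Lemma sigma_algebra_approx (C : set T) : <<s G >> C -> approximable C.
Proof.
apply: smallest_sub; last first.
  move=> E GE; split; first exact: Gm.
  by move=> e e0; exists E => //; rewrite setYK measure0 lee_fin ltW.
split.
- split; first exact: measurable0.
  by move=> e e0; exists set0 => //; rewrite setYK measure0 lee_fin ltW.
- by move=> A hA; rewrite setTD; exact: approximableC.
move=> F hF; have mF n : measurable (F n) by have [] := hF n.
split; first exact: bigcupT_measurable.
move=> e e0; have e2 : 0 < e / 2 by rewrite divr_gt0.
pose U n := \big[setU/set0]_(i < n) F i.
have mU n : measurable (U n) by apply: bigsetU_measurable.
have hU n : approximable (U n).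
  elim: n => [|n IH]; rewrite /U ?big_ord0 ?big_ord_recr/=; last exact: approximableU.
  split; first exact: measurable0.
  by move=> e' e'0; exists set0 => //; rewrite setYK measure0 lee_fin ltW.
have mCF : measurable (\bigcup_n F n) by exact: bigcupT_measurable.
have cv : (mu \o (fun n => (\bigcup_n F n) `\` U n)) @ \oo --> (0 : \bar R)%E.
  have cap0 : \bigcap_n ((\bigcup_n F n) `\` U n) = set0.
    apply/seteqP; split => // x hx.
    have [[n _ Fnx] _] := hx 0%N I.
    have [_] := hx n.+1 I; apply.
    by rewrite /U -bigcup_mkord; exists n => /=.
  rewrite -(measure0 mu) -cap0; apply: nonincreasing_cvg_mu.
  - apply: (le_lt_trans _ mu_fin); rewrite le_measure ?inE//.
    by apply: measurableD.
  - by move=> i; apply: measurableD.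
  - by rewrite cap0.
  - move=> n m nm; apply/subsetPset; apply: setDS.
    rewrite /U -!bigcup_mkord; apply: bigcup_sub => i /= ni x Fix.
    by exists i => //=; exact: leq_trans nm.
have [hfin /cvgr0Pnorm_le /(_ _ e2) hn] : (\forall n \near \oo,
    mu ((\bigcup_n F n) `\` U n) \is a fin_num) /\
    fine (mu ((\bigcup_n F n) `\` U n)) @[n --> \oo] --> (0 : R).
  by move/fine_cvgP : cv => [].
have [n [fn hn']] : exists n, mu ((\bigcup_n F n) `\` U n) \is a fin_num /\
    `|fine (mu ((\bigcup_n F n) `\` U n))| <= e / 2.
  by have [n _ h] := filterI hfin hn; exists n; apply: h => /=.
have [_ /(_ _ e2)[E GE hE]] := hU n; exists E => //.
have mE := Gm GE.
apply: (@le_trans _ _ (mu ((\bigcup_n F n) `\` U n `|` (U n `+` E)))).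
  have UF : U n `<=` \bigcup_n F n.
    by rewrite /U -bigcup_mkord; apply: bigcup_sub => i _ x Fix; exists i.
  rewrite le_measure ?inE//; [exact: setYm|apply: measurableU; [exact: measurableD|exact: setYm]|].
  move=> x; rewrite !setY_def /= => -[[Fx nEx]|[Ex nFx]].
    by have [Ux|Ux] := pselect (U n x); [right; left|left].
  by right; right; split => // /UF.
apply: (le_trans (measureU2 _ _ _)); [exact: measurableD|exact: setYm|].
have {}hn' : (mu ((\bigcup_n F n) `\` U n) <= (e / 2)%:E)%E.
  by rewrite -(fineK fn) lee_fin; exact: le_trans (ler_norm _) hn'.
by rewrite (splitr e) EFinD; apply: leeD; [exact: hn'|exact: hE].
Qed.

End AlgebraApproximation.

Section StepSets.
Context {d1 d2 : measure_display} {T1 : measurableType d1}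
  {T2 : measurableType d2} {R : realType}.

(* Sets with finitely many distinct sections; unlike finite unions of
   rectangles they are visibly closed under complements. *)
Definition step_set (E : set (T1 * T2)) : Prop :=
  exists (I : finType) (iota : T1 -> I) (D : I -> set T2),
  [/\ forall i, measurable (iota @^-1` [set i]), forall i, measurable (D i) &
      E = [set u | D (iota u.1) u.2]].

Lemma step_set_bigcup (I : finType) (iota : T1 -> I) (D : I -> set T2) :
  [set u | D (iota u.1) u.2] =
  \bigcup_(i in [set: I]) ((iota @^-1` [set i]) `*` D i).
Proof.
apply/seteqP; split => [[x y] /= h|[x y] [i _ [/= <-]]//].
by exists (iota x).
Qed.

Lemma measurable_step_set : step_set `<=` measurable.
Proof.
move=> _ [I [iota [D [mi mD ->]]]]; rewrite (step_set_bigcup iota D).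
apply: fin_bigcup_measurable; first exact: finite_finset.
by move=> i _; exact: measurableX.
Qed.

Lemma step_set0 : step_set set0.
Proof.
exists unit, (fun=> tt), (fun=> set0); split => // i.
by rewrite (_ : _ @^-1` _ = setT)//; apply/seteqP; split => // x _ /=; case: i.
Qed.

Lemma step_setC E : step_set E -> step_set (~` E).
Proof.
move=> [I [iota [D [mi mD ->]]]]; exists I, iota, (fun i => ~` D i).
by split => // i; exact: measurableC.
Qed.

Lemma step_setU E E' : step_set E -> step_set E' -> step_set (E `|` E').
Proof.
move=> [I [iota [D [mi mD ->]]]] [I' [iota' [D' [mi' mD' ->]]]].
exists (I * I')%type, (fun x => (iota x, iota' x)), (fun i => D i.1 `|` D' i.2).
split => // -[i i']; last exact: measurableU.
rewrite (_ : _ @^-1` _ = (iota @^-1` [set i]) `&` (iota' @^-1` [set i'])).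
  exact: measurableI.
by apply/seteqP; split => x /= => [[-> ->]|[-> ->]].
Qed.

(** A rectangle is a step set: its sections are [B] over [A] and [set0] elsewhere, whence the index
    type [bool]. *)
Lemma sigma_step_set : <<s step_set >> = (measurable : set (set (T1 * T2))).
Proof.
apply/seteqP; split.
  by apply: smallest_sub; [exact: sigma_algebra_measurable|exact: measurable_step_set].
rewrite measurable_prod_measurableType; apply: sub_sigma_algebra2.
move=> _ [A mA [B mB <-]].
exists bool, (fun x => `[< A x >]), (fun b => if b then B else set0); split.
- case.
    rewrite (_ : _ @^-1` _ = A)//; apply/seteqP; split => x /=; first by move/asboolP.
    by move=> Ax; apply/asboolP.
  rewrite (_ : _ @^-1` _ = ~` A); first exact: measurableC.
  apply/seteqP; split => x /=; first by move=> /asboolPn.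
  by move=> Ax; apply/asboolPn.
- by case.
- apply/seteqP; split => [[x y] [/= Ax By]|[x y] /=].
    by rewrite asboolT.
  by case: asboolP.
Qed.

Lemma probability_setY_le {d} {T : measurableType d} (P : probability T R)
  (C E : set T) : measurable C -> measurable E ->
  `|fine (P C) - fine (P E)| <= fine (P (C `+` E)).
Proof.
have key (A B : set T) : measurable A -> measurable B ->
    fine (P A) - fine (P B) <= fine (P (A `+` B)).
  move=> mA mB.
  have mY : measurable (A `+` B).
    by rewrite setY_def; apply: measurableU; exact: measurableD.
  rewrite lerBlDl -lee_fin EFinD !fineK ?fin_num_measure//.
  apply: (@le_trans _ _ (P (B `|` (A `+` B)))); last exact: measureU2.
  rewrite le_measure ?inE//; first exact: measurableU.
  move=> x Ax; have [Bx|Bx] := pselect (B x); first by left.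
  by right; rewrite setY_def; left.
move=> mC mE; rewrite ler_norml key// andbT lerNl opprB setYC; exact: key.
Qed.

(** Approximating with respect to the sum of the two measures produces one step set that is close to
    [C] for both of them. *)
Lemma step_set_tv (mu nu : probability (T1 * T2)%type R) (b : R) :
  (forall E, step_set E -> `|fine (mu E) - fine (nu E)| <= b) ->
  forall C, measurable C -> `|fine (mu C) - fine (nu C)| <= b.
Proof.
move=> h C mC; apply/ler_addgt0Pr => e e0.
have hfin : (measure_add mu nu setT < +oo)%E.
  by rewrite measure_addE lte_add_pinfty// ltey_eq fin_num_measure.
have [_ /(_ _ e0)[E sE]] := @sigma_algebra_approx _ _ _ (measure_add mu nu) _ hfin
  step_set0 step_setC step_setU measurable_step_set C
  (eq_ind_r (fun M : set (set (T1 * T2)) => M C) mC sigma_step_set).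
move=> hY0; have {hY0} : (measure_add mu nu (C `+` E) <= e%:E)%E := hY0.
have mE := measurable_step_set sE.
have mY : measurable (C `+` E).
  by rewrite setY_def; apply: measurableU; exact: measurableD.
have -> : (measure_add mu nu (C `+` E) = mu (C `+` E) + nu (C `+` E))%E := measure_addE mu nu _.
rewrite -(fineK (fin_num_measure mu _ mY)) -(fineK (fin_num_measure nu _ mY)).
rewrite -EFinD lee_fin => hY.
have h1 := probability_setY_le mu mC mE; have h2 := probability_setY_le nu mC mE.
have -> : fine (mu C) - fine (nu C) = (fine (mu C) - fine (mu E)) +
  (fine (mu E) - fine (nu E)) - (fine (nu C) - fine (nu E)) by ring.
apply: (le_trans (ler_normB _ _)).
apply: (le_trans (lerD (ler_normD _ _) (lexx _))).
by have := h _ sE; move: h1 h2 hY; lra.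
Qed.

End StepSets.

(** * Conditional probabilities and finite partitions of the past *)

Section CondProb.
Context {d : measure_display} {T : measurableType d} {R : realType}.
Variables (P : probability T R) (Gam : set (set T)).
Hypothesis Gam_sub : Gam `<=` measurable.

Let sub_m (B : set T) : <<s Gam >> B -> measurable B.
Proof. by apply: smallest_sub => //; exact: sigma_algebra_measurable. Qed.

(** Radon-Nikodym derivative of the measure [B |-> P (B]&[A)] with respect to the restriction of [P]
    to the sub-sigma-algebra. This restriction is obtained as the image of [P] under the identity
    [phi], seen as a map onto the same set with the coarser structure. *)
Lemma cond_prob_exists (A : set T) : measurable A ->
  exists c, is_cond_prob P <<s Gam >> A c.
Proof.
move=> mA; pose T' : measurableType _ := g_sigma_algebraType Gam.
pose phi : T -> T' := idfun.
have mphi : measurable_fun setT phi.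
  by move=> _ B mB; rewrite setTI; exact: sub_m.
pose X : {mfun T >-> T'} := HB.pack phi (isMeasurableFun.Build _ _ _ _ phi mphi).
have [nu0 nu0E'] : exists nu0 : {measure set T' -> \bar R}, nu0 = pushforward (mrestr P mA) phi :> (set T' -> \bar R).
  by unshelve eexists (pushforward (mrestr P mA) phi).
have nu0E B : nu0 B = P (B `&` A) by rewrite nu0E'.
have nufin (B : set T') : measurable B -> nu0 B \is a fin_num.
  move=> mB; rewrite nu0E fin_num_measure//.
  by apply: measurableI => //; exact: sub_m.
pose nu : {charge set T' -> \bar R} := HB.pack (nu0 : set T' -> \bar R)
  (isCharge.Build _ T' R nu0 (measure0 nu0) nufin (@measure_semi_sigma_additive _ _ _ nu0)).
pose mu : probability T' R := distribution P X.
have numu : nu `<< mu.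
  apply/null_content_dominatesP => B mB muB.
  have PB : P B = 0%E := muB.
  have -> : nu B = P (B `&` A) := nu0E B.
  apply/eqP; rewrite eq_le measure_ge0 andbT -PB; apply: le_measure; rewrite ?inE.
  - by apply: measurableI => //; exact: sub_m.
  - exact: sub_m.
  - by move=> x [].
pose g := Radon_Nikodym nu mu.
have gfin x : g x \is a fin_num by exact: Radon_Nikodym_fin_num.
have gint : mu.-integrable setT g by exact: Radon_Nikodym_integrable.
have mg : measurable_fun [set: T'] g by exact: measurable_int gint.
have gint' : P.-integrable setT (g \o phi).
  apply/integrableP; split; first exact: measurableT_comp.
  have /integrableP[_] := gint; rewrite ge0_integral_distribution//.
  exact: measurableT_comp.
exists (fine \o g); split.
- move=> B mB; have := measurableT_comp (@fine_measurable R setT measurableT) mg.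
  by move=> /(_ measurableT B mB); rewrite setTI.
- rewrite (_ : EFin \o _ = g \o phi)//.
  by apply/funext => x /=; rewrite fineK.
- move=> B GB; rewrite setIC -nu0E -[LHS](_ : (\int[mu]_(x in B) g x)%E = _).
    by rewrite -Radon_Nikodym_integral.
  rewrite integral_pushforward//.
    by apply: eq_integral => x _ /=; rewrite fineK.
  by apply: integrableS gint' => //; exact: sub_m.
Qed.

(** Each summand is the integral over its cell of the deviation of the conditional probability of
    [A i], which [h] dominates; the cells partition the space, so the integrals of [h] add up to
    [b]. The event may vary with the cell because [h] dominates all deviations at once. *)
Lemma deviations_partition_le (H : set (set T)) (h : T -> \bar R) (b : R)
  (I : finType) (iota : T -> I) (A : I -> set T) :
  is_ess_sup_family P (cond_prob_deviations P <<s Gam >> H) h ->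
  b%:E = (\int[P]_w h w)%E ->
  (forall i, <<s Gam >> (iota @^-1` [set i])) ->
  (forall i, H (A i)) -> (forall i, measurable (A i)) ->
  `|\sum_i (fine (P (iota @^-1` [set i] `&` A i)) -
            fine (P (iota @^-1` [set i])) * fine (P (A i)))| <= b.
Proof.
move=> [mh hdom _] hb iotaG HA mA.
have mB i : measurable (iota @^-1` [set i]) by exact: sub_m.
have [c hc] := choice (fun i => cond_prob_exists (mA i)).
have hdev i : {ae P, forall w, ((`|c i w - fine (P (A i))|)%:E <= h w)%E}.
  by apply: hdom; exists (A i), (c i).
(* An essential supremum is nonnegative only almost surely. Its positive part has the same integral,
   because [h] dominates the nonnegative deviation of index [iota point], and can be integrated cell
   by cell as a nonnegative function. *)
pose h' := (h^\+)%E.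
have mh' : measurable_fun setT h' by exact: measurable_funepos.
have hdev' i : {ae P, forall w, ((`|c i w - fine (P (A i))|)%:E <= h' w)%E}.
  apply: filterS (hdev i) => w hw.
  by apply: (le_trans hw); rewrite /h' funeposE le_max lexx.
have hb' : b%:E = (\int[P]_w h' w)%E.
  rewrite hb; apply: ae_eq_integral => //.
  apply: filterS (hdev (iota point)) => w hw _.
  by rewrite /h' funeposE max_l//; apply: le_trans hw; rewrite lee_fin.
have hsum : (\sum_i \int[P]_(w in iota @^-1` [set i]) h' w = b%:E)%E.
  rewrite hb' -ge0_integral_bigsetU//=.
  - rewrite (_ : \big[setU/set0]_(i <- _) _ = setT)//.
    apply/seteqP; split => // w _; rewrite -bigcup_seq.
    by exists (iota w) => //=; rewrite mem_index_enum.
  - exact: index_enum_uniq.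
  - exact: trivIset_preimage1.
  - exact: measurable_funTS.
  - by move=> w _; exact: funepos_ge0.
rewrite -lee_fin -hsum; apply: (le_trans (y := (\sum_i
  `|fine (P (iota @^-1` [set i] `&` A i)) -
    fine (P (iota @^-1` [set i])) * fine (P (A i))|%:E)%E)).
  by rewrite sumEFin lee_fin; exact: ler_norm_sum.
apply: lee_sum => i _; set B := _ @^-1` _; set p := fine (P (A i)).
have [cm ci cE] := hc i.
have ciB : P.-integrable B (EFin \o c i) by apply: integrableS ci => //; exact: mB.
have pint : P.-integrable B (fun=> p%:E).
  by apply: (@integrableS _ _ _ P setT) => //; [exact: mB|exact: finite_measure_integrable_cst].
have -> : (`|fine (P (B `&` A i)) - fine (P B) * p|%:E =
    `|\int[P]_(w in B) ((c i w)%:E - p%:E)|)%E.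
  rewrite (integralB (mB i) ciB pint) (cE B (iotaG i)) (integral_cst _ (mB i)).
  have fB : P B = (fine (P B))%:E.
    by rewrite fineK ?fin_num_measure//; exact: mB.
  have fAB : P (A i `&` B) = (fine (P (B `&` A i)))%:E.
    by rewrite setIC fineK ?fin_num_measure//; apply: measurableI => //; exact: mB.
  rewrite fAB [X in (_ - _ * X)%E]fB -EFinM -EFinB abse_EFin.
  by rewrite [p * _]mulrC.
apply: (le_trans (le_abse_integral _ (mB i) _)).
  exact: measurable_int (integrableB (mB i) ciB pint).
apply: ae_ge0_le_integral => //.
- apply: measurableT_comp => //.
  exact: measurable_int (integrableB (mB i) ciB pint).
- by move=> w _; exact: funepos_ge0.
- exact: measurable_funTS.
- by apply: filterS (hdev' i) => w hw _; rewrite -EFinB abse_EFin.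
Qed.

End CondProb.

(** * Bounded random variables *)

Section BoundedExpectation.
Context {d : measure_display} {T : measurableType d} {R : realType}.

(** The bound holds everywhere and mentions no probability, since the same function is integrated
    against several laws, their products and sections. *)
Definition bounded_mfun (f : T -> R) (K : R) : Prop :=
  measurable_fun setT f /\ forall x, `|f x| <= K.

Lemma bounded_mfun_integrable (P : probability T R) (f : T -> R) (K : R) :
  bounded_mfun f K -> P.-integrable setT (EFin \o f).
Proof.
move=> [mf fK]; apply: measurable_bounded_integrable => //.
  by rewrite ltey_eq fin_num_measure.
exists K; split; first exact: num_real.
by move=> M KM x _; apply: (le_trans (fK x)); exact: ltW.
Qed.

Lemma bounded_mfun_cst (c : R) : bounded_mfun (cst c) `|c|.
Proof. by split. Qed.

Lemma bounded_mfunD (f g : T -> R) (K L : R) : bounded_mfun f K ->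
  bounded_mfun g L -> bounded_mfun (fun x => f x + g x) (K + L).
Proof.
move=> [mf fK] [mg gL]; split; first exact: measurable_funD.
by move=> x; apply: (le_trans (ler_normD _ _)); exact: lerD.
Qed.

Lemma bounded_mfunM (f g : T -> R) (K L : R) : bounded_mfun f K ->
  bounded_mfun g L -> bounded_mfun (fun x => f x * g x) (K * L).
Proof.
move=> [mf fK] [mg gL]; split; first exact: measurable_funM.
by move=> x; rewrite normrM ler_pM.
Qed.

Lemma bounded_mfunN (f : T -> R) (K : R) : bounded_mfun f K ->
  bounded_mfun (fun x => - f x) K.
Proof.
move=> [mf fK]; split; first exact: measurableT_comp.
by move=> x; rewrite normrN.
Qed.

Lemma bounded_mfunB (f g : T -> R) (K L : R) : bounded_mfun f K ->
  bounded_mfun g L -> bounded_mfun (fun x => f x - g x) (K + L).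
Proof. by move=> hf hg; apply: bounded_mfunD => //; exact: bounded_mfunN. Qed.

Variable P : probability T R.
Local Notation Ex f := (\int[P]_x f x)%R.

Lemma expect_cst (c : R) : Ex (cst c) = c.
Proof.
rewrite Rintegral_cst//; transitivity (c * fine (1%E : \bar R)); last by rewrite mulr1.
by congr (c * fine _); exact: probability_setT.
Qed.

Lemma expectD (f g : T -> R) (K L : R) : bounded_mfun f K -> bounded_mfun g L ->
  Ex (fun x => f x + g x) = Ex f + Ex g.
Proof.
move=> hf hg; rewrite RintegralD//; first exact: bounded_mfun_integrable hf.
exact: bounded_mfun_integrable hg.
Qed.

Lemma expectB (f g : T -> R) (K L : R) : bounded_mfun f K -> bounded_mfun g L ->
  Ex (fun x => f x - g x) = Ex f - Ex g.
Proof.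
move=> hf hg; rewrite RintegralB//; first exact: bounded_mfun_integrable hf.
exact: bounded_mfun_integrable hg.
Qed.

Lemma expectZl (c : R) (f : T -> R) (K : R) : bounded_mfun f K ->
  Ex (fun x => c * f x) = c * Ex f.
Proof. by move=> hf; rewrite RintegralZl//; exact: bounded_mfun_integrable hf. Qed.

Lemma expect_ge0 (f : T -> R) : (forall x, 0 <= f x) -> 0 <= Ex f.
Proof. by move=> f0; apply: Rintegral_ge0. Qed.

Lemma expect_le (f g : T -> R) (K L : R) : bounded_mfun f K -> bounded_mfun g L ->
  (forall x, f x <= g x) -> Ex f <= Ex g.
Proof.
move=> hf hg fg; apply: le_Rintegral => //; first exact: bounded_mfun_integrable hf.
exact: bounded_mfun_integrable hg.
Qed.

Lemma expect_norm_le (f : T -> R) (K : R) : bounded_mfun f K -> `|Ex f| <= K.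
Proof.
move=> hf; have [mf fK] := hf.
have hK : bounded_mfun (cst K) `|K| by exact: bounded_mfun_cst.
rewrite ler_norml -[X in - X](expect_cst K) -[in X in _ && X](expect_cst K).
have -> : - Ex (cst K) = Ex (cst (- K)) by rewrite !expect_cst.
apply/andP; split.
  apply: (expect_le _ hf); first exact: bounded_mfun_cst.
  by move=> x /=; move: (fK x); rewrite ler_norml => /andP[].
apply: (expect_le hf hK) => x /=.
by move: (fK x); rewrite ler_norml => /andP[].
Qed.

Lemma expect_sum (I : Type) (s : seq I) (Q : pred I) (f : I -> T -> R)
    (K : I -> R) : (forall i, Q i -> bounded_mfun (f i) (K i)) ->
  bounded_mfun (fun x => \sum_(i <- s | Q i) f i x) (\sum_(i <- s | Q i) K i) /\
  Ex (fun x => \sum_(i <- s | Q i) f i x) = \sum_(i <- s | Q i) Ex (f i).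
Proof.
move=> hf; elim: s => [|i s [IH1 IH2]].
  have -> : (fun x => \sum_(i <- [::] | Q i) f i x) = cst 0.
    by apply/funext => x; rewrite big_nil.
  by rewrite !big_nil expect_cst -{2}(@normr0 _ R); split => //; exact: bounded_mfun_cst.
have [Qi|Qi] := boolP (Q i); last first.
  have -> : (fun x => \sum_(j <- i :: s | Q j) f j x) = (fun x => \sum_(j <- s | Q j) f j x).
    by apply/funext => x; rewrite big_cons (negPf Qi).
  by rewrite !big_cons (negPf Qi).
have -> : (fun x => \sum_(j <- i :: s | Q j) f j x) =
    (fun x => f i x + \sum_(j <- s | Q j) f j x).
  by apply/funext => x; rewrite big_cons Qi.
rewrite !big_cons Qi; split; first exact: bounded_mfunD (hf _ Qi) IH1.
by rewrite (expectD (hf _ Qi) IH1) IH2.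
Qed.

End BoundedExpectation.

Section BoundedFubini.
Context {d1 d2 : measure_display} {T1 : measurableType d1}
  {T2 : measurableType d2} {R : realType}.
Variables (P1 : probability T1 R) (P2 : probability T2 R).
Variables (g : T1 * T2 -> R) (K : R).
Hypothesis gK : bounded_mfun g K.

Lemma bounded_mfun_section1 x : bounded_mfun (fun y => g (x, y)) K.
Proof.
have [mg hg] := gK; split => // ; exact: measurableT_comp mg _.
Qed.

Lemma bounded_mfun_section2 y : bounded_mfun (fun x => g (x, y)) K.
Proof.
have [mg hg] := gK; split => // ; exact: measurableT_comp mg _.
Qed.

Let P12 : probability (T1 * T2)%type R := (P1 \x P2)%E.

Let gint : (P1 \x P2)%E.-integrable setT (EFin \o g).
Proof. exact: (bounded_mfun_integrable P12 gK). Qed.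

Lemma bounded_mfun_expect2 : bounded_mfun (fun x => \int[P2]_y g (x, y))%R K.
Proof.
split; last by move=> x; apply: expect_norm_le; exact: bounded_mfun_section1.
have := measurable_fubini_F gint => h.
exact: measurableT_comp (@fine_measurable R setT measurableT) h.
Qed.

Lemma bounded_mfun_expect1 : bounded_mfun (fun y => \int[P1]_x g (x, y))%R K.
Proof.
split; last by move=> x; apply: expect_norm_le; exact: bounded_mfun_section2.
have := measurable_fubini_G gint => h.
exact: measurableT_comp (@fine_measurable R setT measurableT) h.
Qed.

Lemma expect_fubini1 :
  (\int[P1]_x \int[P2]_y g (x, y) = \int[P12]_u g u)%R.
Proof.
rewrite [RHS]/Rintegral -(integral12_prod_meas1 gint).
rewrite /Rintegral; congr fine; apply: eq_integral => x _.
rewrite /fubini_F /= fineK//; apply: integrable_fin_num => //.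
exact: bounded_mfun_integrable (bounded_mfun_section1 x).
Qed.

Lemma expect_fubini2 :
  (\int[P2]_y \int[P1]_x g (x, y) = \int[P12]_u g u)%R.
Proof.
rewrite [RHS]/Rintegral -(integral21_prod_meas1 gint).
rewrite /Rintegral; congr fine; apply: eq_integral => x _.
rewrite /fubini_G /= fineK//; apply: integrable_fin_num => //.
exact: bounded_mfun_integrable (bounded_mfun_section2 x).
Qed.

Lemma expect_fubini :
  (\int[P1]_x \int[P2]_y g (x, y) = \int[P2]_y \int[P1]_x g (x, y))%R.
Proof. by rewrite expect_fubini1 expect_fubini2. Qed.

End BoundedFubini.

(** * From probabilities of events to bounded expectations *)

Section TotalVariation.
Context {d : measure_display} {T : measurableType d} {R : realType}.

Lemma sum_nat_le_trunc (N : nat) (s : R) : 0 <= s <= N%:R ->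
  \sum_(i < N) ((i.+1%:R <= s)%R : nat)%:R = (Num.truncn s)%:R :> R.
Proof.
move=> /andP[s0 sN]; rewrite -natr_sum; congr (_%:R).
have tN : (Num.truncn s <= N)%N by rewrite -(ler_nat R) (le_trans _ sN)// truncn_le.
rewrite (eq_bigr (fun i : 'I_N => (i < Num.truncn s)%N : nat)); last first.
  by move=> i _; rewrite truncn_ge_nat.
rewrite -(big_mkord xpredT (fun i => (i < Num.truncn s)%N : nat)).
rewrite (@big_cat_nat _ _ _ (Num.truncn s))//= [X in (_ + X)%N]big_nat.
rewrite [X in (_ + X)%N]big1 ?addn0; last by move=> i /andP[+ _]; rewrite ltnNge => ->.
rewrite big_nat (eq_bigr (fun=> 1%N)); last by move=> i /andP[_ ->].
by rewrite -big_nat sum_nat_const_nat muln1 subn0.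
Qed.

Lemma expect_indic (P : probability T R) (A : set T) : measurable A ->
  (\int[P]_x \1_A x)%R = fine (P A).
Proof. by move=> mA; rewrite /Rintegral integral_indic// setIT. Qed.

Lemma bounded_mfun_indic (A : set T) : measurable A -> bounded_mfun (\1_A : T -> R) 1.
Proof.
move=> mA; split; first exact: measurable_indic.
by move=> x; rewrite indicE ger0_norm// lern1 leq_b1.
Qed.

(** Layers: [g] is within [M / N%:R] of [M / N%:R] times the sum of the indicators of [N] superlevel
    sets, and replacing [P] by [Q] changes each of their probabilities by at most [b]. *)
Lemma tv_expect_ge0_le (P Q : probability T R) (b M : R) (g : T -> R) :
  (forall C, measurable C -> `|fine (P C) - fine (Q C)| <= b) ->
  measurable_fun setT g -> 0 < M -> (forall x, 0 <= g x <= M) ->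
  `|\int[P]_x g x - \int[Q]_x g x|%R <= M * b.
Proof.
move=> hb mg M0 gM; apply/ler_addgt0Pr => e e0.
pose N := (Num.truncn (2 * M / e)).+1.
have N0 : 0 < N%:R :> R by rewrite ltr0n.
have hN : 2 * M / N%:R <= e.
  by rewrite ler_pdivrMr// -ler_pdivrMl// mulrC ltW// truncnS_gt.
pose A (i : nat) := [set x | i.+1%:R <= g x * N%:R / M].
have mA i : measurable (A i).
  have : measurable_fun setT (fun x => g x * N%:R / M).
    by apply: measurable_funM => //; exact: measurable_funM.
  move=> h; rewrite (_ : A i = (fun x => g x * N%:R / M) @^-1` `[i.+1%:R, +oo[).
    by rewrite -[X in measurable X]setTI; exact: h.
  by apply/seteqP; split => x /=; rewrite in_itv/= andbT.
have hA i := bounded_mfun_indic (mA i).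
pose gN x := M / N%:R * \sum_(i < N) \1_(A i) x.
have gNE x : gN x = M / N%:R * (Num.truncn (g x * N%:R / M))%:R.
  rewrite /gN -(@sum_nat_le_trunc N).
    congr (_ * _); apply: eq_bigr => i _; rewrite indicE; congr (_%:R).
    by congr nat_of_bool; apply/idP/idP => [|h]; rewrite inE.
  have /andP[g0 gM'] := gM x.
  rewrite !mulr_ge0 ?invr_ge0 ?(ltW M0)//= ler_pdivrMr// mulrC.
  by rewrite ler_pM2l.
have gN1 x : `|g x - gN x| <= M / N%:R.
  have /andP[g0 gM'] := gM x.
  have s0 : 0 <= g x * N%:R / M by rewrite !mulr_ge0 ?invr_ge0// ltW.
  have -> : g x = M / N%:R * (g x * N%:R / M) by field; rewrite !gt_eqF.
  rewrite gNE -mulrBr normrM ger0_norm ?divr_ge0 ?(ltW M0)//.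
  rewrite ler_piMr ?divr_ge0 ?(ltW M0)// ger0_norm ?subr_ge0 ?truncn_le//.
  by rewrite lerBlDr ltW// addrC natr1 truncnS_gt.
have hg : bounded_mfun g M.
  by split => // x; have /andP[g0 gM'] := gM x; rewrite ger0_norm.
have [hs _] := expect_sum P (index_enum 'I_N) (Q := xpredT)
  (fun (i : 'I_N) _ => hA i).
have hgN : bounded_mfun gN (`|M / N%:R| * \sum_(i < N) 1).
  by apply: bounded_mfunM => //; exact: bounded_mfun_cst.
have hgNE (P' : probability T R) :
    (\int[P']_x gN x)%R = M / N%:R * \sum_(i < N) fine (P' (A i)).
  have [hs' es] := expect_sum P' (index_enum 'I_N) (Q := xpredT)
    (fun (i : 'I_N) _ => hA i).
  rewrite /gN (expectZl _ _ hs') es; congr (_ * _).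
  by apply: eq_bigr => i _; rewrite expect_indic.
have near_gN (P' : probability T R) :
    `|\int[P']_x g x - \int[P']_x gN x|%R <= M / N%:R.
  rewrite -(expectB P' hg hgN); apply: expect_norm_le; split => //.
  by apply: measurable_funB => //; have [] := hgN.
have diff : `|\int[P]_x gN x - \int[Q]_x gN x|%R <= M * b.
  rewrite !hgNE -mulrBr -sumrB normrM ger0_norm ?divr_ge0 ?(ltW M0)//.
  rewrite -mulrA ler_pM2l// ler_pdivrMl//.
  apply: (le_trans (ler_norm_sum _ _ _)).
  apply: (@le_trans _ _ (\sum_(i < N) b)); first by apply: ler_sum => i _; exact: hb.
  by rewrite sumr_const card_ord mulr_natl.
have := near_gN P; have := near_gN Q; have : 2 * (M / N%:R) <= e by rewrite mulrA.
move: diff; move: (\int[P]_x g x)%R (\int[Q]_x g x)%R (\int[P]_x gN x)%R (\int[Q]_x gN x)%R.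
move=> a c a' c' h1 h2 h3 h4.
have -> : a - c = (a - a') - (c - c') + (a' - c') by ring.
apply: (le_trans (ler_normD _ _)).
apply: (le_trans (lerD (ler_normB _ _) (lexx _))).
by move: h1 h2 h3 h4; lra.
Qed.

Lemma tv_expect_le (P Q : probability T R) (b K : R) (g : T -> R) :
  (forall C, measurable C -> `|fine (P C) - fine (Q C)| <= b) ->
  bounded_mfun g K ->
  `|\int[P]_x g x - \int[Q]_x g x|%R <= 2 * K * b.
Proof.
move=> hb hg; have [mg gK] := hg.
have b0 : 0 <= b by apply: le_trans (hb setT measurableT).
have [K0|K0] := leP K 0.
  have K00 : K = 0.
    by apply/le_anti; rewrite K0 (le_trans _ (gK point)).
  rewrite K00 mulr0 mul0r (le_trans (ler_normB _ _))//.
  by rewrite -[leRHS]addr0 -K00 lerD// expect_norm_le.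
have hK : bounded_mfun (cst K : T -> R) `|K| by exact: bounded_mfun_cst.
have h := @tv_expect_ge0_le P Q b (2 * K) (fun x => g x + K) hb.
have := h _ _ _; rewrite !(expectD _ hg hK) !expect_cst.
rewrite opprD addrACA subrr addr0; apply.
- by apply: measurable_funD.
- by rewrite mulr_gt0.
- move=> x; have := gK x; rewrite ler_norml => /andP[h1 h2].
  by apply/andP; split; move: h1 h2; lra.
Qed.

End TotalVariation.

Lemma dist_le3 {R : realDomainType} (z0 z1 z2 z3 e1 e2 e3 : R) :
  `|z0 - z1| <= e1 -> `|z1 - z2| <= e2 -> `|z2 - z3| <= e3 ->
  `|z0 - z3| <= e1 + e2 + e3.
Proof.
move=> h1 h2 h3; have -> : z0 - z3 = (z0 - z1) + (z1 - z2) + (z2 - z3) by ring.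
apply: (le_trans (ler_normD _ _)); apply: lerD; last exact: h3.
by apply: (le_trans (ler_normD _ _)); exact: lerD.
Qed.

(** * Factorization over distant times *)

Section Interlacing.
Context {R : realType} {n : nat}.
Local Notation Rn := (n.-tuple R).
Implicit Types (A B : {set 'I_n}) (x y : Rn).

Definition agree_on (D : pred 'I_n) x y : Prop := forall i, D i -> tnth x i = tnth y i.

Definition depends_only {W : Type} (D : pred 'I_n) (f : Rn -> W) : Prop :=
  forall x y, agree_on D x y -> f x = f y.

Definition splice A (u : Rn * Rn) : Rn :=
  [tuple if i \in A then tnth u.1 i else tnth u.2 i | i < n].

Lemma measurable_splice A : measurable_fun setT (splice A).
Proof.
apply/measurable_fun_tnthP => i; rewrite (_ : _ \o _ = fun u =>
    if i \in A then tnth u.1 i else tnth u.2 i); last first.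
  by apply/funext => u /=; rewrite tnth_mktuple.
have [iA|iA] := boolP (i \in A).
  exact: (measurableT_comp (measurable_tnth i) measurable_fst).
exact: (measurableT_comp (measurable_tnth i) measurable_snd).
Qed.

(** Here [t] is the first index of the future, and the past ends [m] before it. General functions of
    both are allowed, since the argument for interlaced sets feeds in functions of spliced
    samples. *)
Definition gap_mixing (mu : probability Rn R) (m : nat) (b : R) : Prop :=
  forall (t : nat) (g : Rn * Rn -> R) (K : R), bounded_mfun g K ->
    (forall y, depends_only (fun i => i + m <= t)%N (fun x => g (x, y))) ->
    (forall x, depends_only (fun i => t <= i)%N (fun y => g (x, y))) ->
    `|\int[mu]_x g (x, x) - \int[mu]_x \int[mu]_y g (x, y)|%R <= 2 * K * b.

Definition far_apart (m : nat) A B : Prop := forall i j : 'I_n, i \in A -> j \in B ->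
  (i + m <= j \/ j + m <= i)%N.

Variables (mu : probability Rn R) (m : nat) (b : R).
Hypothesis mix : gap_mixing mu m b.
Hypothesis b0 : 0 <= b.
Hypothesis m0 : (0 < m)%N.

(* If the first time of A :|: B is in A, the initial run of A, which precedes B
   by a gap, is replaced by an independent copy both in (X_A, X_B) and in the
   target (X_A, X'_B). *)
Lemma interlaced_expect_le A B (g : Rn * Rn -> R) (K : R) : bounded_mfun g K ->
  far_apart m A B ->
  (forall y, depends_only (mem A) (fun x => g (x, y))) ->
  (forall x, depends_only (mem B) (fun y => g (x, y))) ->
  `|\int[mu]_x g (x, x) - \int[mu]_x \int[mu]_y g (x, y)|%R <=
    4 * K * b * (#|A| + #|B|)%:R.
Proof.
have [N] := ubnP (#|A| + #|B|)%N; elim: N A B g => // N IH A B g ABN hg far gA gB.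
have K0 : 0 <= K by have [_ gK] := hg; exact: le_trans (normr_ge0 _) (gK point).
have base : 0 <= 4 * K * b * (#|A| + #|B|)%:R by rewrite !mulr_ge0.
have [A0|/set0Pn[a aA]] := eqVneq A finset.set0.
  have gE x y x' : g (x, y) = g (x', y) by apply: gA => i; rewrite A0 => i0; have : i \in finset.set0 := i0; rewrite finset.in_set0.
  rewrite (_ : (\int[mu]_x g (x, x))%R = (\int[mu]_x \int[mu]_y g (x, y))%R) ?subrr ?normr0//.
  rewrite (_ : (fun x => \int[mu]_y g (x, y))%R = cst (\int[mu]_y g (y, y))%R) ?expect_cst//.
  by apply/funext => x; apply: eq_Rintegral => y _; exact: gE.
have [B0|/set0Pn[c cB]] := eqVneq B finset.set0.
  have gE x y y' : g (x, y) = g (x, y') by apply: gB => i; rewrite B0 => i0; have : i \in finset.set0 := i0; rewrite finset.in_set0.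
  rewrite (_ : (\int[mu]_x g (x, x))%R = (\int[mu]_x \int[mu]_y g (x, y))%R) ?subrr ?normr0//.
  apply: eq_Rintegral => x _.
  rewrite (_ : (fun y => g (x, y)) = cst (g (x, x))) ?expect_cst//.
  by apply/funext => y; exact: gE.
wlog : A B g a aA c cB ABN hg far gA gB base / exists2 a0, a0 \in A & forall c', c' \in B -> (a0 < c')%N.
  move=> hw; case: (arg_minnP (fun i : 'I_n => i : nat) aA) => a0 a0A amin.
  case: (arg_minnP (fun i : 'I_n => i : nat) cB) => c0 c0B cmin.
  have [ac|ca] := ltnP a0 c0.
    apply: (hw A B g a aA c cB) => //; exists a0 => // c' /cmin; exact: leq_trans.
  have {ca} ca : (c0 < a0)%N.
    rewrite ltn_neqAle ca andbT; apply/eqP => e.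
    have := far a0 c0 a0A c0B; rewrite e; clear -m0; case=> h; lia.
  pose g' (u : Rn * Rn) := g (u.2, u.1).
  have hg' : bounded_mfun g' K.
    have [mg gK] := hg; split; last by move=> u; exact: gK.
    by apply: (measurableT_comp mg); exact: measurable_swap.
  rewrite (expect_fubini mu mu hg) addnC.
  apply: (hw B A g' c cB a aA) => //.
  - by rewrite addnC.
  - by move=> i j iB jA; have [?|?] := far j i jA iB; [right|left].
  - by rewrite addnC.
  - by exists c0 => // a' /amin; exact: leq_trans.
move=> [a0 a0A a0B].
case: (arg_minnP (fun i : 'I_n => i : nat) cB) => c0 c0B cmin.
(* The run [A1] ends by [c0 - m], while [A2] and [B] start at [c0] or later; so the mixing bound
   applies at [c0], and [splice A1] reads the run from one sample and all other times from
   another. *)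
pose A1 := [set i in A | (i < c0)%N]%SET.
pose A2 := A :\: A1.
have A1E i : (i \in A1) = (i \in A) && (i < c0)%N by rewrite inE.
have A2E i : (i \in A2) = (i \in A) && (c0 <= i)%N.
  by rewrite inE A1E andbC; case: (i \in A) => //=; rewrite -leqNgt.
have A2card : (#|A2| < #|A|)%N.
  apply: proper_card; apply/properP; split; first exact: subsetDl.
  by exists a0 => //; rewrite A2E a0A leqNgt a0B.
have gap i : i \in A1 -> (i + m <= c0)%N.
  rewrite A1E => /andP[iA ic0]; have [//|] := far i c0 iA c0B.
  by clear -m0 ic0 => h; lia.
have [mg gK] := hg.
pose h (u : Rn * Rn) := splice A1 u.
have mh : measurable_fun setT h by exact: measurable_splice.
have hE x y i : tnth (h (x, y)) i = if i \in A1 then tnth x i else tnth y i.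
  by rewrite /h /splice tnth_mktuple.
have hxx x : h (x, x) = x by apply: eq_from_tnth => i; rewrite hE if_same.
pose g1 (u : Rn * Rn) := g (h u, u.2).
have hg1 : bounded_mfun g1 K.
  split; last by move=> u; exact: gK.
  by apply: (measurableT_comp mg); exact: measurable_fun_pair.
have step1 : `|\int[mu]_x g (x, x) - \int[mu]_x \int[mu]_y g1 (x, y)|%R <= 2 * K * b.
  have := @mix c0 g1 K hg1; rewrite /g1 /=.
  under eq_Rintegral do rewrite hxx.
  apply.
  - move=> y x x' xx'; apply: gA => i iA; rewrite !hE; case: ifP => // /gap.
    exact: xx'.
  - move=> x y y' yy'; transitivity (g (h (x, y'), y)).
      apply: gA => i iA; rewrite !hE; case: ifP => //; rewrite A1E.
      move=> /negbT; rewrite negb_and -leqNgt => /orP[|/yy'//].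
      by rewrite [i \in A](iA : i \in A).
    by apply: gB => i iB; apply: yy'; exact: cmin.
(* Once the run is frozen at the values of [x], only [A2] and [B] matter, which contain fewer times
   in total; the bound given by induction is uniform in [x]. *)
have step2 x : `|\int[mu]_y g1 (x, y) - \int[mu]_u \int[mu]_v g (h (x, u), v)|%R <=
    4 * K * b * (#|A2| + #|B|)%:R.
  apply: (IH A2 B (fun u => g (h (x, u.1), u.2))).
  - by clear -A2card ABN; lia.
  - split; last by move=> u; exact: gK.
    apply: (measurableT_comp mg); apply: measurable_fun_pair => //.
    by apply: (measurableT_comp mh); exact: measurable_fun_pair.
  - by move=> i j; rewrite A2E => /andP[iA _]; exact: far.
  - move=> v u u' uu'; apply: gA => i iA; rewrite !hE; case: ifP => // iA1.
    by apply: uu'; rewrite /= inE iA1.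
  - by move=> u v v' vv'; exact: gB.
have step3 v : `|\int[mu]_x g (x, v) - \int[mu]_x \int[mu]_u g (h (x, u), v)|%R <= 2 * K * b.
  have := @mix c0 (fun u => g (h u, v)) K.
  under eq_Rintegral do rewrite hxx.
  apply.
  - split; last by move=> u; exact: gK.
    by apply: (measurableT_comp mg); exact: measurable_fun_pair.
  - move=> y x x' xx'; apply: gA => i iA; rewrite !hE; case: ifP => // /gap.
    exact: xx'.
  - move=> x y y' yy'; apply: gA => i iA; rewrite !hE; case: ifP => //; rewrite A1E.
    move=> /negbT; rewrite negb_and -leqNgt => /orP[|/yy'//].
    by rewrite [i \in A](iA : i \in A).
have hg3 : bounded_mfun (fun w : (Rn * Rn) * Rn => g (h w.1, w.2)) K.
  split; last by move=> u; exact: gK.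
  apply: (measurableT_comp mg); apply: measurable_fun_pair => //.
  by apply: (measurableT_comp mh).
have hg4 : bounded_mfun (fun w : (Rn * Rn) * Rn => g (h (w.1.1, w.2), w.1.2)) K.
  split; last by move=> u; exact: gK.
  apply: (measurableT_comp mg); apply: measurable_fun_pair.
    apply: (measurableT_comp mh); apply: measurable_fun_pair => //.
    exact: (measurableT_comp measurable_fst measurable_fst).
  exact: (measurableT_comp measurable_snd measurable_fst).
have hg5 x : bounded_mfun (fun w : Rn * Rn => g (h (x, w.1), w.2)) K.
  split; last by move=> u; exact: gK.
  apply: (measurableT_comp mg); apply: measurable_fun_pair => //.
  by apply: (measurableT_comp mh); exact: measurable_fun_pair.
have hI1 := bounded_mfun_expect2 mu mu hg1.
pose mu2 : probability (Rn * Rn)%type R := (mu \x mu)%E.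
have hI2 := bounded_mfun_expect2 mu mu (bounded_mfun_expect2 mu2 mu hg3).
have hI4 := bounded_mfun_expect2 mu2 mu hg4.
have hI3 := bounded_mfun_expect1 mu mu hg.
pose I2 := (\int[mu]_x \int[mu]_u \int[mu]_v g (h (x, u), v))%R.
have I2E : I2 = (\int[mu]_v \int[mu]_x \int[mu]_u g (h (x, u), v))%R.
  rewrite -(expect_fubini mu mu hI4)/=; apply: eq_Rintegral => x _.
  exact: (expect_fubini mu mu (hg5 x)).
have step2' : `|\int[mu]_x \int[mu]_y g1 (x, y) - I2|%R <= 4 * K * b * (#|A2| + #|B|)%:R.
  pose D2 x := (\int[mu]_y g1 (x, y) - \int[mu]_u \int[mu]_v g (h (x, u), v))%R.
  have <- : (\int[mu]_x D2 x = \int[mu]_x \int[mu]_y g1 (x, y) - I2)%R.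
    exact: (expectB mu hI1 hI2).
  have [mD2 _] : bounded_mfun D2 (K + K) := bounded_mfunB hI1 hI2.
  by apply: expect_norm_le; split.
have h5 : bounded_mfun (fun v => \int[mu]_x \int[mu]_u g (h (x, u), v))%R K.
  exact: (bounded_mfun_expect1 mu mu hI4).
have step3' : `|I2 - \int[mu]_x \int[mu]_y g (x, y)|%R <= 2 * K * b.
  pose D3 v := (\int[mu]_x g (x, v) - \int[mu]_x \int[mu]_u g (h (x, u), v))%R.
  have eD3 : (\int[mu]_v D3 v = \int[mu]_x \int[mu]_y g (x, y) - I2)%R.
    by rewrite I2E (expect_fubini mu mu hg); exact: (expectB mu hI3 h5).
  rewrite distrC -eD3.
  have [mD3 _] : bounded_mfun D3 (K + K) := bounded_mfunB hI3 h5.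
  by apply: expect_norm_le; split.
have Kb : 0 <= 4 * K * b by rewrite !mulr_ge0.
(* The two uses of the mixing bound cost [4 * K * b], paid for by the run, which contains at least
   one time of [A]. *)
have Nle : (#|A2| + #|B|)%:R + 1 <= (#|A| + #|B|)%:R :> R.
  by rewrite natr1 ler_nat; clear -A2card; lia.
apply: (le_trans (dist_le3 step1 step2' step3')).
apply: le_trans (ler_wpM2l Kb Nle); rewrite mulrDr mulr1.
by rewrite le_eqVlt; apply/orP; left; apply/eqP; ring.
Qed.

End Interlacing.

Lemma probability_step_set {d1 d2} {T1 : measurableType d1}
  {T2 : measurableType d2} {R : realType} (P : probability (T1 * T2)%type R)
  (I : finType) (iota : T1 -> I) (D : I -> set T2) :
  (forall i, measurable (iota @^-1` [set i])) -> (forall i, measurable (D i)) ->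
  fine (P [set u | D (iota u.1) u.2]) =
  \sum_i fine (P ((iota @^-1` [set i]) `*` D i)).
Proof.
move=> mi mD; have mX i := measurableX (mi i) (mD i).
have mE : measurable [set u | D (iota u.1) u.2].
  by apply: measurable_step_set; exists I, iota, D.
rewrite -(expect_indic P mE).
have [_ h] := expect_sum P (index_enum I) (Q := xpredT)
  (fun i _ => @bounded_mfun_indic _ _ R _ (mX i)).
under [RHS]eq_bigr do rewrite -(expect_indic P (mX _)).
rewrite -h; apply: eq_Rintegral => -[x y] _.
rewrite (bigD1 (iota x))//= big1 ?addr0 => [|i ix]; last first.
  rewrite indicE (_ : _ \in _ = false)//; apply/negbTE/negP.
  by rewrite inE => -[/= xi _]; rewrite xi eqxx in ix.
rewrite !indicE; congr (_%:R); congr nat_of_bool.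
by apply/idP/idP; rewrite !inE /=; [split|case].
Qed.

Lemma expect_distribution {d d'} {T : measurableType d} {T' : measurableType d'}
  {R : realType} (P : probability T R) (X : {mfun T >-> T'}) (g : T' -> R) (K : R) :
  bounded_mfun g K ->
  (\int[distribution P X]_y g y = \int[P]_w g (X w))%R.
Proof.
move=> [mg gK]; rewrite /Rintegral integral_distribution//.
  exact/measurable_EFinP.
apply: (@bounded_mfun_integrable _ _ _ P (fun w => g (X w)) K); split => //.
exact: measurableT_comp.
Qed.

Lemma expect_same_law {d d' d0} {T : measurableType d} {T' : measurableType d'}
  {S : measurableType d0} {R : realType} (P : probability T R)
  (Q : probability T' R) (X : {mfun T >-> S}) (Y : {mfun T' >-> S})
  (g : S -> R) (K : R) : bounded_mfun g K -> same_law P Q X Y ->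
  (\int[P]_w g (X w) = \int[Q]_w g (Y w))%R.
Proof.
move=> hg hl; rewrite -(expect_distribution P X hg) -(expect_distribution Q Y hg).
rewrite /Rintegral; congr fine; apply: eq_measure_integral => A mA _.
exact: hl.
Qed.

Lemma measurable_at_times {d} {T : measurableType d} {I : Type} {R : realType}
  (P : probability T R) (X : I -> {RV P >-> R}) (n : nat) (t : n.-tuple I) :
  measurable_fun setT (at_times X t : T -> n.-tuple R).
Proof.
apply/measurable_fun_tnthP => i.
rewrite (_ : _ \o _ = X (tnth t i)); first exact: measurable_funP.
by apply/funext => w /=; rewrite tnth_map.
Qed.

HB.instance Definition _ {d} {T : measurableType d} {I : Type} {R : realType}
  (P : probability T R) (X : I -> {RV P >-> R}) (n : nat) (t : n.-tuple I) :=
  isMeasurableFun.Build _ _ _ _ (at_times X t : T -> n.-tuple R)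
    (measurable_at_times X t).

(** * Mixing across a gap from the regularity coefficient *)

Section RegularityGap.
Context {d} {T : measurableType d} {R : realType} (P : probability T R).
Variables (X : nat -> {RV P >-> R}) (beta : nat -> R) (n m : nat).
Hypothesis n0 : (0 < n)%N.
Hypothesis m0 : (0 < m)%N.
Hypothesis hX : abs_regularity_coefs X beta.

Definition times1 : n.-tuple nat := [tuple i.+1 | i < n].

Definition sample_law : probability (n.-tuple R) R :=
  distribution P (at_times X times1 : {mfun T >-> n.-tuple R}).

(** Coordinates outside [D] get the default value 0, which makes the tuple measurable for the times
    of [D]; functions depending only on [D] do not see the default. *)
Let restrict_to (D : pred 'I_n) (x : n.-tuple R) : n.-tuple R :=
  [tuple if D i then tnth x i else 0 | i < n].

Lemma sample_gap_mixing : gap_mixing sample_law m (beta m).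
Proof.
have [d' [T' [Q [Y [[Ystat YX] hbeta]]]]] := hX.
move=> t g K hg gL gR; have [mg gK] := hg.
(* Index [i] stands for time [i + 1] and moves to [i + m - t]: the past [i + m <= t] lands at times
   <= 0, and the future [t <= i] at times >= m. *)
pose tau : int := m%:Z - t%:Z - 1.
pose s : n.-tuple int := map_tuple (fun s => s + tau) (map_tuple Posz times1).
pose U : {mfun T' >-> n.-tuple R} := at_times Y s.
have sE i : tnth s i = i%:Z + m%:Z - t%:Z.
  by rewrite /s 2!tnth_map /times1 tnth_mktuple /tau /=; lia.
have UE w i : tnth (U w) i = Y (tnth s i) w by rewrite /U /at_times /= tnth_map.
have lawU : same_law Q P U (at_times X times1 : {mfun T >-> n.-tuple R}).
  move=> B mB; rewrite -(YX n times1)//.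
    exact: Ystat.
  by move=> i; rewrite tnth_mktuple.
pose L : pred 'I_n := fun i => (i + m <= t)%N.
pose Rt : pred 'I_n := fun i => (t <= i)%N.
pose zL w := restrict_to L (U w); pose zR w := restrict_to Rt (U w).
have zE D w i : tnth (restrict_to D (U w)) i = if D i then Y (tnth s i) w else 0.
  by rewrite tnth_mktuple UE.
have gen (D : pred 'I_n) (S : set int) : (forall i, D i -> S (tnth s i)) ->
    forall B : set (n.-tuple R), measurable B ->
    sigma_generated Y S ((fun w => restrict_to D (U w)) @^-1` B).
  move=> DS B mB.
  pose G := \bigcup_(s0 in S) preimage_set_system setT (Y s0) (measurable : set (set R)).
  pose T'' : measurableType _ := g_sigma_algebraType G.
  have : measurable_fun [set: T''] (fun w : T'' => restrict_to D (U w)).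
    apply/measurable_fun_tnthP => i; have [Di|Di] := boolP (D i); last first.
      rewrite (_ : _ \o _ = cst 0)//.
      by apply/funext => w; rewrite /= zE (negPf Di).
    rewrite (_ : _ \o _ = (Y (tnth s i) : T'' -> R)); last first.
      by apply/funext => w; rewrite /= zE Di.
    move=> _ C mC; apply: sub_sigma_algebra; exists (tnth s i); first exact: DS.
    by exists C.
  by move=> /(_ measurableT B mB); rewrite setTI.
have gen_m (S : set int) : \bigcup_(s0 in S) preimage_set_system setT (Y s0)
    (measurable : set (set R)) `<=` (measurable : set (set T')).
  by move=> _ [s0 _ [C mC <-]]; exact: measurable_funP.
have gen_sub (S : set int) A : sigma_generated Y S A -> measurable A.
  by apply: smallest_sub; [exact: sigma_algebra_measurable|exact: gen_m].
have hL : forall i, L i -> [set s0 : int | s0 <= 0] (tnth s i).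
  by move=> i; rewrite /L /= sE; lia.
have hR : forall i, Rt i -> [set s0 : int | m%:Z <= s0] (tnth s i).
  by move=> i; rewrite /Rt /= sE; lia.
have mzL : measurable_fun setT zL.
  by move=> _ B mB; rewrite setTI; apply: gen_sub; exact: gen hL B mB.
have mzR : measurable_fun setT zR.
  by move=> _ B mB; rewrite setTI; apply: gen_sub; exact: gen hR B mB.
pose ZL : {mfun T' >-> n.-tuple R} := HB.pack zL (isMeasurableFun.Build _ _ _ _ zL mzL).
pose ZR : {mfun T' >-> n.-tuple R} := HB.pack zR (isMeasurableFun.Build _ _ _ _ zR mzR).
have mW : measurable_fun setT (fun w => (zL w, zR w)) by exact: measurable_fun_pair.
pose W : {mfun T' >-> (n.-tuple R * n.-tuple R)%type} :=
  HB.pack (fun w => (zL w, zR w)) (isMeasurableFun.Build _ _ _ _ (fun w => (zL w, zR w)) mW).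
pose rho : probability _ R := distribution Q W.
pose piL : probability _ R := distribution Q ZL.
pose piR : probability _ R := distribution Q ZR.
pose pi2 : probability (n.-tuple R * n.-tuple R)%type R := (piL \x piR)%E.
have [h [hess hb]] := hbeta m m0.
(* The distinct sections of [E] cut the past into cells, and [D i] is the future event attached to
   the cell [i]. *)
have step E : step_set E -> `|fine (rho E) - fine (pi2 E)| <= beta m.
  move=> [I [iota [D [mi mD ->]]]]; rewrite (probability_step_set rho mi mD) (probability_step_set pi2 mi mD) -sumrB.
  have := @deviations_partition_le _ _ _ Q _ (gen_m [set s0 : int | s0 <= 0])
    (sigma_generated Y [set s0 : int | m%:Z <= s0]) h (beta m) I (fun w => iota (zL w))
    (fun i => zR @^-1` D i) hess hb.
  have -> : \sum_i (fine (Q ((fun w => iota (zL w)) @^-1` [set i] `&` zR @^-1` D i)) -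
    fine (Q ((fun w => iota (zL w)) @^-1` [set i])) * fine (Q (zR @^-1` D i))) =
    \sum_i (fine (rho (iota @^-1` [set i] `*` D i)) - fine (pi2 (iota @^-1` [set i] `*` D i))).
    apply: eq_bigr => i _; congr (_ - _).
    have -> : pi2 (iota @^-1` [set i] `*` D i) = (piL (iota @^-1` [set i]) * piR (D i))%E.
      exact: product_measure1E.
    by rewrite fineM// fin_num_measure.
  apply.
  - by move=> i; exact: gen hL _ (mi i).
  - by move=> i; exact: gen hR _ (mD i).
  - by move=> i; rewrite -[X in measurable X]setTI; exact: (mzR measurableT _ (mD i)).
have tv := step_set_tv step.
have := tv_expect_le tv hg.
rewrite (expect_distribution Q W hg) -(expect_fubini1 piL piR hg).
have e1 : (\int[Q]_w g (W w) = \int[sample_law]_x g (x, x))%R.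
  have hd : bounded_mfun (fun x => g (x, x)) K.
    by split => //; apply: (measurableT_comp mg); exact: measurable_fun_pair.
  rewrite /sample_law (expect_distribution P _ hd) -(expect_same_law hd lawU).
  apply: eq_Rintegral => w _; transitivity (g (U w, zR w)).
    by apply: gL => i Li; rewrite zE UE ifT.
  by apply: gR => i Ri; rewrite zE UE ifT.
have toU (D : pred 'I_n) (f : n.-tuple R -> R) (mD : measurable_fun setT (fun w => restrict_to D (U w))) :
    bounded_mfun f K -> depends_only D f ->
    (\int[Q]_w f (restrict_to D (U w)) = \int[sample_law]_x f x)%R.
  move=> hf fD; rewrite /sample_law (expect_distribution P _ hf) -(expect_same_law hf lawU).
  by apply: eq_Rintegral => w _; apply: fD => i Di; rewrite zE UE ifT.
have e2 : (\int[piL]_x \int[piR]_y g (x, y) = \int[sample_law]_x \int[sample_law]_y g (x, y))%R.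
  transitivity (\int[piL]_x \int[sample_law]_y g (x, y))%R.
    apply: eq_Rintegral => x _; have hx := bounded_mfun_section1 hg x.
    rewrite (expect_distribution Q ZR hx); exact: (toU Rt _ mzR hx (gR x)).
  have hx := bounded_mfun_expect2 sample_law sample_law hg.
  rewrite (expect_distribution Q ZL hx); apply: (toU L _ mzL hx).
  by move=> x x' xx'; apply: eq_Rintegral => y _; exact: gL.
by rewrite e1 e2.
Qed.

End RegularityGap.

(** * Moments of the normal law *)

Section NormalMoments.
Context {R : realType}.
Local Notation N := (normal_prob (0 : R) 1).
Local Notation lam := (@lebesgue_measure R).

Lemma ge0_integral_normal (m : R) (f : R -> \bar R) :
  measurable_fun setT f -> (forall x, 0 <= f x)%E ->
  (\int[normal_prob m 1]_x f x = \int[lam]_x (f x * (normal_pdf m 1 x)%:E))%E.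
Proof.
move=> mf f0; have dom := normal_prob_dominates m (1 : R).
rewrite -(Radon_Nikodym_SigmaFinite.change_of_variables dom)//.
apply: ae_eq_integral => //.
- apply: emeasurable_funM => //; apply: (measurable_int lam).
  exact: Radon_Nikodym_SigmaFinite.f_integrable.
- by apply: emeasurable_funM => //; apply/measurable_EFinP; exact: measurable_normal_pdf.
- apply: ae_eqe_mul2l; apply: integral_ae_eq => //.
  + exact: Radon_Nikodym_SigmaFinite.f_integrable.
  + by apply/measurable_EFinP; exact: measurable_normal_pdf.
  + by move=> E _ mE; rewrite -Radon_Nikodym_SigmaFinite.f_integral.
Qed.

(** Completing the square: [expR (t * x)] times the centred density is [expR (t ^+ 2 / 2)] times the
    density with mean [t]. *)
Lemma normal_mgf (t : R) :
  (\int[N]_x (expR (t * x))%:E = (expR (t ^+ 2 / 2))%:E)%E.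
Proof.
rewrite ge0_integral_normal//; last by apply/measurable_EFinP; apply: measurableT_comp => //; exact: mulrl_measurable.
transitivity (\int[lam]_x ((expR (t ^+ 2 / 2))%:E * (normal_pdf t 1 x)%:E))%E.
  apply: eq_integral => x _; rewrite -!EFinM !normal_pdfE ?oner_neq0//; congr (_%:E).
  rewrite mulrCA [RHS]mulrCA; congr (_ * _).
  by rewrite /normal_fun -!expRD; congr expR; field.
rewrite ge0_integralZl//.
- by rewrite integral_normal_pdf mule1.
- by apply/measurable_EFinP; exact: measurable_normal_pdf.
- by move=> x _; rewrite lee_fin normal_pdf_ge0.
Qed.

End NormalMoments.

Section ExpBounds.
Context {R : realType}.

Lemma exp_partial_le (y : R) (n : nat) : 0 <= y ->
  \sum_(i < n) y ^+ i / i`!%:R <= expR y.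
Proof.
move=> y0; rewrite -(big_mkord xpredT (fun i => y ^+ i / i`!%:R)).
have cv := is_cvg_series_exp_coeff y.
apply: (@nondecreasing_cvgn_le _ (series (exp_coeff y)) _ cv n).
by apply: nondecreasing_series => i _ _; rewrite divr_ge0// exprn_ge0.
Qed.

Lemma pow_fact_le_exp (y : R) (k : nat) : 0 <= y -> y ^+ k / k`!%:R <= expR y.
Proof.
move=> y0; apply: le_trans (exp_partial_le k.+1 y0); rewrite big_ord_recr/= lerDr.
by apply: sumr_ge0 => i _; rewrite divr_ge0// exprn_ge0.
Qed.

(** From order [K] on, |y|^i <= 2^-K (2 |y|)^i. The remainder thus decays geometrically in [K]
    against a fixed majorant that the normal law integrates. *)
Lemma exp_taylor_le (y : R) (K : nat) :
  `|expR y - \sum_(i < K) y ^+ i / i`!%:R| <= (2 ^+ K)^-1 * expR (2 * `|y|).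
Proof.
have cv := is_cvg_series_exp_coeff y.
have h : (fun n => `|series (exp_coeff y) n - \sum_(i < K) y ^+ i / i`!%:R|) @ \oo -->
    `|expR y - \sum_(i < K) y ^+ i / i`!%:R|.
  by apply: cvg_norm; apply: cvgB; [exact: cv|exact: cvg_cst].
rewrite -(cvg_lim (@Rhausdorff R) h); apply: limr_le; first by apply/cvg_ex; eexists; exact: h.
near=> n; have Kn : (K <= n)%N by near: n; exact: nbhs_infty_ge.
rewrite /series /= (@big_cat_nat _ _ _ K)//= big_mkord addrAC subrr add0r.
apply: (le_trans (ler_norm_sum _ _ _)).
apply: (@le_trans _ _ (\sum_(K <= i < n) (2 ^+ K)^-1 * ((2 * `|y|) ^+ i / i`!%:R))).
  rewrite big_nat [leRHS]big_nat; apply: ler_sum => i /andP[Ki _].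
  rewrite /exp_coeff /= normrM normrX [`|_^-1|]ger0_norm ?invr_ge0// exprMn.
  rewrite !mulrA ler_wpM2r ?invr_ge0// -[leLHS]mul1r ler_wpM2r ?exprn_ge0//.
  by rewrite ler_pdivlMl ?exprn_gt0// mulr1 ler_weXn2l// ler1n.
rewrite -mulr_sumr ler_wpM2l ?invr_ge0 ?exprn_ge0//.
have y0 : 0 <= 2 * `|y| by rewrite mulr_ge0.
apply: le_trans (exp_partial_le n y0).
rewrite -(big_mkord xpredT (fun i => (2 * `|y|) ^+ i / i`!%:R)).
rewrite [leRHS](@big_cat_nat _ _ _ K)//= lerDr.
by apply: sumr_ge0 => i _; rewrite divr_ge0// exprn_ge0.
Unshelve. all: end_near. Qed.

Lemma entire_coefs_inj (c : nat -> R) : entire_coefs c ->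
  (forall t, limn (pseries c t) = 0) -> forall k, c k = 0.
Proof.
move=> hc h k; elim: k c hc h => [|k IH] c hc h.
  by rewrite -(limn_pseries0 c) h.
have : pseries_diffs c k = 0.
  apply: IH; first exact: entire_coefs_diffs.
  move=> t; have hd := is_derive_entire t hc.
  have e : (fun x => limn (pseries c x)) = cst 0 by apply/funext => x; exact: h.
  rewrite e in hd; have h0 := is_derive_cst (0 : R) t (1 : R).
  by rewrite -(@derive_val _ _ _ _ _ _ _ hd) (@derive_val _ _ _ _ _ _ _ h0).
rewrite /pseries_diffs => /eqP; rewrite mulf_eq0 pnatr_eq0/= => /eqP.
exact.
Qed.

End ExpBounds.

Section NormalMoments.
Context {R : realType}.
Local Notation N := (normal_prob (0 : R) 1).
Implicit Type f : R -> R.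

Definition exp_bounded f (C t : R) : Prop :=
  measurable_fun setT f /\ forall x, `|f x| <= C * expR (t * `|x|).

Lemma normal_exp_abs (t : R) : 0 <= t ->
  (\int[N]_x (expR (t * `|x|))%:E <= (2 * expR (t ^+ 2 / 2))%:E)%E.
Proof.
move=> t0.
have me (s : R) : measurable_fun [set: R] (fun x => (expR (s * x))%:E).
  by apply/measurable_EFinP; apply: measurableT_comp => //; exact: mulrl_measurable.
apply: (@le_trans _ _ (\int[N]_x ((expR (t * x))%:E + (expR (- t * x))%:E))%E).
  apply: ge0_le_integral => //.
  - apply/measurable_EFinP; apply: measurableT_comp => //.
    by apply: measurable_funM => //; exact: normr_measurable.
  - by apply: emeasurable_funD; [exact: (me t)|exact: (me (- t))].
  - move=> x _; rewrite -EFinD lee_fin; case: (leP 0 x) => x0.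
      by rewrite ger0_norm// lerDl expR_ge0.
    by rewrite ltr0_norm// mulrN mulNr lerDr expR_ge0.
rewrite ge0_integralD//; [|exact: (me t)|exact: (me (- t))].
by rewrite !normal_mgf -EFinD lee_fin sqrrN -mulr2n mulr_natl.
Qed.

Lemma exp_bounded_integrable f (C t : R) : 0 <= C -> 0 <= t -> exp_bounded f C t ->
  N.-integrable setT (EFin \o f) /\
  `|\int[N]_x f x|%R <= C * (2 * expR (t ^+ 2 / 2)).
Proof.
move=> C0 t0 [mf hf].
have mexp : measurable_fun [set: R] (fun x => (expR (t * `|x|))%:E).
  apply/measurable_EFinP; apply: measurableT_comp => //.
  by apply: measurable_funM => //; exact: normr_measurable.
have hle : (\int[N]_x `|(f x)%:E| <= (C * (2 * expR (t ^+ 2 / 2)))%:E)%E.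
  apply: (@le_trans _ _ (\int[N]_x (C%:E * (expR (t * `|x|))%:E))%E).
    apply: ge0_le_integral => //.
    - by apply: measurableT_comp => //; exact/measurable_EFinP.
    - by apply: emeasurable_funM.
    - by move=> x _; rewrite abse_EFin -EFinM lee_fin.
  rewrite ge0_integralZl//.
  by rewrite EFinM; apply: lee_wpmul2l; [rewrite lee_fin|exact: normal_exp_abs].
have fint : N.-integrable setT (EFin \o f).
  apply/integrableP; split; first exact/measurable_EFinP.
  by apply: (le_lt_trans hle); rewrite ltry.
split => //; rewrite -lee_fin EFin_normr_Rintegral//.
apply: le_trans hle; apply: le_abse_integral => //; exact/measurable_EFinP.
Qed.

Definition normal_moment (k : nat) : R := (\int[N]_x x ^+ k)%R.

(** The inequality y^k / k! <= exp y at y = |x| / e. Keeping [e] free is what makes the normal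
    moments, divided by factorials, the coefficients of an entire series. *)
Lemma exp_bounded_pow (k : nat) (e : R) : 0 < e ->
  exp_bounded (fun x => x ^+ k) (k`!%:R * e ^+ k) e^-1.
Proof.
move=> e0; split; first exact: exprn_measurable.
move=> x; rewrite normrX.
have y0 : 0 <= e^-1 * `|x| by rewrite mulr_ge0// invr_ge0 ltW.
have := pow_fact_le_exp k y0; rewrite ler_pdivrMr ?ltr0n ?fact_gt0// => h.
have -> : `|x| ^+ k = e ^+ k * (e^-1 * `|x|) ^+ k.
  by rewrite -exprMn mulrA divff ?mul1r// gt_eqF.
by rewrite [k`!%:R * _]mulrC -mulrA ler_wpM2l ?exprn_ge0 ?(ltW e0)// [leRHS]mulrC.
Qed.

Lemma normal_moment_integrable (k : nat) : N.-integrable setT (fun x => (x ^+ k)%:E).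
Proof.
by have [] := @exp_bounded_integrable (fun x => x ^+ k) _ _ _ _ (exp_bounded_pow k (@ltr01 R)).
Qed.

Lemma entire_normal_moment : entire_coefs (fun k => normal_moment k / k`!%:R).
Proof.
move=> e e0; exists (2 * expR (e^-1 ^+ 2 / 2)) => k.
have [||_] := @exp_bounded_integrable (fun x => x ^+ k) _ _ _ _ (exp_bounded_pow k e0).
- by rewrite mulr_ge0// exprn_ge0// ltW.
- by rewrite invr_ge0 ltW.
rewrite -/(normal_moment k) => h; rewrite normrM [`|_^-1|]ger0_norm ?invr_ge0//.
by rewrite ler_pdivrMr ?ltr0n ?fact_gt0//; apply: (le_trans h); rewrite mulrC mulrA [leRHS]mulrAC.
Qed.

Lemma normal_moment_series (t : R) :
  limn (pseries (fun k => normal_moment k / k`!%:R) t) = expR (t ^+ 2 / 2).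
Proof.
apply: cvg_lim => //.
have t0 : 0 <= 2 * `|t| by rewrite mulr_ge0.
pose M := 2 * expR ((2 * `|t|) ^+ 2 / 2).
have M0 : 0 < M by rewrite mulr_gt0// expR_gt0.
have hE : N.-integrable setT (fun x => (expR (t * x))%:E) /\
    (\int[N]_x expR (t * x))%R = expR (t ^+ 2 / 2).
  have me : measurable_fun setT (fun x : R => expR (t * x)).
    by apply: measurableT_comp => //; exact: mulrl_measurable.
  split; last by rewrite /Rintegral normal_mgf.
  apply/integrableP; split; first exact/measurable_EFinP.
  under eq_integral do rewrite abse_EFin ger0_norm ?expR_ge0//.
  by rewrite normal_mgf ltry.
have key n : `|expR (t ^+ 2 / 2) - pseries (fun k => normal_moment k / k`!%:R) t n| <=
    (2^-1) ^+ n * M.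
  have hint (i : nat) : N.-integrable setT (EFin \o (fun x => (t * x) ^+ i / i`!%:R)).
    have := integrableZl measurableT (t ^+ i / i`!%:R) (normal_moment_integrable i).
    congr (N.-integrable setT _); apply/funext => x /=.
    by rewrite -EFinM exprMn mulrAC.
  have hintE (i : nat) : (\int[N]_x ((t * x) ^+ i / i`!%:R))%R = normal_moment i / i`!%:R * t ^+ i.
    transitivity (\int[N]_x ((t ^+ i / i`!%:R) * x ^+ i))%R.
      by apply: eq_Rintegral => x _; rewrite exprMn mulrAC.
    by rewrite RintegralZl//; [rewrite mulrC mulrA mulrAC|exact: normal_moment_integrable].
  have hs (k : nat) : N.-integrable setT (EFin \o (fun x => \sum_(i < k) (t * x) ^+ i / i`!%:R)) /\
     (\int[N]_x (\sum_(i < k) (t * x) ^+ i / i`!%:R))%R = \sum_(i < k) (normal_moment i / i`!%:R * t ^+ i).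
    elim: k => [|k [IH1 IH2]].
      split; last by rewrite big_ord0; under eq_Rintegral do rewrite big_ord0; rewrite Rintegral_cst// mul0r.
      have -> : (fun x : R => \sum_(i < 0) (t * x) ^+ i / i`!%:R) = cst 0.
        by apply/funext => x; rewrite big_ord0.
      exact: integrable0.
    have -> : (fun x => \sum_(i < k.+1) (t * x) ^+ i / i`!%:R) =
       (fun x => \sum_(i < k) (t * x) ^+ i / i`!%:R + (t * x) ^+ k / k`!%:R).
      by apply/funext => x; rewrite big_ord_recr.
    split.
      have := integrableD measurableT IH1 (hint k).
      by congr (N.-integrable setT _); apply/funext => x.
    by rewrite RintegralD// big_ord_recr/= IH2 hintE.
  have [i1 i2] := hs n; have [j1 j2] := hE.
  rewrite /pseries /series /= big_mkord -i2 -j2 -RintegralB//.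
  have [|||_] := @exp_bounded_integrable (fun x => expR (t * x) - \sum_(i < n) (t * x) ^+ i / i`!%:R) ((2^-1) ^+ n) (2 * `|t|) => //.
  split; last first.
    by move=> x; apply: (le_trans (exp_taylor_le _ _)); rewrite normrM mulrA exprVn.
  apply/measurable_EFinP; apply: (measurable_int N); have := integrableB measurableT j1 i1.
  by congr (N.-integrable setT _); apply/funext => x.
apply/cvgrPdist_le => e e0.
have : (fun n => (2^-1 : R) ^+ n * M) @ \oo --> (0 : R).
  by rewrite -(mul0r M); apply: cvgMr_tmp; apply: cvg_expr; rewrite ger0_norm ?invr_ge0// invf_lt1// ltr1n.
move=> /cvgrPdist_le /(_ e e0); apply: filterS => n; rewrite sub0r normrN ger0_norm; last first.
  by rewrite mulr_ge0// ?(ltW M0)// exprn_ge0// invr_ge0.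
by apply: le_trans; exact: key.
Qed.

Lemma normal_moment0 : normal_moment 0 = 1.
Proof.
rewrite /normal_moment -[RHS](expect_cst N 1).
by apply: eq_Rintegral => x _; rewrite expr0.
Qed.

(** Comparison of coefficients in M'(t) = t M(t) for M(t) = exp (t^2 / 2), instead of an integration
    by parts. *)
Lemma normal_moment_rec (k : nat) :
  normal_moment k.+1 = if k is j.+1 then k%:R * normal_moment j else 0.
Proof.
pose a k := normal_moment k / k`!%:R.
have ha : entire_coefs a := entire_normal_moment.
have hc : entire_coefs (fun k => pseries_diffs a k + (-1) * (if (1 <= k)%N then a (k - 1)%N else 0)).
  apply: entire_coefsD; first exact: entire_coefs_diffs.
  by apply: entire_coefsZ; exact: entire_coefs_shift.
have h0 t : limn (pseries (fun k => pseries_diffs a k + (-1) * (if (1 <= k)%N then a (k - 1)%N else 0)) t) = 0.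
  rewrite limn_pseriesD; [|exact: entire_coefs_diffs|by apply: entire_coefsZ; exact: entire_coefs_shift].
  rewrite limn_pseriesZ; last exact: entire_coefs_shift.
  rewrite limn_pseries_shift// normal_moment_series.
  have hd := is_derive_entire t ha.
  have e : (fun x => limn (pseries a x)) = (fun x => expR (x ^+ 2 / 2)).
    by apply/funext => x; exact: normal_moment_series.
  rewrite e in hd.
  have hd' : is_derive t (1 : R) (fun x => expR (x ^+ 2 / 2)) (t * expR (t ^+ 2 / 2)).
    have := is_derive_monomial (1 : R) t 1; rewrite (_ : (fun x => 1 * x ^+ 2 / 2%:R) = (fun x : R => x ^+ 2 / 2)); last first.
      by apply/funext => x; rewrite mul1r.
    move=> hq; have := @is_derive1_comp _ expR (fun x : R => x ^+ 2 / 2) t _ _ (is_derive_expR _) hq.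
    by rewrite mul1r expr1 mulrC.
  by rewrite -(@derive_val _ _ _ _ _ _ _ hd) (@derive_val _ _ _ _ _ _ _ hd') expr1 mulN1r subrr.
have := entire_coefs_inj hc h0 k; rewrite /pseries_diffs /a.
have f0 := @natr_fact_neq0 R.
case: k => [|j] /=.
  by rewrite mulr0 addr0 mul1r (_ : 1`! = 1%N)// divr1.
rewrite subn1/= mulN1r => /eqP; rewrite subr_eq0 => /eqP h.
have j0 : j.+1%:R != 0 :> R by rewrite pnatr_eq0.
have j1 : j.+2%:R != 0 :> R by rewrite pnatr_eq0.
have := f0 j; move: h; rewrite !factS !natrM => h fj.
move: (j.+2%:R) (j.+1%:R) (j`!%:R) j0 j1 fj h => u v w v0 u0 w0 h.
transitivity (u * (normal_moment j.+2 / (u * (v * w))) * (v * w)).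
  by field; rewrite u0 v0 w0.
by rewrite h; field.
Qed.

End NormalMoments.

(** * From moments to distribution functions *)

Section CosTaylor.
Context {R : realType}.

Lemma le_is_derive (f g df dg : R -> R) (y : R) : 0 <= y -> f 0 = g 0 ->
  (forall x, is_derive x (1 : R) f (df x)) -> (forall x, is_derive x (1 : R) g (dg x)) ->
  (forall x, 0 <= x -> df x <= dg x) -> f y <= g y.
Proof.
move=> y0 fg hf hg hdf.
have hd x : is_derive x (1 : R) (g - f) (dg x - df x) by apply: is_deriveB.
have hc : {within `[0, y], continuous (g - f)}.
  apply: derivable_within_continuous => x _; have [] := hd x; exact.
have [c] := @MVT_segment _ (g - f) (fun x => dg x - df x) 0 y y0 (fun x _ => hd x) hc.
rewrite in_itv/= => /andP[c0 _]; rewrite !fctE fg subrr !subr0 => h.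
by rewrite -subr_ge0 h mulr_ge0// subr_ge0 hdf.
Qed.

(** Taylor polynomial of cos (s + y) in y: each derivative advances the phase by pi / 2. The free
    phase [s] lets an induction on the order pass through differentiation. *)
Definition cos_taylor (j : nat) (s y : R) : R :=
  \sum_(i < j) cos (s + i%:R * (pi / 2)) * (y ^+ i / i`!%:R).

Lemma is_derive_cos_taylor (j : nat) (s y : R) :
  is_derive y (1 : R) (cos_taylor j.+1 s) (cos_taylor j (s + pi / 2) y).
Proof.
elim: j => [|j IH].
  have -> : cos_taylor 1 s = cst (cos s).
    by apply/funext => x; rewrite /cos_taylor big_ord1 mul0r addr0 expr0 divr1 mulr1.
  by rewrite /cos_taylor big_ord0; exact: is_derive_cst.
have -> : cos_taylor j.+2 s = cos_taylor j.+1 s +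
    (fun x => cos (s + j.+1%:R * (pi / 2)) / j`!%:R * x ^+ j.+1 / j.+1%:R).
  apply/funext => x; rewrite fctE /cos_taylor [LHS]big_ord_recr/=; congr (_ + _).
  by rewrite factS natrM invfM !mulrA; ring.
rewrite [cos_taylor j.+1 _ _]/cos_taylor big_ord_recr/= -/(cos_taylor j (s + pi / 2) y).
have e : s + pi / 2 + j%:R * (pi / 2) = s + j.+1%:R * (pi / 2).
  by rewrite -addrA -[j.+1%:R]nat1r [(1 + _) * _]mulrDl mul1r.
rewrite e; move: (cos (s + _)) => c; rewrite mulrA mulrAC.
by apply: is_deriveD; exact: is_derive_monomial.
Qed.

Lemma cos_taylor_ge0_le (j : nat) (s y : R) : 0 <= y ->
  `|cos (s + y) - cos_taylor j s y| <= y ^+ j / j`!%:R.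
Proof.
elim: j s y => [|j IH] s y y0.
  by rewrite /cos_taylor big_ord0 subr0 expr0 divr1 ler_norml cos_geN1 cos_le1.
pose dr x := cos (s + pi / 2 + x) - cos_taylor j (s + pi / 2) x.
have hr x : is_derive x (1 : R) ((fun x => cos (s + x)) - cos_taylor j.+1 s) (dr x).
  apply: is_deriveB; last exact: is_derive_cos_taylor.
  have hs : is_derive x (1 : R) (fun x => s + x) 1.
    by rewrite -[X in is_derive _ _ _ X]add0r; apply: is_deriveD.
  have := @is_derive1_comp _ cos (fun x => s + x) x _ _ (is_derive_cos (s + x)) hs.
  by rewrite mulr1 addrAC cosDpihalf.
have hp x : is_derive x (1 : R) (fun x => x ^+ j.+1 / j.+1`!%:R) (x ^+ j / j`!%:R).
  rewrite (_ : (fun _ => _) = (fun x => j`!%:R^-1 * x ^+ j.+1 / j.+1%:R)); last first.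
    by apply/funext => z; rewrite factS natrM invfM; ring.
  by apply: is_derive_eq; [exact: is_derive_monomial|rewrite mulrC].
have r0 : ((fun x => cos (s + x)) - cos_taylor j.+1 s) 0 = 0.
  rewrite !fctE /cos_taylor big_ord_recl/= big1 => [|i _]; last by rewrite /bump/= add1n expr0n/= mul0r mulr0.
  by rewrite mul0r !addr0 expr0 divr1 mulr1 subrr.
have p0 : (0 : R) ^+ j.+1 / j.+1`!%:R = 0 by rewrite expr0n/= mul0r.
rewrite ler_norml; apply/andP; split.
  rewrite lerNl -[leRHS]/((fun x => x ^+ j.+1 / j.+1`!%:R) y).
  apply: (@le_is_derive (- ((fun x => cos (s + x)) - cos_taylor j.+1 s)) _ (fun x => - dr x)) hp _ => //.
    by rewrite fctE r0 p0 oppr0.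
  by move=> x x0; have := IH (s + pi / 2) x x0; rewrite ler_norml => /andP[+ _]; rewrite lerNl.
apply: (@le_is_derive ((fun x => cos (s + x)) - cos_taylor j.+1 s) (fun x => x ^+ j.+1 / j.+1`!%:R) dr) hr hp _ => //.
  by rewrite r0 p0.
by move=> x x0; have := IH (s + pi / 2) x x0; rewrite ler_norml => /andP[].
Qed.

Lemma cosD_natr_pi (k : nat) (x : R) : cos (x + k%:R * pi) = (-1) ^+ k * cos x.
Proof.
elim: k => [|k IH]; first by rewrite mul0r addr0 expr0 mul1r.
by rewrite -[k.+1%:R]natr1 mulrDl mul1r addrA cosDpi IH exprS mulN1r mulNr.
Qed.

Lemma cos_taylorN (j : nat) (s y : R) : cos_taylor j (- s) (- y) = cos_taylor j s y.
Proof.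
apply: eq_bigr => i _; rewrite exprNn -!mulrA mulrA mulrC [RHS]mulrC; congr (_ * _).
rewrite -[in LHS](cosN (- s + _)) mulrC -cosD_natr_pi; congr cos.
by rewrite opprD opprK -addrA; congr (_ + _); field.
Qed.

Lemma cos_taylor_le (j : nat) (s y : R) :
  `|cos (s + y) - cos_taylor j s y| <= `|y| ^+ j / j`!%:R.
Proof.
have [y0|y0] := leP 0 y; first by rewrite [`|y|]ger0_norm// cos_taylor_ge0_le.
rewrite [`|y|]ltr0_norm// -cosN opprD -(cos_taylorN j s y).
by apply: cos_taylor_ge0_le; rewrite oppr_ge0 ltW.
Qed.

End CosTaylor.

Section MomentTest.
Context {R : realType}.
Implicit Types Q : probability (measurableTypeR R) R.

Definition integrable_moments Q : Prop :=
  forall k, Q.-integrable setT (fun x => (x ^+ k)%:E).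

Lemma integrable_lincomb Q (f : nat -> R -> R) (c : nat -> R) (k : nat) :
  (forall i, Q.-integrable setT (EFin \o f i)) ->
  Q.-integrable setT (EFin \o (fun x => \sum_(i < k) c i * f i x)) /\
  (\int[Q]_x (\sum_(i < k) c i * f i x))%R = \sum_(i < k) c i * (\int[Q]_x f i x)%R.
Proof.
move=> hf; elim: k => [|k [IH1 IH2]].
  rewrite big_ord0 -[RHS](expect_cst Q 0).
  have -> : (fun x : R => \sum_(i < 0) c i * f i x) = cst 0.
    by apply/funext => x; rewrite big_ord0.
  by split => //; apply: (@bounded_mfun_integrable _ _ _ Q (cst 0) _ (bounded_mfun_cst 0)).
have -> : (fun x => \sum_(i < k.+1) c i * f i x) =
    (fun x => \sum_(i < k) c i * f i x + c k * f k x).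
  by apply/funext => x; rewrite big_ord_recr.
have hk : Q.-integrable setT (EFin \o (fun x => c k * f k x)).
  by have := integrableZl measurableT (c k) (hf k); congr (Q.-integrable setT _).
split.
  by have := integrableD measurableT IH1 hk; congr (Q.-integrable setT _).
by rewrite RintegralD// big_ord_recr/= IH2 RintegralZl.
Qed.

Lemma bounded_mfun_cos (s t : R) :
  bounded_mfun (fun x : measurableTypeR R => cos (s + t * x)) 1.
Proof.
split; last by move=> x; rewrite ler_norml cos_geN1 cos_le1.
apply: measurableT_comp; first by apply: continuous_measurable_fun; exact: continuous_cos.
by apply: measurable_funD => //; exact: mulrl_measurable.
Qed.

(** An even order makes |t x|^(2K) a monomial, so the remainder is bounded by a moment rather than
    by an absolute moment. *)
Lemma expect_cos_taylor_le Q (s t : R) (K : nat) : integrable_moments Q ->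
  `|(\int[Q]_x cos (s + t * x))%R -
    \sum_(i < K.*2) cos (s + i%:R * (pi / 2)) * t ^+ i / i`!%:R * (\int[Q]_x x ^+ i)%R| <=
  t ^+ K.*2 / K.*2`!%:R * (\int[Q]_x x ^+ K.*2)%R.
Proof.
move=> hQ.
have [hs <-] := @integrable_lincomb Q (fun i x => x ^+ i)
  (fun i => cos (s + i%:R * (pi / 2)) * t ^+ i / i`!%:R) K.*2 hQ.
have hc : Q.-integrable setT (EFin \o (fun x => cos (s + t * x))).
  exact: (bounded_mfun_integrable Q (bounded_mfun_cos s t)).
rewrite -RintegralB// -RintegralZl//; last exact: hQ.
have hd : Q.-integrable setT (EFin \o (fun x => cos (s + t * x) -
    \sum_(i < K.*2) cos (s + i%:R * (pi / 2)) * t ^+ i / i`!%:R * x ^+ i)).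
  by have := integrableB measurableT hc hs; congr (Q.-integrable setT _).
apply: (le_trans (le_normr_Rintegral _ hd)) => //.
apply: le_Rintegral => //.
- by have := integrable_norm hd; congr (Q.-integrable setT _).
- have := integrableZl measurableT (t ^+ K.*2 / K.*2`!%:R) (hQ K.*2).
  by congr (Q.-integrable setT _); apply/funext => x /=; rewrite -EFinM.
move=> x _; have := cos_taylor_le K.*2 s (t * x).
rewrite -normrX [X in _ <= X / _ -> _]ger0_norm ?exprn_even_ge0 ?odd_double// exprMn mulrAC.
apply: le_trans; rewrite le_eqVlt; apply/orP; left; apply/eqP; congr `|_ - _|.
apply: eq_bigr => i _; rewrite exprMn; move: (cos _) => c; ring.
Qed.

End MomentTest.

Section TrigPoly.
Context {R : realType}.

Inductive trig_poly : (R -> R) -> Prop :=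
| trig_poly_cos s t : trig_poly (fun x => cos (s + t * x))
| trig_polyD f g : trig_poly f -> trig_poly g -> trig_poly (fun x => f x + g x)
| trig_polyZ c f : trig_poly f -> trig_poly (fun x => c * f x).

Lemma trig_poly_bounded (f : R -> R) : trig_poly f ->
  exists K, bounded_mfun (f : measurableTypeR R -> R) K.
Proof.
elim=> [s t|{}f g _ [K hK] _ [L hL]|c {}f _ [K hK]].
- by exists 1; exact: bounded_mfun_cos.
- by exists (K + L); exact: bounded_mfunD.
- by exists (`|c| * K); exact: (bounded_mfunM (bounded_mfun_cst c)).
Qed.

Lemma trig_poly_cst (c : R) : trig_poly (fun=> c).
Proof.
have -> : (fun _ : R => c) = (fun x => c * cos (0 + 0 * x)).
  by apply/funext => x; rewrite mul0r addr0 cos0 mulr1.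
exact/trig_polyZ/trig_poly_cos.
Qed.

Lemma trig_polyM (f g : R -> R) : trig_poly f -> trig_poly g ->
  trig_poly (fun x => f x * g x).
Proof.
move=> hf hg; elim: hf => [s t|{}f f' _ h1 _ h2|c {}f _ h].
- elim: hg => [s' t'|{}g g' _ h1 _ h2|c {}g _ h].
  + have -> : (fun x => cos (s + t * x) * cos (s' + t' * x)) =
        (fun x => 2^-1 * (cos ((s + s') + (t + t') * x) + cos ((s - s') + (t - t') * x))).
      apply/funext => x.
      have -> : s + s' + (t + t') * x = (s + t * x) + (s' + t' * x) by ring.
      have -> : s - s' + (t - t') * x = (s + t * x) - (s' + t' * x) by ring.
      by move: (s + _) (s' + _) => u v; rewrite cosB cosD; field.
    apply: trig_polyZ; apply: trig_polyD; exact: trig_poly_cos.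
  + have := trig_polyD h1 h2; congr trig_poly; apply/funext => x; by rewrite mulrDr.
  + have := trig_polyZ c h; congr trig_poly; apply/funext => x; by rewrite mulrCA.
- have := trig_polyD h1 h2; congr trig_poly; apply/funext => x; by rewrite mulrDl.
- have := trig_polyZ c h; congr trig_poly; apply/funext => x; by rewrite mulrA.
Qed.

Lemma trig_polyX (f : R -> R) (n : nat) : trig_poly f -> trig_poly (fun x => f x ^+ n).
Proof.
move=> hf; elim: n => [|n IH].
  have := trig_poly_cst 1; by congr trig_poly.
have := trig_polyM hf IH; congr trig_poly; apply/funext => x; by rewrite exprS.
Qed.

End TrigPoly.

Section MomentConvergence.
Context {R : realType}.
Variables (Q : nat -> probability (measurableTypeR R) R).
Variables (P : probability (measurableTypeR R) R).
Hypothesis Qint : forall n, integrable_moments (Q n).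
Hypothesis Pint : integrable_moments P.
Local Notation mom Q k := (\int[Q]_x x ^+ k)%R.
Hypothesis Pent : entire_coefs (fun k => mom P k / k`!%:R).
Hypothesis Qcvg : forall k, mom (Q n) k @[n --> \oo] --> mom P k.

Lemma entire_moment_small (t e : R) : 0 < e ->
  exists K : nat, `|t ^+ K.*2 / K.*2`!%:R * mom P K.*2| <= e.
Proof.
move=> e0; have t0 : 0 < 2 * (`|t| + 1) by rewrite mulr_gt0// ltr_wpDl.
have [|C hC] := Pent (e := (2 * (`|t| + 1))^-1); first by rewrite invr_gt0.
have C0 : 0 <= C by have := hC 0%N; rewrite expr0 mulr1; apply: le_trans.
have : (fun n => C * (2^-1 : R) ^+ n) @ \oo --> (0 : R).
  by rewrite -(mulr0 C); apply: cvgMl_tmp; apply: cvg_expr; rewrite ger0_norm ?invr_ge0// invf_lt1// ltr1n.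
move=> /cvgrPdist_le /(_ e e0) [K _ hK]; exists K.
have := hK K.*2; rewrite /= -addnn leq_addr => /(_ isT); rewrite addnn sub0r normrN ger0_norm; last first.
  by rewrite mulr_ge0// exprn_ge0// invr_ge0.
apply: le_trans; rewrite mulrAC -mulrA normrM.
apply: (le_trans (ler_wpM2l (normr_ge0 _) (hC _))).
rewrite mulrCA ler_wpM2l// normrX -exprMn lerXn2r// ?nnegrE ?invr_ge0//.
by rewrite ler_pdivrMr// mulrA mulVf ?mul1r ?lerDl// pnatr_eq0.
Qed.

Lemma cos_moment_cvg (s t : R) :
  (\int[Q n]_x cos (s + t * x))%R @[n --> \oo] --> (\int[P]_x cos (s + t * x))%R.
Proof.
apply/cvgrPdist_le => e e0.
(* The order is fixed by the limit law alone; convergence of the moment of order [K.*2] transfers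
   the remainder bound to [Q n], at the cost of another [e / 4]. *)
have [|K hK] := @entire_moment_small t (e / 4); first by rewrite divr_gt0.
pose c (i : nat) := cos (s + i%:R * (pi / 2)) * t ^+ i / i`!%:R.
have h1 : (\sum_(i < K.*2) c i * mom (Q n) i) @[n --> \oo] --> \sum_(i < K.*2) c i * mom P i.
  by apply: cvg_sumr => i _; apply: cvgMl_tmp; exact: Qcvg.
have h2 : (t ^+ K.*2 / K.*2`!%:R * mom (Q n) K.*2) @[n --> \oo] -->
    t ^+ K.*2 / K.*2`!%:R * mom P K.*2 by apply: cvgMl_tmp; exact: Qcvg.
have e4 : 0 < e / 4 by rewrite divr_gt0.
near=> n.
have k1 : `|\sum_(i < K.*2) c i * mom P i - \sum_(i < K.*2) c i * mom (Q n) i| <= e / 4.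
  by near: n; move/cvgrPdist_le : h1; exact.
have k2 : `|t ^+ K.*2 / K.*2`!%:R * mom P K.*2 - t ^+ K.*2 / K.*2`!%:R * mom (Q n) K.*2| <= e / 4.
  by near: n; move/cvgrPdist_le : h2; exact.
have b1 : `|(\int[P]_x cos (s + t * x))%R - \sum_(i < K.*2) c i * mom P i| <=
    t ^+ K.*2 / K.*2`!%:R * mom P K.*2 := expect_cos_taylor_le s t K Pint.
have b2 : `|(\int[Q n]_x cos (s + t * x))%R - \sum_(i < K.*2) c i * mom (Q n) i| <=
    t ^+ K.*2 / K.*2`!%:R * mom (Q n) K.*2 := expect_cos_taylor_le s t K (Qint n).
move: k1 k2 b1 b2 hK.
generalize (\sum_(i < K.*2) c i * mom P i) (\sum_(i < K.*2) c i * mom (Q n) i)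
  (t ^+ K.*2 / K.*2`!%:R * mom P K.*2) (t ^+ K.*2 / K.*2`!%:R * mom (Q n) K.*2)
  (\int[P]_x cos (s + t * x))%R (\int[Q n]_x cos (s + t * x))%R => x1 x2 z1 z2 y1 y2.
rewrite !ler_norml => /andP[? ?] /andP[? ?] /andP[? ?] /andP[? ?] /andP[? ?]; apply/andP; split; lra.
Unshelve. all: end_near. Qed.

Lemma trig_poly_cvg (f : R -> R) : trig_poly f ->
  (\int[Q n]_x f x)%R @[n --> \oo] --> (\int[P]_x f x)%R.
Proof.
elim=> [s t|{}f g hf IHf hg IHg|c {}f hf IH]; first exact: cos_moment_cvg.
- have [K hK] := trig_poly_bounded hf; have [L hL] := trig_poly_bounded hg.
  rewrite (expectD P hK hL).
  by under eq_fun do rewrite (expectD (Q _) hK hL); apply: cvgD.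
- have [K hK] := trig_poly_bounded hf.
  rewrite (expectZl P c hK).
  by under eq_fun do rewrite (expectZl (Q _) c hK); apply: cvgMl_tmp.
Qed.

End MomentConvergence.

(** * Trigonometric polynomials close to a step *)

Section StepTest.
Context {R : realType}.

Lemma bernoulli (x : R) (n : nat) : -1 <= x -> 1 + n%:R * x <= (1 + x) ^+ n.
Proof.
move=> x1; elim: n => [|n IH]; first by rewrite mul0r addr0 expr0.
have x0 : 0 <= 1 + x by rewrite -lerBlDl sub0r.
apply: le_trans (_ : (1 + x) * (1 + n%:R * x) <= _); last by rewrite exprS ler_wpM2l.
have := mulr_ge0 (ler0n R n) (sqr_ge0 x); rewrite -[n.+1%:R]natr1; nra.
Qed.

(** Bernoulli's inequality replaces [1 + n%:R * v] by [(1 + v) ^+ n], and (1 - v) (1 + v) <= 1. *)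
Lemma expr_subr1_le (v : R) (n : nat) : 0 <= v <= 1 ->
  (1 - v) ^+ n * (1 + n%:R * v) <= 1.
Proof.
move=> /andP[v0 v1]; have w0 : 0 <= 1 - v by rewrite subr_ge0.
apply: (@le_trans _ _ ((1 - v) ^+ n * (1 + v) ^+ n)).
  by rewrite ler_wpM2l ?exprn_ge0// bernoulli// (le_trans _ v0)// lerN10.
rewrite -exprMn exprn_ile1//; first by rewrite mulr_ge0// addr_ge0.
by rewrite -subr_sqr expr1n gerBl sqr_ge0.
Qed.

Lemma trig_poly_sin (c t : R) : trig_poly (fun x => sin (t * (x - c))).
Proof.
have := trig_poly_cos (- (t * c) - pi / 2) t; congr trig_poly; apply/funext => x.
have -> : - (t * c) - pi / 2 + t * x = t * (x - c) - pi / 2 by ring.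
by rewrite cosB cos_pihalf sin_pihalf mulr0 add0r mulr1.
Qed.

(* With [u = (1 + sin) / 2], the power [(1 - u ^+ N) ^+ (2 ^ N)] tends to 1 where
   [2 * u < 1] and to 0 where [2 * u > 1]. *)
Lemma step_test (c delta A eps : R) : 0 < delta < A -> 0 < eps ->
  exists h, [/\ trig_poly h, forall x, 0 <= h x <= 1,
    forall x, `|x - c| < A -> x <= c - delta -> 1 - eps <= h x &
    forall x, `|x - c| < A -> c + delta <= x -> h x <= eps].
Proof.
move=> /andP[d0 dA] e0; have A0 : 0 < A := lt_trans d0 dA.
have pi0 : 0 < pi :> R := pi_gt0 R.
(* For |x - c| < A the argument of the sine stays between -pi / 2 and pi / 2, where the sine
   increases; [s] is its value at distance [delta] from [c]. *)
pose t : R := pi / 2 / A; have t0 : 0 < t by rewrite !divr_gt0.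
have tA : t * A = pi / 2 by rewrite /t divfK// gt_eqF.
pose s := sin (t * delta).
have td : 0 < t * delta < pi / 2 by rewrite mulr_gt0//= -tA ltr_pM2l.
have s0 : 0 < s.
  by apply: sin_gt0_pi; case/andP: td => -> /lt_trans -> //; rewrite ltr_pdivrMr// mulr_natr mulr2n ltrDl.
have s1 : s <= 1 by exact: sin_le1.
pose u x : R := 2^-1 * (1 + sin (t * (x - c))).
have u01 x : 0 <= u x <= 1.
  have := sin_le1 (t * (x - c)); have := sin_geN1 (t * (x - c)); rewrite /u.
  by move: (sin _) => v *; apply/andP; split; lra.
(* Both errors will be at most 1 / (1 + N s), since 2^N u^N = (1 + sin)^N. On the left this power is
   at most (1 - s)^N <= 1 / (1 + N s); on the right it is at least (1 + s)^N >= 1 + N s, and it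
   bounds the reciprocal of the test function from below. *)
have [N hN] : exists N : nat, (1 + N%:R * s)^-1 <= eps.
  exists (Num.truncn (eps * s)^-1).+1.
  have es : 0 < eps * s by rewrite mulr_gt0.
  have h := truncnS_gt (eps * s)^-1.
  rewrite invf_ple ?posrE ?ltr_pwDl// ?mulr_ge0 ?(ltW s0)//.
  apply: (@le_trans _ _ ((Num.truncn (eps * s)^-1).+1%:R * s)); last by rewrite lerDr.
  by rewrite -ler_pdivrMr// -invfM ltW.
have tu : trig_poly u.
  apply: trig_polyZ; apply: trig_polyD; [exact: trig_poly_cst|exact: trig_poly_sin].
have mono x y : - A <= x - c -> x <= y -> y - c <= A -> sin (t * (x - c)) <= sin (t * (y - c)).
  move=> x1 xy y1; have tx : t * (x - c) <= t * (y - c) by rewrite ler_pM2l// lerB.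
  have r1 : - (pi / 2) <= t * (x - c) by rewrite -tA -mulrN ler_pM2l.
  have r2 : t * (y - c) <= pi / 2 by rewrite -tA ler_pM2l.
  rewrite leNgt ltr_sin ?in_itv/= ?r1 ?r2 ?(le_trans r1)// ?(le_trans tx)//.
  by rewrite -leNgt.
exists (fun x => (1 + (-1) * u x ^+ N) ^+ (2 ^ N)).
have uN x : 0 <= u x ^+ N <= 1.
  by case/andP: (u01 x) => a b; rewrite exprn_ge0//= exprn_ile1.
have e2 x : (2 ^ N)%:R * u x ^+ N = (1 + sin (t * (x - c))) ^+ N.
  by rewrite natrX -exprMn /u mulrA mulfV ?mul1r// pnatr_eq0.
have sN0 : 0 < 1 + N%:R * s by rewrite ltr_pwDl// mulr_ge0 ?(ltW s0).
split.
- apply: trig_polyX; apply: trig_polyD; first exact: trig_poly_cst.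
  by apply: trig_polyZ; exact: trig_polyX.
- move=> x; rewrite mulN1r; case/andP: (uN x) => a b.
  by rewrite exprn_ge0 ?subr_ge0//= exprn_ile1 ?subr_ge0// gerBl.
- move=> x; rewrite ltr_norml => /andP[x1 x2] xc.
  have hs : sin (t * (x - c)) <= - s.
    rewrite /s -sinN -mulrN; have -> : - delta = (c - delta) - c by ring.
    by apply: mono => //; [exact: ltW|rewrite addrC addKr lerNl; lra].
  rewrite mulN1r; have := @bernoulli (- u x ^+ N) (2 ^ N); rewrite mulrN e2.
  case/andP: (uN x) => a b; rewrite lerN2 => /(_ b); apply: le_trans.
  rewrite lerD2l lerN2; apply: le_trans hN.
  apply: (@le_trans _ _ ((1 - s) ^+ N)).
    by rewrite lerXn2r ?nnegrE ?subr_ge0// ?lerD2l// -[1]opprK -lerNl ?opprK addrC -lerBlDr sub0r sin_geN1.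
  by rewrite -[leRHS]mul1r ler_pdivlMr// expr_subr1_le// (ltW s0).
- move=> x; rewrite ltr_norml => /andP[x1 x2] xc.
  have hs : s <= sin (t * (x - c)).
    rewrite /s; have -> : delta = (c + delta) - c by ring.
    by apply: mono => //; [lra|exact: ltW].
  rewrite mulN1r; apply: le_trans hN; rewrite -[leRHS]mul1r ler_pdivlMr//.
  apply: le_trans (expr_subr1_le (2 ^ N) (uN x)); rewrite e2 ler_wpM2l//.
    by apply: exprn_ge0; case/andP: (uN x) => a b; rewrite subr_ge0.
  apply: (@le_trans _ _ ((1 + s) ^+ N)).
    by apply: bernoulli; apply: le_trans (ltW s0); rewrite lerN10.
  apply: (@le_trans _ _ ((1 + sin (t * (x - c))) ^+ N)); last by rewrite lerDr.
  by rewrite lerXn2r ?nnegrE ?lerD2l//; rewrite addr_ge0// ?(ltW s0)// (le_trans (ltW s0)).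
Qed.

End StepTest.

Section MomentsToCdf.
Context {R : realType}.
Variables (Q : nat -> probability (measurableTypeR R) R).
Variables (P : probability (measurableTypeR R) R).
Hypothesis Qint : forall n, integrable_moments (Q n).
Hypothesis Pint : integrable_moments P.
Local Notation mom Q k := (\int[Q]_x x ^+ k)%R.
Hypothesis Pent : entire_coefs (fun k => mom P k / k`!%:R).
Hypothesis Qcvg : forall k, mom (Q n) k @[n --> \oo] --> mom P k.

Let admissible (g : R -> R) : Prop :=
  [/\ forall n, (Q n).-integrable setT (EFin \o g), P.-integrable setT (EFin \o g) &
      (\int[Q n]_x g x)%R @[n --> \oo] --> (\int[P]_x g x)%R].

(** The polynomial [h] approximates the step only for |x - c| < A. The quadratic [q] exceeds 1
    beyond that range and is at least [eps / 2] everywhere, so it absorbs both the uncontrolled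
    region and the error of [h] near [c]. *)
Lemma step_approx (c delta eps : R) : 0 < delta -> 0 < eps ->
  exists h q, [/\ admissible h, admissible q, (\int[P]_x q x)%R <= eps,
    forall x, \1_`]-oo, c - delta] x <= h x + q x &
    forall x, h x <= \1_`]-oo, c + delta] x + q x].
Proof.
move=> d0 e0; pose M := (\int[P]_x ((x - c) ^+ 2))%R.
have M0 : 0 <= M by apply: expect_ge0 => x; exact: sqr_ge0.
(* As A^2 >= A >= 2 M / eps, the quadratic part of [q] has integral M / A^2 <= eps / 2. *)
pose A := delta + 1 + 2 * M / eps.
have A0 : 0 <= 2 * M / eps by rewrite !mulr_ge0// invr_ge0 ltW.
have A1 : 1 <= A by rewrite /A; lra.
have dA : 0 < delta < A by rewrite d0/= /A; lra.
have eps2 : 0 < eps / 2 by rewrite divr_gt0.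
have [h [th h01 hl hr]] := step_test c dA eps2.
pose b (i : nat) : R := if i == 0 then eps / 2 + c ^+ 2 / A ^+ 2 else
  if i == 1 then - (2 * c) / A ^+ 2 else (A ^+ 2)^-1.
pose q x : R := \sum_(i < 3) b i * x ^+ i.
have A20 : A != 0 by rewrite gt_eqF// (lt_le_trans _ A1).
have qE x : q x = eps / 2 + (x - c) ^+ 2 / A ^+ 2.
  by rewrite /q !big_ord_recr big_ord0 /b /= expr0 expr1; field.
have adm_q : admissible q.
  split=> [n||].
  - exact: (@integrable_lincomb _ (Q n) (fun i x => x ^+ i) b 3 (Qint n)).1.
  - exact: (@integrable_lincomb _ P (fun i x => x ^+ i) b 3 Pint).1.
  rewrite (@integrable_lincomb _ P (fun i x => x ^+ i) b 3 Pint).2.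
  under eq_fun do rewrite (@integrable_lincomb _ (Q _) (fun i x => x ^+ i) b 3 (Qint _)).2.
  by apply: cvg_sumr => i _; apply: cvgMl_tmp; exact: Qcvg.
have adm_h : admissible h.
  have [K hK] := trig_poly_bounded th.
  split; [by move=> n; exact: (bounded_mfun_integrable (Q n) hK)|exact: (bounded_mfun_integrable P hK)|].
  exact: (trig_poly_cvg Qint Pint Pent Qcvg th).
have far x : A <= `|x - c| -> 1 <= q x.
  move=> Ax; rewrite qE; apply: (@le_trans _ _ ((x - c) ^+ 2 / A ^+ 2)); last by rewrite lerDr ltW.
  rewrite ler_pdivlMr ?exprn_gt0 ?(lt_le_trans _ A1)// mul1r -[leRHS]ger0_norm ?sqr_ge0//.
  by rewrite normrX lerXn2r// ?nnegrE// (le_trans ler01).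
have q0 x : eps / 2 <= q x by rewrite qE lerDl divr_ge0// sqr_ge0.
exists h, q; split => //.
- have [_ iq _] := adm_q; have Pi2 : P.-integrable setT (EFin \o (fun x => (x - c) ^+ 2)).
    pose b' (i : nat) : R := if i == 0 then c ^+ 2 else if i == 1 then - (2 * c) else 1.
    have := (@integrable_lincomb _ P (fun i x => x ^+ i) b' 3 Pint).1.
    congr (P.-integrable setT _); apply/funext => x /=; congr (_%:E).
    by rewrite !big_ord_recr big_ord0 /b' /= expr0 expr1; ring.
  have i1 : P.-integrable setT (EFin \o (fun _ : measurableTypeR R => eps / 2)).
    exact: (bounded_mfun_integrable P (bounded_mfun_cst (eps / 2))).
  have i2 : P.-integrable setT (EFin \o (fun x => (A ^+ 2)^-1 * (x - c) ^+ 2)).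
    have := integrableZl measurableT ((A ^+ 2)^-1) Pi2.
    by congr (P.-integrable setT _).
  have -> : (\int[P]_x q x)%R = (\int[P]_x (eps / 2 + (A ^+ 2)^-1 * (x - c) ^+ 2))%R.
    by apply: eq_Rintegral => x _; rewrite qE [_ / A ^+ 2]mulrC.
  have ec : (\int[P]_x (eps / 2))%R = eps / 2 := expect_cst P (eps / 2).
  rewrite (RintegralD measurableT i1 i2) ec (RintegralZl _ measurableT Pi2) -/M.
  rewrite [leRHS](splitr eps) lerD2l mulrC ler_pdivrMr ?exprn_gt0 ?(lt_le_trans _ A1)//.
  apply: (@le_trans _ _ (eps / 2 * (2 * M / eps))).
    by rewrite le_eqVlt; apply/orP; left; apply/eqP; field; rewrite gt_eqF.
  rewrite ler_wpM2l ?(ltW eps2)//; apply: (@le_trans _ _ A); first by rewrite /A lerDr; lra.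
  by rewrite expr2 ler_peMl// (le_trans ler01).
- move=> x; rewrite indicE; have [Ax|Ax] := leP A `|x - c|.
    apply: (@le_trans _ _ 1); first by rewrite lern1 leq_b1.
    by have := far _ Ax; have /andP[+ _] := h01 x; lra.
  case: (boolP (x \in _)) => /=; last first.
    by move=> _; have := q0 x; have /andP[+ _] := h01 x; lra.
  rewrite inE/= in_itv/= => xc; have := hl x Ax xc; have := q0 x; lra.
- move=> x; rewrite indicE; have [Ax|Ax] := leP A `|x - c|.
    apply: (@le_trans _ _ (q x)); last by rewrite lerDr.
    by have := far _ Ax; have /andP[_ +] := h01 x; lra.
  case: (boolP (x \in _)) => /=.
    by move=> _; have := q0 x; have /andP[_ +] := h01 x; lra.
  rewrite notin_setE/= in_itv/= => /negP; rewrite -ltNge => /ltW xc.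
  by have := hr x Ax xc; have := q0 x; lra.
Qed.

Let cdf (mu : probability (measurableTypeR R) R) (x : R) : R := fine (mu `]-oo, x]%classic).

Lemma moments_cdf_cvg (x : R) :
  (forall e, 0 < e -> exists2 delta, 0 < delta &
     cdf P (x + delta) <= cdf P x + e /\ cdf P x - e <= cdf P (x - delta)) ->
  cdf (Q n) x @[n --> \oo] --> cdf P x.
Proof.
have dist (e u v : R) : `|u - v| <= e / 5 -> v <= u + e / 5 /\ u - e / 5 <= v.
  by rewrite ler_norml => /andP[? ?]; split; lra.
(* Five errors of [e / 5]: the convergence of the integrals of [h] and of [q], the limit integral of
   [q] counted twice, and the continuity of the limit distribution function. *)
have upper (e F Fn Fp hP hQ qP qQ : R) : Fn <= hQ + qQ -> hQ <= hP + e / 5 ->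
    qQ <= qP + e / 5 -> qP <= e / 5 -> hP <= Fp + qP -> Fp <= F + e / 5 -> Fn <= F + e.
  by move=> *; lra.
have lower (e F Fn Fm hP hQ qP qQ : R) : hQ <= Fn + qQ -> hP - e / 5 <= hQ ->
    qQ <= qP + e / 5 -> qP <= e / 5 -> Fm <= hP + qP -> F - e / 5 <= Fm -> F - e <= Fn.
  by move=> *; lra.
move=> hP; apply/cvgrPdist_le => e e0.
have e5 : 0 < e / 5 by rewrite divr_gt0.
have [delta d0 [hd1 hd2]] := hP _ e5.
have d2 : 0 < delta / 2 by rewrite divr_gt0.
(* Centring the steps at [x + delta / 2] and [x - delta / 2] puts their transitions exactly on
   [x, x + delta] and [x - delta, x]. *)
have [h [q [[hQ hP' hc] [qQ qP qc] qe h1 h2]]] := step_approx (x + delta / 2) d2 e5.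
have [h' [q' [[hQ' hP'' hc'] [qQ' qP' qc'] qe' h1' h2']]] := step_approx (x - delta / 2) d2 e5.
have cE mu y : cdf mu y = (\int[mu]_z \1_`]-oo, y] z)%R by rewrite expect_indic.
have iI (mu : probability (measurableTypeR R) R) (y : R) :
    mu.-integrable setT (EFin \o (\1_`]-oo, y] : R -> R)).
  by apply: (bounded_mfun_integrable mu); apply: bounded_mfun_indic.
have intD (mu : probability (measurableTypeR R) R) (f g : R -> R) :
    mu.-integrable setT (EFin \o f) -> mu.-integrable setT (EFin \o g) ->
    mu.-integrable setT (EFin \o (fun x => f x + g x)).
  by move=> fi gi; have := integrableD measurableT fi gi; congr (mu.-integrable setT _).
have le1 (mu : probability (measurableTypeR R) R) (f g k : R -> R) : mu.-integrable setT (EFin \o f) ->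
    mu.-integrable setT (EFin \o g) -> mu.-integrable setT (EFin \o k) ->
    (forall z, f z <= g z + k z) ->
    (\int[mu]_z f z <= \int[mu]_z g z + \int[mu]_z k z)%R.
  by move=> fi gi ki hle; rewrite -RintegralD//; apply: le_Rintegral => //; exact: intD.
have e1 : x + delta / 2 - delta / 2 = x by rewrite addrK.
have e2 : x + delta / 2 + delta / 2 = x + delta by rewrite -addrA -splitr.
have e3 : x - delta / 2 + delta / 2 = x by rewrite subrK.
have e4 : x - delta / 2 - delta / 2 = x - delta by rewrite -addrA -opprD -splitr.
rewrite e1 in h1; rewrite e2 in h2; rewrite e4 in h1'; rewrite e3 in h2'.
near=> n.
have a1 := le1 (Q n) _ _ _ (iI _ x) (hQ n) (qQ n) h1.
have a2 := le1 P _ _ _ hP' (iI _ (x + delta)) qP h2.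
have a3 := le1 (Q n) _ _ _ (hQ' n) (iI _ x) (qQ' n) h2'.
have a4 := le1 P _ _ _ (iI _ (x - delta)) hP'' qP' h1'.
rewrite -cE in a1; rewrite -cE in a2; rewrite -cE in a3; rewrite -cE in a4.
have b1 : `|(\int[P]_z h z)%R - (\int[Q n]_z h z)%R| <= e / 5.
  by near: n; move/cvgrPdist_le : hc; exact.
have b2 : `|(\int[P]_z q z)%R - (\int[Q n]_z q z)%R| <= e / 5.
  by near: n; move/cvgrPdist_le : qc; exact.
have b3 : `|(\int[P]_z h' z)%R - (\int[Q n]_z h' z)%R| <= e / 5.
  by near: n; move/cvgrPdist_le : hc'; exact.
have b4 : `|(\int[P]_z q' z)%R - (\int[Q n]_z q' z)%R| <= e / 5.
  by near: n; move/cvgrPdist_le : qc'; exact.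
have [? _] := dist _ _ _ b1; have [? _] := dist _ _ _ b2.
have [_ ?] := dist _ _ _ b3; have [? _] := dist _ _ _ b4.
rewrite ler_norml lerNl opprB lerBlDl; apply/andP; split.
  exact: (upper e _ _ _ _ _ _ _ a1 _ _ qe a2 hd1).
by rewrite lerBlDl -lerBlDr; exact: (lower e _ _ _ _ _ _ _ a3 _ _ qe' a4 hd2).
Unshelve. all: end_near. Qed.

End MomentsToCdf.

(** * Continuity of the normal distribution function *)

Section NormalCdf.
Context {R : realType}.
Local Notation N := (normal_prob (0 : R) 1).

(** The density is at most its peak, which serves as a Lipschitz constant. *)
Lemma normal_cdf_lipschitz (a b : R) : a <= b ->
  fine (N `]-oo, a]%classic) <= fine (N `]-oo, b]%classic) <=
  fine (N `]-oo, a]%classic) + normal_peak 1 * (b - a).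
Proof.
move=> ab.
have e : N `]-oo, b]%classic = (N `]-oo, a]%classic + N `]a, b]%classic)%E.
  rewrite -measureU//; first by congr (N _); rewrite -itv_bndbnd_setU// bnd_simp.
  by apply/seteqP; split => // z /= []; rewrite !in_itv/= => za /andP[/(le_lt_trans za)]; rewrite ltxx.
have fN A : measurable A -> N A \is a fin_num by move=> mA; exact: fin_num_measure.
have -> : fine (N `]-oo, b]%classic) = fine (N `]-oo, a]%classic) + fine (N `]a, b]%classic).
  by rewrite e fineD ?fN.
rewrite lerDl lerD2l fine_ge0//=.
rewrite -lee_fin fineK ?fN//.
have <- : (\int[lebesgue_measure]_(x in `]a, b]) (normal_peak 1)%:E)%E = (normal_peak 1 * (b - a))%:E; last first.
  apply: ge0_le_integral => //.
  - by move=> x _; rewrite lee_fin normal_pdf_ge0.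
  - by apply/measurable_EFinP; apply: measurable_funTS; exact: measurable_normal_pdf.
  - by move=> x _; rewrite lee_fin normal_pdf_ub// oner_neq0.
have lab : lebesgue_measure `]a, b]%classic = (b - a)%:E.
  rewrite lebesgue_measure_itv/= lte_fin; case: ltP => // ba.
  by have -> : b = a; [apply/eqP; rewrite eq_le ba|rewrite subrr].
transitivity ((normal_peak 1)%:E * lebesgue_measure `]a, b]%classic)%E.
  exact: (integral_cst lebesgue_measure).
by rewrite lab EFinM.
Qed.

Lemma normal_cdf_continuous (x e : R) : 0 < e -> exists2 delta, 0 < delta &
  fine (N `]-oo, x + delta]%classic) <= fine (N `]-oo, x]%classic) + e /\
  fine (N `]-oo, x]%classic) - e <= fine (N `]-oo, x - delta]%classic).
Proof.
move=> e0; have p0 : 0 < normal_peak (1 : R) by rewrite normal_peak_gt0// oner_neq0.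
exists (e / normal_peak 1); first by rewrite divr_gt0.
have d0 : 0 <= e / normal_peak 1 :> R by rewrite divr_ge0// ltW.
have pe : normal_peak 1 * (e / normal_peak 1) = e by rewrite mulrC divfK// gt_eqF.
split.
  have le1 : x <= x + e / normal_peak 1 by rewrite lerDl.
  by have /andP[_ +] := normal_cdf_lipschitz le1; rewrite addrAC subrr add0r pe.
have le2 : x - e / normal_peak 1 <= x by rewrite gerBl.
by have /andP[_ +] := normal_cdf_lipschitz le2; rewrite opprB addrCA subrr addr0 pe lerBlDr.
Qed.

End NormalCdf.

(** * Cumulants of the standardized sum *)

Lemma bounded_mfun_prod {d} {T : measurableType d} {R : realType} (I : Type)
    (s : seq I) (Q : pred I) (h : I -> T -> R) (K : R) :
  (forall i, bounded_mfun (h i) K) ->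
  bounded_mfun (fun x => \prod_(i <- s | Q i) h i x) (\prod_(i <- s | Q i) K).
Proof.
move=> hK; elim: s => [|i s IH].
  have -> : (fun x => \prod_(i <- [::] | Q i) h i x) = cst 1.
    by apply/funext => x; rewrite big_nil.
  by rewrite big_nil -{2}(@normr1 R); exact: bounded_mfun_cst.
rewrite big_cons; case: (boolP (Q i)) => Qi.
  have := bounded_mfunM (hK i) IH; congr bounded_mfun; apply/funext => x.
  by rewrite big_cons Qi.
by move: IH; congr bounded_mfun; apply/funext => x; rewrite big_cons (negPf Qi).
Qed.

Lemma bounded_mfunX {d} {T : measurableType d} {R : realType} (g : T -> R)
    (K : R) (i : nat) :
  bounded_mfun g K -> bounded_mfun (fun x => g x ^+ i) (K ^+ i).
Proof.
move=> gK; have := bounded_mfun_prod (index_iota 0 i) xpredT (fun _ : nat => gK).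
rewrite prodr_const_nat subn0; congr bounded_mfun; apply/funext => x.
by rewrite prodr_const_nat subn0.
Qed.

Section SampleCumulants.
Context {R : realType} {r n : nat}.
Variables (mu : probability (n.-tuple R) R) (m : nat) (b K : R).
Hypothesis mix : gap_mixing mu m b.
Hypothesis b0 : 0 <= b.
Hypothesis m0 : (0 < m)%N.
Hypothesis n0 : (0 < n)%N.
Variable y : r.-tuple 'I_n -> n.-tuple R -> R.
Hypothesis yK : forall j, bounded_mfun (y j) K.
Hypothesis ydep : forall j, depends_only (mem j) (y j).
Local Notation J := (r.-tuple 'I_n).
Local Notation Ex f := (\int[mu]_x f x)%R.
Variables (k' : nat).
Local Notation k := k'.+1.

Let Y (j : {ffun 'I_k -> J}) (S : {set 'I_k}) (x : n.-tuple R) : R :=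
  \prod_(a in S) y (j a) x.

Let e (j : {ffun 'I_k -> J}) (S : {set 'I_k}) : R := Ex (Y j S).

Let YK j S : bounded_mfun (Y j S) (K ^+ #|S|).
Proof. by rewrite -prodr_const; apply: bounded_mfun_prod. Qed.

Let times (j : {ffun 'I_k -> J}) (S : {set 'I_k}) : {set 'I_n} :=
  finset (fun i => [exists a in S, i \in j a]).

Let card_times j S : (#|times j S| <= #|S| * r)%N.
Proof.
apply: (@leq_trans (\sum_(a in S) #|[pred i | i \in j a]|)).
  rewrite -sum1_card; apply: (@leq_trans (\sum_(i : 'I_n) \sum_(a in S) (i \in j a : nat))).
    rewrite [leqLHS]big_mkcond; apply: leq_sum => i _; case: ifP => //.
    by rewrite inE => /exists_inP[a aS ia]; rewrite (bigD1 a)//= ia.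
  rewrite exchange_big; apply: leq_sum => a _; rewrite -sum1_card [leqRHS]big_mkcond.
  exact: leq_sum.
rewrite -sum_nat_const; apply: leq_sum => a _.
by rewrite -[X in (_ <= X)%N](size_tuple (j a)); exact: card_size.
Qed.

Let Ydep j S : depends_only (mem (times j S)) (Y j S).
Proof.
move=> x x' xx; apply: eq_bigr => a aS; apply: ydep => i ia; apply: xx.
by rewrite /= inE; apply/exists_inP; exists a.
Qed.

(** Groups of multi-indices without close pairs occupy sets of times that are [m] apart, though
    possibly interlaced, with at most [k * r] times in total; this number is the factor in the
    error. *)
Let split_le (j : {ffun 'I_k -> J}) (A : {set 'I_k}) :
  (forall p q, p \in A -> q \notin A -> ~~ close_tuples m (j p) (j q)) ->
  forall S, `|e j S - e j (S :&: A)%SET * e j (S :\: A)%SET| <=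
    (4 * b * (k * r)%:R) * K ^+ #|S|.
Proof.
move=> hA S; pose S1 := (S :&: A)%SET; pose S2 := (S :\: A)%SET.
have K0 : 0 <= K ^+ #|S| by exact: le_trans (normr_ge0 _) (expect_norm_le mu (YK j S)).
have cS : (#|S1| + #|S2| = #|S|)%N by rewrite cardsID.
pose g (u : n.-tuple R * n.-tuple R) := Y j S1 u.1 * Y j S2 u.2.
have gK : bounded_mfun g (K ^+ #|S|).
  rewrite -cS exprD; apply: bounded_mfunM; have [m1 k1] := YK j S1; have [m2 k2] := YK j S2.
    by split => [|u]; [exact: measurableT_comp|exact: k1].
  by split => [|u]; [exact: measurableT_comp|exact: k2].
have far : far_apart m (times j S1) (times j S2).
  move=> i i'; rewrite !inE => /exists_inP[a aS ia] /exists_inP[a' aS' ia'].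
  move: aS aS'; rewrite !inE => /andP[_ aA] /andP[aA' _].
  have := hA _ _ aA aA'; rewrite negb_exists => /forallP h.
  have /tnthP[p ->] := ia; have /tnthP[q ->] := ia'.
  have := h p; rewrite negb_exists => /forallP /(_ q); rewrite negb_and -!leqNgt.
  by case/orP; [right|left].
have := interlaced_expect_le mix b0 m0 gK far.
have d1 z : depends_only (mem (times j S1)) (fun x => g (x, z)).
  by move=> x x' xx; rewrite /g /= (Ydep xx).
have d2 z : depends_only (mem (times j S2)) (fun x => g (z, x)).
  by move=> x x' xx; rewrite /g /= (Ydep xx).
move=> /(_ d1 d2).
have -> : Ex (fun x => g (x, x)) = e j S.
  by apply: eq_Rintegral => x _; rewrite /g /= /Y -big_setID.
have -> : Ex (fun x => Ex (fun z => g (x, z))) = e j S1 * e j S2.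
  transitivity (Ex (fun x => e j S2 * Y j S1 x)).
    by apply: eq_Rintegral => x _; rewrite /g /= (expectZl mu _ (YK j S2)) mulrC.
  by rewrite (expectZl mu _ (YK j S1)) mulrC.
move=> /le_trans; apply; rewrite -!mulrA ler_wpM2l// mulrCA ler_wpM2l// mulrC ler_wpM2r//.
rewrite ler_nat; apply: (leq_trans (leq_add (card_times _ _) (card_times _ _))).
by rewrite -mulnDl cS leq_mul2r (leq_trans (max_card _)) ?card_ord ?orbT.
Qed.

Lemma sample_cumulant_le (kap : nat -> R) :
  cumulants_of (fun i => Ex (fun x => (\sum_j y j x) ^+ i)) kap ->
  `|kap k| <= (2 * (1 + 2 ^+ k)) ^+ k * K ^+ k *
    ((k ^ 2 * (r ^ 2 * (m.*2 * n ^ r.-1)))%:R ^+ k' * (n ^ r)%:R +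
     (4 * b * (k * r)%:R) * (n ^ r)%:R ^+ k).
Proof.
move=> hkap; have cJ : #|{: J}| = (n ^ r)%N by rewrite card_tuple card_ord.
have J0 : (0 < #|{: J}|)%N by rewrite cJ expn_gt0 n0.
have [j0 _] : exists j0 : J, true by case/card_gt0P: J0 => j0 _; exists j0.
have K0 : 0 <= K by exact: le_trans (normr_ge0 _) (expect_norm_le mu (yK j0)).
rewrite -cJ.
apply: (cumulant_sum_le (@card_close_tuples r n m) (e := e) K0 _ _ _ _ split_le _ hkap J0).
- by rewrite !mulr_ge0.
- move=> S j j' jj; apply: eq_Rintegral => x _; apply: eq_bigr => a aS.
  by rewrite jj.
- move=> j; rewrite -[RHS](expect_cst mu 1); apply: eq_Rintegral => x _.
  by rewrite /Y big_set0.
- by move=> j S; exact: expect_norm_le (YK j S).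
- rewrite -[RHS](expect_cst mu 1); apply: eq_Rintegral => x _.
  by rewrite expr0.
move=> S.
have [_ <-] := expect_sum mu (index_enum {ffun 'I_k -> J}) (Q := xpredT)
  (f := fun j => Y j S) (fun j _ => YK j S).
(* With factors 1 outside [S], the sum over families becomes a product over coordinates, each free
   coordinate contributing [#|J|]. *)
pose G x (a : 'I_k) (j : J) : R := if a \in S then y j x else 1.
have GE x : \sum_(j : {ffun 'I_k -> J}) Y j S x =
    #|{: J}|%:R ^+ (k - #|S|) * (\sum_j y j x) ^+ #|S|.
  transitivity (\sum_(j : {ffun 'I_k -> J}) \prod_a G x a (j a)).
    by apply: eq_bigr => j _; rewrite /Y big_mkcond.
  rewrite -bigA_distr_bigA (bigID (mem S))/= mulrC; congr (_ * _).
    rewrite (eq_bigr (fun=> #|{: J}|%:R)) => [|a /negPf aS]; last first.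
      by rewrite /G aS sumr_const.
    by rewrite prodr_const; congr (_ ^+ _); have := etrans (cardC (mem S)) (card_ord k); rewrite addnC => /(canRL (addnK _)).
  rewrite (eq_bigr (fun=> \sum_j y j x)) => [|a aS]; last by rewrite /G aS.
  by rewrite prodr_const.
have kS : (#|S| <= k)%N by rewrite (leq_trans (max_card _)) ?card_ord.
have [_ hs] := expect_sum mu (index_enum J) (Q := xpredT) (fun j _ => yK j).
have hW := (expect_sum mu (index_enum J) (Q := xpredT) (fun j _ => yK j)).1.
have hWS := bounded_mfunX #|S| hW.
have -> : #|{: J}|%:R ^+ k = #|{: J}|%:R ^+ #|S| * #|{: J}|%:R ^+ (k - #|S|) :> R.
  by rewrite -exprD subnKC.
rewrite -mulrA; congr (_ * _).
rewrite -(expectZl mu _ hWS); apply: eq_Rintegral => x _; exact: GE.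
Qed.

End SampleCumulants.

(** * Rates: the cumulant bound against the assumed quantity *)

Section Rates.
Context {R : realType}.

(** The sequence [u] is the power (k + 1) / 2 of [X]; comparing [u ^+ 2] with a natural power keeps
    all exponents integral. *)
Lemma cvg_of_sqr_expr (u X : nat -> R) (k : nat) : (forall n, 0 <= u n) ->
  (forall n, u n ^+ 2 = X n ^+ k.+1) -> X n @[n --> \oo] --> (0 : R) ->
  u n @[n --> \oo] --> (0 : R).
Proof.
move=> u0 uX X0.
have -> : u = (fun n => Num.sqrt (X n ^+ k.+1)).
  by apply/funext => n; rewrite -uX sqrtr_sqr ger0_norm.
have hc : (fun x : R => Num.sqrt (x ^+ k.+1)) x @[x --> (0 : R)] -->
    Num.sqrt ((0 : R) ^+ k.+1).
  exact: (@continuous_comp _ _ _ (fun x : R => x ^+ k.+1) Num.sqrt 0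
    (@exprn_continuous R k.+1 0) (@sqrt_continuous R _)).
have e : Num.sqrt ((0 : R) ^+ k.+1) = 0 by rewrite expr0n sqrtr0.
rewrite e in hc.
exact: cvg_comp X0 hc.
Qed.

Lemma powR_expn (x y : R) (k : nat) : 0 <= x -> (x `^ y) ^+ k = x `^ (y * k%:R).
Proof. by move=> x0; rewrite powRrM powR_mulrn// powR_ge0. Qed.

Variables (r : nat) (k' : nat).
Local Notation k := k'.+1.
Variables (F DV be : nat -> R) (m : nat -> nat) (N : nat -> nat).
Hypothesis hr : (0 < r)%N.
Hypothesis F0 : forall n, 0 <= F n.
Hypothesis DV0 : forall n, 0 < DV n.
Hypothesis be0 : forall n, 0 <= be n.

Let c : R := 2 / k%:R.

Hypothesis hlim : (F n ^+ 2 * (m n)%:R `^ (2 - c) * (N n)%:R `^ (2 * (r%:R - 1) + c)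
        * r%:R `^ (4 - 2 * c) / DV n
      + be n `^ c * (F n ^+ 2 * (N n)%:R ^+ (2 * r) / DV n))
       @[n --> \oo] --> (0 : R).

Let a n : R := F n / Num.sqrt (DV n).

Let a_sqr n : a n ^+ 2 = F n ^+ 2 / DV n.
Proof. by rewrite /a expr_div_n sqr_sqrtr// ltW. Qed.

(** For c = 2 / k the k-th power clears the real exponents: (2 - c) k = 2 (k - 1), (2 (r - 1) + c) k
    = 2 ((r - 1) k + 1) and (4 - 2 c) k = 4 (k - 1). The k-th powers of the two assumed terms are
    therefore the squares of [Z] and [Z'], which up to constants are the contributions of connected
    and of disconnected families. *)
Lemma cumulant_bound_cvg : ((2 * (1 + 2 ^+ k)) ^+ k * (2 * a n) ^+ k *
    ((k ^ 2 * (r ^ 2 * ((m n).*2 * N n ^ r.-1)))%:R ^+ k' * (N n ^ r)%:R +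
     (4 * be n * (k * r)%:R) * (N n ^ r)%:R ^+ k)) @[n --> \oo] --> (0 : R).
Proof.
pose X n := F n ^+ 2 * (m n)%:R `^ (2 - c) * (N n)%:R `^ (2 * (r%:R - 1) + c)
        * r%:R `^ (4 - 2 * c) / DV n.
pose X' n := be n `^ c * (F n ^+ 2 * (N n)%:R ^+ (2 * r) / DV n).
have X0 n : 0 <= X n by rewrite /X !mulr_ge0 ?powR_ge0 ?sqr_ge0// invr_ge0 ltW.
have X0' n : 0 <= X' n by rewrite /X' !mulr_ge0 ?powR_ge0 ?sqr_ge0 ?exprn_ge0// invr_ge0 ltW.
have cX : X n @[n --> \oo] --> (0 : R).
  apply: (squeeze_cvgr _ (cvg_cst 0) hlim); near=> n.
  by rewrite X0/= lerDl; exact: X0'.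
have cX' : X' n @[n --> \oo] --> (0 : R).
  apply: (squeeze_cvgr _ (cvg_cst 0) hlim); near=> n.
  by rewrite X0'/= lerDr; exact: X0.
have a0 n : 0 <= a n by rewrite divr_ge0// sqrtr_ge0.
pose Z n := a n ^+ k * (m n)%:R ^+ k' * (N n)%:R ^+ (r.-1 * k).+1 * r%:R ^+ (2 * k').
pose Z' n := be n * a n ^+ k * (N n)%:R ^+ (r * k).
have k0 : k%:R != 0 :> R by rewrite pnatr_eq0.
have ck : c * k%:R = 2 by rewrite /c divfK.
have cZ : Z n @[n --> \oo] --> (0 : R).
  apply: (@cvg_of_sqr_expr _ _ k') cX => n; first by rewrite /Z !mulr_ge0 ?exprn_ge0.
  have -> : X n = a n ^+ 2 * (m n)%:R `^ (2 - c) * (N n)%:R `^ (2 * (r%:R - 1) + c) * r%:R `^ (4 - 2 * c).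
    by rewrite a_sqr /X; ring.
  rewrite /Z; move: (a n) => A; rewrite !exprMn !powR_expn// -!exprM.
  have -> : (2 - c) * k%:R = (k' * 2)%:R by rewrite mulrBl ck [RHS]natrM -[k%:R]natr1; ring.
  have -> : (2 * (r%:R - 1) + c) * k%:R = ((r.-1 * k).+1 * 2)%:R.
    have rE : r%:R = r.-1%:R + 1 :> R by rewrite natr1 prednK.
    by rewrite mulrDl ck [RHS]natrM -[(r.-1 * k).+1%:R]natr1 [(r.-1 * k)%:R]natrM rE; ring.
  have -> : (4 - 2 * c) * k%:R = (2 * k' * 2)%:R.
    by rewrite mulrBl -mulrA ck [RHS]natrM [(2 * k')%:R]natrM -[k%:R]natr1; ring.
  by rewrite !powR_mulrn// [A ^+ (k * 2)]exprM expr2.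
have cZ' : Z' n @[n --> \oo] --> (0 : R).
  apply: (@cvg_of_sqr_expr _ _ k') cX' => n; first by rewrite /Z' !mulr_ge0 ?exprn_ge0.
  have -> : X' n = be n `^ c * a n ^+ 2 * (N n)%:R ^+ (2 * r).
    by rewrite a_sqr /X'; ring.
  rewrite /Z'; move: (a n) => A; rewrite !exprMn powR_expn// ck -!exprM powR_mulrn//.
  by rewrite [A ^+ (k * 2)]exprM [A ^+ k ^+ 2]expr2; congr (_ * _ * _ ^+ _); rewrite mulnC mulnA.
pose C : R := (2 * (1 + 2 ^+ k)) ^+ k * 2 ^+ k.
have -> : (fun n => (2 * (1 + 2 ^+ k)) ^+ k * (2 * a n) ^+ k *
    ((k ^ 2 * (r ^ 2 * ((m n).*2 * N n ^ r.-1)))%:R ^+ k' * (N n ^ r)%:R +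
     (4 * be n * (k * r)%:R) * (N n ^ r)%:R ^+ k)) =
   (fun n => C * ((k ^ 2)%:R ^+ k' * 2 ^+ k') * Z n + C * (4 * (k * r)%:R) * Z' n).
  apply/funext => n; rewrite /C /Z /Z'.
  have e1 : (N n)%:R ^+ (r.-1 * k).+1 = ((N n)%:R ^+ r.-1) ^+ k' * (N n)%:R ^+ r :> R.
    by rewrite -exprM -exprD; congr (_ ^+ _); rewrite mulnS -addSn prednK// addnC.
  have e2 : (N n)%:R ^+ (r * k) = ((N n)%:R ^+ r) ^+ k :> R by rewrite exprM.
  have e3 : r%:R ^+ (2 * k') = (r ^ 2)%:R ^+ k' :> R by rewrite natrX exprM.
  have e4 : (k ^ 2 * (r ^ 2 * ((m n).*2 * N n ^ r.-1)))%:R ^+ k' =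
      (k ^ 2)%:R ^+ k' * ((r ^ 2)%:R ^+ k') * 2 ^+ k' * (m n)%:R ^+ k' * ((N n)%:R ^+ r.-1) ^+ k' :> R.
    rewrite -[(N n)%:R ^+ r.-1]natrX; move: (k ^ 2)%N (r ^ 2)%N (N n ^ r.-1)%N => u v w.
    by rewrite -mul2n !natrM !exprMn !mulrA.
  have alg (c1 p2 A u v t M p q b kr w : R) :
      c1 * (p2 * A) * (u * v * t * M * p * q + 4 * b * kr * w) =
      c1 * p2 * (u * t) * (A * M * (p * q) * v) + c1 * p2 * (4 * kr) * (b * A * w) by ring.
  by rewrite e1 e2 e3 e4 [(N n ^ r)%:R]natrX [(2 * a n) ^+ k]exprMn; exact: alg.
have e0 : C * ((k ^ 2)%:R ^+ k' * 2 ^+ k') * 0 + C * (4 * (k * r)%:R) * 0 = 0 by rewrite !mulr0 addr0.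
rewrite -{}e0.
by apply: cvgD; apply: cvgMl_tmp.
Unshelve. all: end_near. Qed.
End Rates.

(** The normal moments obey the same recursion with the second cumulant 1 and all others 0, so the
    recursion passes to the limit order by order. *)
Lemma moments_of_cumulants_cvg {R : realType} (mu kap : nat -> nat -> R) :
  (forall n, cumulants_of (mu n) (kap n)) -> (forall n, mu n 0 = 1) ->
  (forall n, kap n 1 = 0) -> (forall n, kap n 2 = 1) ->
  (forall k, (3 <= k)%N -> kap n k @[n --> \oo] --> (0 : R)) ->
  forall k, mu n k @[n --> \oo] --> (normal_moment k : R).
Proof.
move=> hkap mu0 k1 k2 k3; elim/ltn_ind => -[_|k IH].
  by under eq_fun do rewrite mu0; rewrite normal_moment0; exact: cvg_cst.
under eq_fun do rewrite hkap.
have -> : normal_moment k.+1 =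
    \sum_(j < k.+1) 'C(k, j)%:R * (j == 1 :> nat)%:R * normal_moment (k - j) :> R.
  rewrite normal_moment_rec; case: k IH => [|k] _.
    by rewrite big_ord1 mulr0 mul0r.
  rewrite (bigD1 (@Ordinal k.+2 1 isT))//= bin1 mulr1 subn1/= big1 ?addr0// => i /negPf i1.
  by rewrite (_ : _ == _ = false) ?mulr0 ?mul0r//; rewrite -i1.
apply: cvg_sumr => j _; apply: cvgM; last by apply: IH; rewrite ltnS leq_subr.
apply: cvgMl_tmp; case: j => [[|[|j]] ?] /=.
- by under eq_fun do rewrite k1; exact: cvg_cst.
- by under eq_fun do rewrite k2; exact: cvg_cst.
- exact: k3.
Qed.

(** * The standardized sum as a function of the sample *)

Section OneSample.
Context {R : realType} {r n : nat} {d : measure_display} {T : measurableType d}.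
Variables (P : probability T R) (X : nat -> {RV P >-> R}) (beta : nat -> R).
Variables (f : r.-tuple 'I_n -> r.-tuple R -> R) (F : R) (m : nat).
Hypothesis n0 : (0 < n)%N.
Hypothesis m0 : (0 < m)%N.
Hypothesis hX : abs_regularity_coefs X beta.
Hypothesis beta0 : 0 <= beta m.
Hypothesis mf : forall j, measurable_fun setT (f j).
Hypothesis fF : forall j x, `|f j x| <= F.
Let V : T -> R := multi_sum X f.
Let DV : R := fine ('V_P[V])%E.
Hypothesis DV0 : 0 < DV.
Let W : T -> R := standardized P V.
Let S : {mfun T >-> n.-tuple R} := at_times X (times1 n).
Let mu := sample_law X n.
Let v (j : r.-tuple 'I_n) (x : n.-tuple R) : R := f j (map_tuple (tnth x) j).
Let c j : R := (\int[mu]_x v j x)%R.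
Let y (j : r.-tuple 'I_n) (x : n.-tuple R) : R := (Num.sqrt DV)^-1 * (v j x - c j).

Let vF j : bounded_mfun (v j) F.
Proof.
split; last by move=> x; exact: fF.
apply: (measurableT_comp (mf j)); apply/measurable_fun_tnthP => i.
rewrite (_ : _ \o _ = (fun x => tnth x (tnth j i))); first exact: measurable_tnth.
by apply/funext => x /=; rewrite tnth_map.
Qed.

Let yF j : bounded_mfun (y j) (2 * (F / Num.sqrt DV)).
Proof.
have s0 : 0 <= (Num.sqrt DV)^-1 by rewrite invr_ge0 sqrtr_ge0.
have h1 := bounded_mfunB (vF j) (bounded_mfun_cst (c j)).
have [h2 h3] := bounded_mfunM (bounded_mfun_cst (Num.sqrt DV)^-1) h1; split => // x.
apply: (le_trans (h3 x)); rewrite ger0_norm// mulrA [leRHS]mulrC ler_wpM2l//.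
by rewrite mulr_natl mulr2n lerD2l; exact: expect_norm_le (vF j).
Qed.

Let ydep j : depends_only (mem j) (y j).
Proof.
move=> x x' xx; rewrite /y /v; congr (_ * (f j _ - _)); apply: eq_from_tnth => i.
by rewrite !tnth_map; apply: xx; exact: mem_tnth.
Qed.

Let VE w : V w = \sum_j v j (S w).
Proof.
apply: eq_bigr => j _; congr (f j _); apply: eq_from_tnth => i.
transitivity (X (tnth j i).+1 w); first by rewrite /at_times !tnth_map.
by rewrite tnth_map [RHS]tnth_map tnth_mktuple.
Qed.

Let EV : fine ('E_P[V])%E = \sum_j c j.
Proof.
have [hv <-] := expect_sum mu (index_enum (r.-tuple 'I_n)) (Q := xpredT) (fun j _ => vF j).
rewrite (expect_distribution P S hv) unlock; apply: eq_Rintegral => w _.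
exact: VE.
Qed.

Let WE w : W w = \sum_j y j (S w).
Proof.
by rewrite /W /standardized EV VE -/DV -sumrB mulrC mulr_sumr.
Qed.

Let hY : bounded_mfun (fun x => \sum_j y j x) (\sum_(j : r.-tuple 'I_n) (2 * (F / Num.sqrt DV))).
Proof. exact: (expect_sum mu (index_enum _) (Q := xpredT) (fun j _ => yF j)).1. Qed.

Lemma bounded_mfun_standardized :
  bounded_mfun W (\sum_(j : r.-tuple 'I_n) (2 * (F / Num.sqrt DV))).
Proof.
have [h1 h2] := hY; have -> : W = (fun x => \sum_j y j x) \o S by apply/funext => w; exact: WE.
by split => [|w]; [exact: measurableT_comp|exact: h2].
Qed.

Let WX (i : nat) : (\int[P]_w W w ^+ i)%R = (\int[mu]_x (\sum_j y j x) ^+ i)%R.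
Proof.
have hi := bounded_mfunX i hY.
by rewrite (expect_distribution P S hi); apply: eq_Rintegral => w _; rewrite WE.
Qed.

Lemma bounded_ge0 : 0 <= F.
Proof.
have j : r.-tuple 'I_n := [tuple Ordinal n0 | i < r].
exact: le_trans (normr_ge0 _) (fF j [tuple 0 | i < r]).
Qed.

Lemma standardized_mean : (\int[P]_w W w ^+ 1)%R = 0.
Proof.
rewrite WX; have [_ h] := expect_sum mu (index_enum (r.-tuple 'I_n)) (Q := xpredT) (fun j _ => yF j).
rewrite [LHS]h big1// => j _; rewrite (expectZl mu _ (bounded_mfunB (vF j) (bounded_mfun_cst (c j)))).
rewrite (expectB mu (vF j) (bounded_mfun_cst (c j))) [X in _ - X]expect_cst -/(c j) subrr mulr0.
by [].
Qed.

Lemma standardized_variance : (\int[P]_w W w ^+ 2)%R = 1.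
Proof.
have s0 : Num.sqrt DV != 0 by rewrite gt_eqF// sqrtr_gt0.
have eDV : DV = (\int[P]_w ((Num.sqrt DV * W w) ^+ 2))%R.
  rewrite {1}/DV /variance covariance.unlock; pose e0 := fine (@expectation _ _ _ P V)%E; rewrite -/e0.
  rewrite expectation.unlock; apply: eq_Rintegral => w _.
  have -> : Num.sqrt DV * W w = V w - e0 by rewrite /W /standardized mulrC divfK.
  by rewrite expr2.
have hW := bounded_mfun_standardized; have hW2 := bounded_mfunM hW hW.
have : DV * (\int[P]_w W w ^+ 2)%R = DV * 1.
  rewrite mulr1 [RHS]eDV -(expectZl P _ hW2); apply: eq_Rintegral => w _.
  by rewrite exprMn sqr_sqrtr ?expr2// ltW.
by apply: mulfI; rewrite gt_eqF.
Qed.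

Lemma standardized_cumulant_le (kap : nat -> R) (k' : nat) (k := k'.+1) :
  cumulants_of (fun i => \int[P]_w W w ^+ i)%R kap ->
  `|kap k| <= (2 * (1 + 2 ^+ k)) ^+ k * (2 * (F / Num.sqrt DV)) ^+ k *
    ((k ^ 2 * (r ^ 2 * (m.*2 * n ^ r.-1)))%:R ^+ k' * (n ^ r)%:R +
     (4 * beta m * (k * r)%:R) * (n ^ r)%:R ^+ k).
Proof.
move=> hkap; have mix := sample_gap_mixing n0 m0 hX.
apply: (sample_cumulant_le mix beta0 m0 n0 yF ydep).
by move: hkap; congr cumulants_of; apply/funext => i; exact: WX.
Qed.

End OneSample.

Section BoundedLaw.
Context {d : measure_display} {T : measurableType d} {R : realType}.
Variables (P : probability T R) (W : T -> R) (K : R).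
Hypothesis WK : bounded_mfun W K.

(** The double sum is the expectation of the square of a polynomial in [W]. *)
Lemma moments_psd (N : nat) (g : nat -> R) :
  0 <= \sum_(i < N) \sum_(j < N) g i * g j * (\int[P]_w W w ^+ (i + j))%R.
Proof.
pose h (i j : 'I_N) w := g i * g j * W w ^+ (i + j).
have hb i j : bounded_mfun (h i j) (`|g i * g j| * K ^+ (i + j)).
  exact: bounded_mfunM (bounded_mfun_cst _) (bounded_mfunX _ WK).
have hs i := expect_sum P (index_enum 'I_N) (Q := xpredT) (fun j _ => hb i j).
have [_ h2] := expect_sum P (index_enum 'I_N) (Q := xpredT) (fun i _ => (hs i).1).
have -> : \sum_(i < N) \sum_(j < N) g i * g j * (\int[P]_w W w ^+ (i + j))%R =
    (\int[P]_w (\sum_(i < N) \sum_(j < N) h i j w))%R.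
  rewrite h2; apply: eq_bigr => i _; rewrite (hs i).2; apply: eq_bigr => j _.
  by rewrite (expectZl P _ (bounded_mfunX _ WK)).
apply: expect_ge0 => w.
have -> : \sum_(i < N) \sum_(j < N) h i j w = (\sum_(i < N) g i * W w ^+ i) ^+ 2.
  rewrite expr2 mulr_suml; apply: eq_bigr => i _; rewrite mulr_sumr; apply: eq_bigr => j _.
  by rewrite /h exprD; ring.
exact: sqr_ge0.
Qed.

End BoundedLaw.

Lemma decreases_to_0_ge0 {R : realType} (beta : nat -> R) (t : nat) :
  decreases_to_0 beta -> (0 < t)%N -> 0 <= beta t.
Proof.
move=> [hd h0] t0; rewrite leNgt; apply/negP => bt.
move/cvgrPdist_lt : h0 => /(_ (- beta t)); rewrite oppr_gt0 => /(_ bt) [N _ hN].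
have := hN (maxn N t); rewrite /= leq_maxl => /(_ isT).
have := hd t (maxn N t); rewrite t0 leq_maxr => /(_ isT) h.
by rewrite sub0r normrN ltr0_norm ?(le_lt_trans h)// ltrN2 => /lt_le_trans /(_ h); rewrite ltxx.
Qed.

(** The variables live on spaces that change with n; passing to their laws on the line brings them
    into the setting of the moment method. *)
Lemma bounded_mfun_law {d} {T : measurableType d} {R : realType}
    (P : probability T R) (W : T -> R) (K : R) : bounded_mfun W K ->
  exists Q : probability (measurableTypeR R) R, [/\ integrable_moments Q,
    forall i, (\int[Q]_x x ^+ i)%R = (\int[P]_w W w ^+ i)%R &
    forall x, Q `]-oo, x]%classic = P [set w | W w <= x]].
Proof.
move=> WK; have [mW _] := WK.
have mW' : measurable_fun [set: T] (W : T -> measurableTypeR R).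
  by move=> _ B mB; exact: mW measurableT B mB.
pose Wm : {mfun T >-> measurableTypeR R} := HB.pack W (isMeasurableFun.Build _ _ T (measurableTypeR R) W mW').
have mX (i : nat) : measurable_fun [set: measurableTypeR R] (fun x : R => (x ^+ i)%:E).
  by apply/measurable_EFinP; exact: exprn_measurable.
have iW (i : nat) : P.-integrable setT ((fun x : R => (x ^+ i)%:E) \o Wm).
  exact: (bounded_mfun_integrable P (bounded_mfunX i WK)).
exists (distribution P Wm); split.
- by move=> i; apply: integrable_pushforward.
- by move=> i; rewrite /Rintegral (integral_distribution (mX i) (iW i)).
- move=> x; congr (P _); apply/seteqP; split => w /=; rewrite in_itv//=.
Qed.

Theorem theorem3 (R : realType) (r : nat) (hr : (1 <= r)%N)
  (d : nat -> measure_display) (T : forall n, measurableType (d n))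
  (P : forall n, probability (T n) R)
  (X : forall n, nat -> {RV (P n) >-> R})
  (beta : nat -> nat -> R)
  (f : forall n, r.-tuple 'I_n -> r.-tuple R -> R)
  (F : nat -> R) (m : nat -> nat) (b0 : R)
  (V := fun n => multi_sum (X n) (f n))
  (DV := fun n => fine ('V_(P n)[V n])%E)
  (hstat : forall n, (1 <= n)%N -> strictly_stationary (X n))
  (hcoef : forall n, (1 <= n)%N -> abs_regularity_coefs (X n) (beta n))
  (hreg : forall n, (1 <= n)%N -> decreases_to_0 (beta n))
  (hfmeas : forall n (j : r.-tuple 'I_n), (1 <= n)%N ->
     measurable_fun setT (f n j))
  (hfbound : forall n (j : r.-tuple 'I_n) (x : r.-tuple R), (1 <= n)%N ->
     `|f n j x| <= F n)
  (hDV : forall n, (1 <= n)%N -> 0 < DV n)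
  (hm : forall n, (1 <= n)%N -> (1 <= m n)%N)
  (hb0 : 0 < b0 <= 2 / 3)
  (hlim : forall b : R, 0 < b <= b0 ->
     (F n ^+ 2 * (m n)%:R `^ (2 - b) * n%:R `^ (2 * (r%:R - 1) + b)
        * r%:R `^ (4 - 2 * b) / DV n
      + beta n (m n) `^ b * (F n ^+ 2 * n%:R ^+ (2 * r) / DV n))
       @[n --> \oo] --> (0 : R)) :
  (forall k : nat, (1 <= k)%N ->
     'E_(P n)[(fun w => standardized (P n) (V n) w ^+ k)%R]%E @[n --> \oo]
       --> (\int[normal_prob (0 : R) 1]_x (x ^+ k)%:E)%E) /\
  (forall x : R,
     P n [set w | standardized (P n) (V n) w <= x] @[n --> \oo]
       --> normal_prob (0 : R) 1 `]-oo, x]).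
Proof.
(* The assumptions hold from n = 1 on, so all sequences are read at [n.+1]; this shift does not
   affect limits. *)
have nP n : (1 <= n.+1)%N by [].
pose W n : T n.+1 -> R := standardized (P n.+1) (V n.+1).
have mf n j := hfmeas n.+1 j (nP n).
have fF n j x := hfbound n.+1 j x (nP n).
have be0 n : 0 <= beta n.+1 (m n.+1).
  by apply: decreases_to_0_ge0; [exact: hreg|exact: hm].
have WK n := @bounded_mfun_standardized _ _ _ _ _ (P n.+1) (X n.+1) (f n.+1) (F n.+1) (mf n) (fF n).
pose mu n k : R := (\int[P n.+1]_w W n w ^+ k)%R.
have mu0 n : mu n 0 = 1.
  rewrite -[RHS](expect_cst (P n.+1) 1); apply: eq_Rintegral => w _.
  by rewrite expr0.
have mu1 n : mu n 1 = 0 := standardized_mean (X n.+1) (mf n) (fF n).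
have mu2 n : mu n 2 = 1 := standardized_variance (mf n) (fF n) (hDV n.+1 (nP n)).
have /choice[kap hkap] : forall n, exists kap, cumulants_of (mu n) kap.
  by move=> n; exact: cumulants_of_exists.
have kap1 n : kap n 1 = 0.
  by have := hkap n 0; rewrite big_ord1 bin0 mul1r subnn mu0 mulr1 mu1.
have kap2 n : kap n 2 = 1.
  by have := hkap n 1; rewrite big_ord_recl big_ord1 /= kap1 mulr0 mul0r add0r binn mul1r mu0 mulr1 mu2.
have /andP[b00 _] := hb0.
(* From order [s] on, 2 / k <= b0, so that the assumption may be used with b = 2 / k. *)
pose s := (Num.truncn (2 / b0)).+1.
have high k : (s <= k)%N -> kap n k @[n --> \oo] --> (0 : R).
  case: k => [//|k'] sk; set k := k'.+1.
  have k0 : 0 < k%:R :> R by rewrite ltr0n.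
  have kb : 0 < (2 / k%:R : R) <= b0.
    apply/andP; split; first by rewrite divr_gt0.
    rewrite ler_pdivrMr// mulrC -ler_pdivrMr// (le_trans (ltW (truncnS_gt _)))//.
    by rewrite ler_nat.
  have := hlim _ kb; rewrite -cvg_shiftS => hl.
  have := cumulant_bound_cvg (N := fun n => n.+1) (m := fun n => m n.+1) hr
    (fun n => bounded_ge0 (nP n) (fF n)) (fun n => hDV n.+1 (nP n)) be0 hl.
  move=> /cvgrPdist_le h; apply/cvgrPdist_le => e /h.
  apply: filterS => n; rewrite !sub0r !normrN; apply: le_trans.
  apply: le_trans (ler_norm _).
  exact: (standardized_cumulant_le (nP n) (hm _ (nP n)) (hcoef _ (nP n)) (be0 n) (mf n) (fF n) k' (hkap n)).
have kap3 := janson hkap mu0 (fun n => moments_psd (P n.+1) (WK n)) kap1 kap2 high.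
have mucvg k : mu n k @[n --> \oo] --> (normal_moment k : R).
  exact: moments_of_cumulants_cvg hkap mu0 kap1 kap2 kap3 k.
split=> [k _|x].
  rewrite -cvg_shiftS.
  have -> : (\int[normal_prob (0 : R) 1]_x (x ^+ k)%:E)%E = (normal_moment k)%:E.
    rewrite /normal_moment /Rintegral fineK//.
    exact: integrable_fin_num (normal_moment_integrable k).
  have -> : (fun n => 'E_(P n.+1)[(fun w => standardized (P n.+1) (V n.+1) w ^+ k)%R]%E) =
      (fun n => (mu n k)%:E).
    apply/funext => n; rewrite expectation.unlock /mu /Rintegral fineK//.
    exact: integrable_fin_num (bounded_mfun_integrable (P n.+1) (bounded_mfunX k (WK n))).
  by apply: cvg_EFin; [near=> n|exact: mucvg].
rewrite -cvg_shiftS.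
have /choice[Q hQ] := fun n => bounded_mfun_law (P n.+1) (WK n).
have Qint n : integrable_moments (Q n) by have [] := hQ n.
have Qcvg k : (\int[Q n]_x x ^+ k)%R @[n --> \oo] --> (normal_moment k : R).
  have -> : (fun n => \int[Q n]_x x ^+ k)%R = mu ^~ k.
    by apply/funext => n; have [_ h _] := hQ n.
  exact: mucvg.
have cdf := moments_cdf_cvg Qint (@normal_moment_integrable R) (@entire_normal_moment R) Qcvg
  (@normal_cdf_continuous R x).
have -> : (fun n => P n.+1 [set w | standardized (P n.+1) (V n.+1) w <= x]) =
    (fun n => (fine (Q n `]-oo, x]%classic))%:E).
  apply/funext => n; have [_ _ h] := hQ n; rewrite fineK ?h//.
  by rewrite -h fin_num_measure.
have -> : normal_prob (0 : R) 1 `]-oo, x]%classic = (fine (normal_prob (0 : R) 1 `]-oo, x]%classic))%:E.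
  by rewrite fineK// fin_num_measure.
by apply: cvg_EFin; [near=> n|exact: cdf].
Unshelve. all: end_near. Qed.
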